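(* Let $d\ge 3$ and let $K$ be an algebraically closed field of characteristic $p$, where $p=0$ or $p>d$. Let $X_d\subset\mathbb{P}^3(K)$ be a smooth surface of degree $d$, and let $\ell(X_d)$ denote the number of lines contained in $X_d$. Then $$\ell(X_d)\le 11d^2-30d+18 .$$ *)

(* Defs.v *)
From HB Require Import structures.
From mathcomp Require Import all_boot all_order all_algebra.
Set Implicit Arguments. Unset Strict Implicit. Unset Printing Implicit Defensive.
Import Order.TTheory GRing.Theory Num.Theory.
Local Open Scope ring_scope.

(* Exponent vectors of monomials in the 4 homogeneous coordinates x_0..x_3,
   each exponent at most d. *)
Definition mon (d : nat) := {ffun 'I_4 -> 'I_d.+1}.

Definition is_degd (d : nat) (e : mon d) : bool := (\sum_(i < 4) (e i : nat))%N == d.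

(* A homogeneous quartic-variable form of degree d over K is given by its
   coefficients c e on the monomials of total degree d (coefficients of other
   exponent vectors are ignored). *)
Definition hform (K : fieldType) (d : nat) := mon d -> K.

Definition heval (K : fieldType) (d : nat) (c : hform K d) (x : 'rV[K]_4) : K :=
  \sum_(e : mon d | is_degd e) c e * \prod_(j < 4) x 0 j ^+ e j.

Definition hderiv (K : fieldType) (d : nat) (c : hform K d) (i : 'I_4) (x : 'rV[K]_4) : K :=
  \sum_(e : mon d | is_degd e)
     c e * (e i : nat)%:R * x 0 i ^+ (e i).-1 * \prod_(j < 4 | j != i) x 0 j ^+ e j.

(* The projective surface V(F) in P^3 is smooth: no nonzero x with F(x)=0 and
   all partials vanishing (Jacobian criterion). *)
Definition smooth_surface (K : fieldType) (d : nat) (c : hform K d) : Prop :=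
  forall x : 'rV[K]_4, x != 0 ->
    ~ (heval c x = 0 /\ forall i : 'I_4, hderiv c i x = 0).

(* A line in P^3 is the row space of a rank-2 2x4 matrix; it lies on V(F)
   when F vanishes on every vector of that 2-dimensional subspace. *)
Definition is_line (K : fieldType) (A : 'M[K]_(2, 4)) : bool := \rank A == 2%N.

Definition line_on (K : fieldType) (d : nat) (c : hform K d) (A : 'M[K]_(2, 4)) : Prop :=
  forall u : 'rV[K]_2, heval c (u *m A) = 0.

Definition same_line (K : fieldType) (A B : 'M[K]_(2, 4)) : bool := (A == B)%MS.

(* Main.v *)
Require Import Defs.
From HB Require Import structures.
From mathcomp Require Import all_boot all_order all_algebra.
From mathcomp Require Import perm polyXY ring zify.
From mathcomp.multinomials Require Import mpoly.
From Stdlib Require Import Classical.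
Set Implicit Arguments.
Unset Strict Implicit.
Unset Printing Implicit Defensive.
Import GRing.Theory.
Local Open Scope ring_scope.
Local Notation "p ;; i" := (p^`M(i)) (at level 3, left associativity).

(** The flecnodal covariant [flec f] of Salmon and Clebsch has degree [11 d - 24]; at a point of
    the surface it vanishes iff some tangent direction has contact of order at least four, so it
    vanishes along every line of the surface. A smooth [f] is prime, and [f] does not divide
    [flec f] once the surface contains a line: otherwise the flecnodal directions would form a
    rational field of rulings, against smoothness.

    Along a line [L] let [Omega] be the derivative of [flec f] in the tangent direction transverse
    to [L]. Call [L] simple if [Omega] does not vanish identically. Then:
    - a general plane section of [flec f = 0] gives [n_s + 2 n_m <= d (11 d - 24)] for the numbers
      of simple and of other lines;
    - [Omega], a form of degree [12 d - 26] on [L], is up to a power of a partial derivative of [f]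
      the product of a Schwarzian derivative of the Gauss map, which is nonzero, and of a form [Q]
      of degree [8 d - 14]; [Q] vanishes to order [j] at a point lying on [j] other lines, so a
      simple line meets at most [8 d - 14] others;
    - eliminating between [f] and [flec f] by projection from a point of a line [B] shows that at
      most [(d - 1) (11 d - 25)] lines are skew to [B]; if a simple line [L] meets [B], the zeros of
      [Omega] on [L] not accounted for by lines meeting [L] improve this bound.

    If some simple line meets at most [6 d - 8] others, the third bound suffices. Otherwise either
    two simple neighbours of a simple line span different planes with it, and the improved third
    bound applies to one of them, or the simple neighbours of each simple line lie in one plane;
    then there are so many non-simple lines that the first bound suffices. *)

(** * Unique factorisation in polynomial rings *)

(** The bound is [1 + (6 d - 8) + (d - 1) (11 d - 25)]: a line, its neighbours, the lines skew to
    it. The threshold [6 d - 8] balances this case with the other tight one: at least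
    [(12 d - 26) - (8 d - 14) = 4 d - 12] zeros of [Omega] belong to no neighbour, two neighbours in
    different planes share them as a saving, so one saves at least [2 d - 6], and
    [8 d - 14 - (2 d - 6) = 6 d - 8]. For the plane section bound, [6 d - 18] non-simple lines
    already suffice.

    Intersection numbers appear only as degrees and orders of vanishing of polynomials in one
    variable. Every elimination is a resultant in the last coordinate whose degree is bounded by a
    weighting of the variables, and multiplicities come from Taylor expansions. The step from
    [d (11 d - 24)] to [(d - 1) (11 d - 25)] is of this kind: both forms vanish on [B], so each
    monomial loses one unit of weight. The condition on the characteristic makes the integers up to
    [d] invertible, as Taylor coefficients, the Wronskian and the Schwarzian require. *)

Definition divides (R : idomainType) (a b : R) := exists c, b = a * c.

Definition prime_elt (R : idomainType) (p : R) :=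
  [/\ p != 0, p \isn't a GRing.unit &
      forall a b, divides p (a * b) -> divides p a \/ divides p b].

Definition factors_as (R : idomainType) (a : R) (s : seq R) :=
  [/\ forall p, p \in s -> prime_elt p &
      exists2 u, u \is a GRing.unit & a = u * \prod_(p <- s) p].

(** Asking for prime factors, not merely irreducible ones, makes uniqueness automatic;
    [factors_size] extracts the part of it that is used. *)
Definition ufd (R : idomainType) :=
  forall a : R, a != 0 -> exists s, factors_as a s.

Section Divides.
Variable R : idomainType.
Implicit Types a b p : R.

Lemma divides_refl a : divides a a.
Proof. by exists 1; rewrite mulr1. Qed.

Lemma dividesMl a b c : divides a b -> divides a (c * b).
Proof. by move=> [x ->]; exists (c * x); rewrite mulrCA. Qed.

Lemma dividesMr a b c : divides a b -> divides a (b * c).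
Proof. by move=> ab; rewrite mulrC; apply: dividesMl. Qed.

Lemma dividesD a b c : divides a b -> divides a c -> divides a (b + c).
Proof. by move=> [x ->] [y ->]; exists (x + y); rewrite mulrDr. Qed.

Lemma dividesB a b c : divides a b -> divides a c -> divides a (b - c).
Proof. by move=> [x ->] [y ->]; exists (x - y); rewrite mulrBr. Qed.

Lemma prime_divides_unit p u : prime_elt p -> u \is a GRing.unit -> ~ divides p u.
Proof.
move=> [_ /negP pN _] Uu [x ux]; apply: pN.
by move: Uu; rewrite ux unitrM => /andP[].
Qed.

Lemma prime_dvd_prod p (s : seq R) :
  prime_elt p -> divides p (\prod_(q <- s) q) -> exists2 q, q \in s & divides p q.
Proof.
move=> pp; elim: s => [|q s IHs].
  by rewrite big_nil => /(prime_divides_unit pp (unitr1 R)).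
rewrite big_cons; have [_ _ h] := pp; case/h => [pq|/IHs[r rs pr]].
  by exists q; rewrite ?mem_head.
by exists r; rewrite ?inE ?rs ?orbT.
Qed.

Lemma prime_dvd_prime p q : prime_elt p -> prime_elt q -> divides p q ->
  exists2 u, u \is a GRing.unit & q = u * p.
Proof.
move=> [p0 pN hp] [q0 qN hq] [x qx].
case: (hq p x); first by rewrite -qx; apply: divides_refl.
  move=> [y py]; exists x; last by rewrite mulrC.
  have /eqP : q * (1 - y * x) = 0.
    by rewrite mulrBr mulr1 mulrA -py -qx subrr.
  rewrite mulf_eq0 (negbTE q0) subr_eq0 /= => /eqP e.
  by apply/unitrP; exists y; rewrite [x * y]mulrC -e.
move=> [y xy]; case/negP: pN.
have /eqP : q * (1 - p * y) = 0.
  by rewrite mulrBr mulr1 mulrCA -xy -qx subrr.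
rewrite mulf_eq0 (negbTE q0) subr_eq0 /= => /eqP e.
by apply/unitrP; exists y; rewrite [y * p]mulrC -e.
Qed.

Lemma factorsM a b s t :
  factors_as a s -> factors_as b t -> factors_as (a * b) (s ++ t).
Proof.
move=> [ps [u Uu ->]] [pt [v Uv ->]]; split.
  by move=> p; rewrite mem_cat => /orP[/ps|/pt].
exists (u * v); first by rewrite unitrM Uu.
by rewrite big_cat /= mulrACA.
Qed.

Lemma factors_prime p : prime_elt p -> factors_as p [:: p].
Proof.
move=> pp; split; first by move=> q; rewrite inE => /eqP->.
by exists 1; rewrite ?unitr1 // big_seq1 mul1r.
Qed.

Lemma factors_size a s t : factors_as a s -> factors_as a t -> size s = size t.
Proof.
elim: s a t => [|p s IHs] a t [ps [u Uu ->]].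
  rewrite big_nil mulr1; case: t => [//|q t] [pt [v Uv e]].
  case: (@prime_divides_unit q u (pt q (mem_head _ _)) Uu).
  by rewrite e big_cons; exists (v * \prod_(j <- t) j); rewrite mulrCA.
move=> [pt [v Uv]]; rewrite big_cons => e.
have pp := ps p (mem_head _ _).
have : divides p (v * \prod_(q <- t) q).
  by rewrite -e; apply: dividesMl; exists (\prod_(j <- s) j).
have [_ _ h] := pp; case/h => [/(prime_divides_unit pp Uv)//|].
case/(prime_dvd_prod pp) => q qt pq.
have [w Uw qw] := prime_dvd_prime pp (pt q qt) pq.
have pe := perm_to_rem qt.
rewrite (perm_size pe) /=; congr S.
apply: (IHs (u * \prod_(j <- s) j)).
  split; first by move=> r rs; apply: ps; rewrite inE rs orbT.
  by exists u.
split; first by move=> r /mem_rem; apply: pt.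
exists (v * w); first by rewrite unitrM Uv.
have [p0 _ _] := pp; apply: (mulfI p0).
rewrite mulrCA e (perm_big _ pe) big_cons /= qw; ring.
Qed.

End Divides.

Section PolyFactorial.
Variable R : idomainType.
Hypothesis R_fact : ufd R.
Implicit Types (p q f A B : {poly R}).

(** If [c] divides a product, it divides the product of the leading coefficients, hence one of them;
    subtracting that leading term lowers the total size. *)
Lemma prime_polyC (c : R) : prime_elt c -> prime_elt c%:P.
Proof.
move=> [c0 cN hc]; split; first by rewrite polyC_eq0.
  by rewrite poly_unitE coefC eqxx negb_and cN orbT.
move=> A B; move: {2}(size A + size B)%N (leqnn (size A + size B)) => n.
elim: n A B => [|n IHn] A B.
  rewrite leqn0 addn_eq0 size_poly_eq0 => /andP[/eqP-> _] _.
  by left; exists 0; rewrite mulr0.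
have [-> _ _|A0] := eqVneq A 0; first by left; exists 0; rewrite mulr0.
have [-> _ _|B0] := eqVneq B 0; first by right; exists 0; rewrite mulr0.
move=> le_n cAB.
have lower q q' : q != 0 -> divides c%:P (q * q') -> divides c (lead_coef q) ->
    exists2 r : {poly R}, (size r < size q)%N & divides c%:P (q - r) /\ divides c%:P (r * q').
  move=> q0 dqq' [x ex].
  exists (q - lead_coef q *: 'X^((size q).-1)).
    have sq : (0 < size q)%N by rewrite size_poly_gt0.
    rewrite -[X in (_ < X)%N](prednK sq) ltnS; apply/leq_sizeP => j lej.
    rewrite coefB coefZ coefXn; case: (ltngtP j (size q).-1) lej => // [lj|->] _.
      by rewrite mulr0 subr0 nth_default // -(prednK sq).
    by rewrite mulr1 subrr.
  have d : divides c%:P (lead_coef q *: 'X^((size q).-1)).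
    by exists (x *: 'X^((size q).-1)); rewrite mul_polyC ex scalerA.
  split; first by rewrite opprB addrC subrK.
  by rewrite mulrBl; apply: dividesB => //; apply: dividesMr.
have [cl|cl] : divides c (lead_coef A) \/ divides c (lead_coef B).
- by apply: hc; rewrite -lead_coefM; case: cAB => x ->; rewrite lead_coefM lead_coefC;
  exists (lead_coef x).
- have [r sr [cAr crB]] := lower A B A0 cAB cl.
  case: (IHn r B _ crB) => [|cr|]; last by right.
    by rewrite -ltnS; apply: leq_trans le_n; rewrite ltn_add2r.
  by left; rewrite -(subrK r A); apply: dividesD.
- rewrite mulrC in cAB; have [r sr [cBr crA]] := lower B A B0 cAB cl.
  rewrite mulrC in crA; case: (IHn A r _ crA) => [||cr]; last 2 [by left].
    by rewrite -ltnS; apply: leq_trans le_n; rewrite ltn_add2l.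
  by right; rewrite -(subrK r B); apply: dividesD.
Qed.

Definition primitive f := forall c : R, prime_elt c -> ~ divides c%:P f.

(** Gauss's lemma: the prime factors of [c] remain prime as constants, so each can be cancelled from
    [A] or from [B] without changing sizes. *)
Lemma Gauss_split (c : R) f A B : c != 0 -> c%:P * f = A * B ->
  exists A' B', [/\ f = A' * B', size A' = size A & size B' = size B].
Proof.
move=> /R_fact[s [ps [u Uu ->]]].
elim: s f A B ps => [|p s IHs] f A B ps.
  rewrite big_nil mulr1 => e; exists (u^-1 *: A), B.
  rewrite size_scale ?invr_eq0 ?unitr_neq0; last first.
    by apply: contraTneq Uu => ->; rewrite unitr0.
  split=> //; rewrite -scalerAl -e mul_polyC scalerA mulVr ?scale1r //.
rewrite big_cons => e.
have pp := ps p (mem_head _ _); have [p0 _ _] := pp.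
have ps' (q : R) : q \in s -> prime_elt q by move=> qs; apply: ps; rewrite inE qs orbT.
have [_ _ h] := prime_polyC pp.
have P0 : p%:P != 0 by rewrite polyC_eq0.
have e' : p%:P * ((u * \prod_(j <- s) j)%:P * f) = A * B.
  by rewrite -e !polyCM; ring.
have : divides p%:P (A * B) by rewrite -e'; exists ((u * \prod_(j <- s) j)%:P * f).
case/h=> [[A1 eA]|[B1 eB]].
- have [|A' [B' [-> sA sB]]] := IHs f A1 B ps'.
    by apply: (mulfI P0); rewrite e' eA mulrA.
  by exists A', B'; split; rewrite // sA eA size_Cmul.
- have [|A' [B' [-> sA sB]]] := IHs f A B1 ps'.
    by apply: (mulfI P0); rewrite e' eB; ring.
  by exists A', B'; split; rewrite // sB eB size_Cmul.
Qed.

Lemma primitive_divides_scale (c : R) f g : primitive f -> c != 0 ->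
  divides f (c%:P * g) -> divides f g.
Proof.
move=> fprim /R_fact[s [ps [u Uu ->]]].
elim: s g ps => [|p s IHs] g ps.
  rewrite big_nil mulr1 => -[h e]; exists (u^-1 *: h).
  by rewrite -scalerAr -e mul_polyC scalerA mulVr ?scale1r.
have pp := ps p (mem_head _ _); have [p0 _ _] := pp.
have P0 : p%:P != 0 by rewrite polyC_eq0.
rewrite big_cons => -[h e].
have [_ _ hp] := prime_polyC pp.
have e' : p%:P * ((u * \prod_(j <- s) j)%:P * g) = f * h.
  by rewrite -e !polyCM; ring.
have : divides p%:P (f * h) by rewrite -e'; exists ((u * \prod_(j <- s) j)%:P * g).
case/hp=> [/(fprim p pp)//|[h1 eh]].
apply: IHs; first by move=> q qs; apply: ps; rewrite inE qs orbT.
by exists h1; apply: (mulfI P0); rewrite e' eh; ring.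
Qed.

(** The gcd is taken over the fraction field. If [f] and [a] are coprime there, Bezout gives a
    nonzero constant multiple of [b] divisible by [f]. Otherwise the gcd has positive degree,
    [Gauss_split] makes its cofactor in [f] constant, and [f] divides a constant multiple of [a].
    Primitivity removes the constants. *)
Lemma primitive_irreducible_prime f : primitive f -> (1 < size f)%N ->
  ~ (exists A B, [/\ f = A * B, (1 < size A)%N & (1 < size B)%N]) -> prime_elt f.
Proof.
move=> fprim sf irr.
have f0 : f != 0 by rewrite -size_poly_gt0 ltnW.
split=> //; first by rewrite poly_unitE gtn_eqF.
move=> a b [h eh].
have [a0|a0] := eqVneq a 0; first by left; exists 0; rewrite a0 mulr0.
have [cop|ncop] := boolP (coprimep f a).
  have [[u v] /= e1] := Bezout_coprimepP _ _ cop.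
  have /size_poly1P[c c0 ec] : size (u * f + v * a) == 1%N.
    by rewrite (eqp_size e1) size_poly1.
  right; apply: (primitive_divides_scale fprim c0).
  by exists (u * b + v * h); rewrite -ec mulrDl -!mulrA eh; ring.
left; set g := gcdp f a in ncop.
have gf : g %| f by apply: dvdp_gcdl.
have ga : g %| a by apply: dvdp_gcdr.
have g0 : g != 0 by rewrite gcdp_eq0 (negbTE f0).
have sg : (1 < size g)%N.
  by rewrite ltn_neqAle eq_sym ncop size_poly_gt0.
have [[c x] /= c0 ex] := Pdiv.Idomain.dvdpP _ _ gf.
have [[c' y] /= c'0 ey] := Pdiv.Idomain.dvdpP _ _ ga.
have x1 : (size x <= 1)%N.
  rewrite leqNgt; apply/negP => sx; apply: irr.
  have [|A [B [-> sA sB]]] := Gauss_split (f := f) (A := x) (B := g) c0.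
    by rewrite mul_polyC.
  by exists A, B; rewrite sA sB.
have [x' x0 xx] : exists2 x', x' != 0 & x = x'%:P.
  exists x`_0; last by rewrite -size1_polyC.
  rewrite -polyC_eq0 -size1_polyC //; apply: contraNneq f0 => x0.
  by move/eqP: ex; rewrite x0 mul0r scale_poly_eq0 (negbTE c0).
have c'x : x' * c' != 0 by rewrite mulf_neq0.
apply: (primitive_divides_scale fprim c'x).
exists (c *: y); rewrite -scalerAr [f * y]mulrC scalerAr ex xx polyCM.
by rewrite mulrCA -ey mul_polyC -!mul_polyC; ring.
Qed.

Theorem ufd_poly : ufd {poly R}.
Proof.
(* The measure is the size of [f] plus the number of primes in its leading coefficient: removing a
   constant prime lowers the second term, and splitting off a nonconstant factor lowers the sum. *)
suff main N f s : f != 0 -> factors_as (lead_coef f) s ->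
    (size f + size s <= N)%N -> exists t, factors_as f t.
  move=> f f0; have lf0 : lead_coef f != 0 by rewrite lead_coef_eq0.
  by have [s fs] := R_fact lf0; apply: main fs (leqnn _).
elim: N f s => [|N IHN] f s f0 fs.
  by rewrite leqn0 addn_eq0 size_poly_eq0 (negbTE f0).
have [sf _|sf leN] := leqP (size f) 1.
  have [c fc] : exists c, f = c%:P by exists f`_0; apply: size1_polyC.
  have c0 : c != 0 by rewrite -polyC_eq0 -fc.
  have [t [pt [u Uu cu]]] := R_fact c0.
  exists (map polyC t); split=> [p /mapP[q qt ->]|]; first by apply: prime_polyC; apply: pt.
  exists u%:P; first by rewrite poly_unitE coefC eqxx size_polyC (contraTneq _ Uu) // => ->; rewrite unitr0.
  by rewrite big_map -rmorph_prod -polyCM -cu.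
have [[c pc [h fh]]|fprim] := classic (exists2 c, prime_elt c & divides c%:P f).
  have [c0 _ _] := pc.
  have h0 : h != 0 by apply: contraNneq f0 => h0; rewrite fh h0 mulr0.
  have lh0 : lead_coef h != 0 by rewrite lead_coef_eq0.
  have [t th] := R_fact lh0.
  have lt : factors_as (lead_coef f) ([:: c] ++ t).
    by rewrite fh lead_coefM lead_coefC; apply: factorsM (factors_prime pc) th.
  have est := factors_size fs lt.
  have [|t' ft'] := IHN h t h0 th.
    rewrite -ltnS; apply: leq_trans leN.
    by rewrite fh size_Cmul // est /= addnS.
  exists ([:: c%:P] ++ t'); rewrite fh.
  exact: factorsM (factors_prime (prime_polyC pc)) ft'.
have fprim' : primitive f by move=> c pc cf; apply: fprim; exists c.
have [[A [B [fAB sA sB]]]|irr] :=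
  classic (exists A B, [/\ f = A * B, (1 < size A)%N & (1 < size B)%N]); last first.
  by exists [:: f]; apply: factors_prime; apply: primitive_irreducible_prime.
have A0 : A != 0 by rewrite -size_poly_gt0 ltnW.
have B0 : B != 0 by rewrite -size_poly_gt0 ltnW.
have lA0 : lead_coef A != 0 by rewrite lead_coef_eq0.
have lB0 : lead_coef B != 0 by rewrite lead_coef_eq0.
have [a fa] := R_fact lA0; have [b fb] := R_fact lB0.
have fab : factors_as (lead_coef f) (a ++ b).
  by rewrite fAB lead_coefM; apply: factorsM.
have es := factors_size fs fab; rewrite size_cat in es.
move: leN; rewrite es fAB size_mul // => leN.
have [|t ft] := IHN A a A0 fa.
  by move: leN sB; clear; move: (size A) (size B) (size a) (size b) => x y z w; lia.
have [|t' ft'] := IHN B b B0 fb.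
  by move: leN sA; clear; move: (size A) (size B) (size a) (size b) => x y z w; lia.
by exists (t ++ t'); apply: factorsM.
Qed.
End PolyFactorial.

(** * Evaluation and substitution of multivariate polynomials *)

Section MpolyInd.
Variables (n : nat) (K : comNzRingType).

Lemma mpoly_ring_ind (P : {mpoly K[n]} -> Prop) :
  (forall c, P c%:MP) -> (forall i, P 'X_i) ->
  (forall p q, P p -> P q -> P (p + q)) -> (forall p q, P p -> P q -> P (p * q)) ->
  forall p, P p.
Proof.
move=> PC PX PD PM p.
have P0 : P 0 by rewrite -mpolyC0; apply: PC.
have P1 : P 1 by rewrite -mpolyC1; apply: PC.
rewrite (mpolyE p); elim/big_rec: _ => [|m q _ Pq]; first by []. apply: (PD) => //.
rewrite -mul_mpolyC mpolyXE_id; apply: (PM) => //.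
elim/big_rec: _ => // i r _ Pr; apply: (PM) => //.
by elim: (m i) => [|k IHk]; rewrite ?expr0 // exprS; apply: (PM).
Qed.

End MpolyInd.

Section Mev.
Variables (K S : comNzRingType) (phi : {rmorphism K -> S}) (n : nat).

(** Evaluation in an arbitrary ring under [phi]: the same map gives values at points, restrictions
    to lines, linear substitutions, pencils of planes and formal arcs. *)
Definition mev (x : 'rV[S]_n) (p : {mpoly K[n]}) : S := mmap phi (fun i => x 0 i) p.

Variable x : 'rV[S]_n.

HB.instance Definition _ := GRing.RMorphism.copy (mev x) (mmap phi (fun i => x 0 i)).

Lemma mevC c : mev x c%:MP = phi c.
Proof. exact: mmapC. Qed.

Lemma mevX i : mev x 'X_i = x 0 i.
Proof. by rewrite /mev mmapX mmap1U. Qed.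

Lemma mevZ c p : mev x (c *: p) = phi c * mev x p.
Proof. exact: mmapZ. Qed.

Lemma mev_unique (g : {rmorphism {mpoly K[n]} -> S}) :
  (forall c, g c%:MP = phi c) -> (forall i, g 'X_i = x 0 i) -> g =1 mev x.
Proof.
move=> gC gX; apply: mpoly_ring_ind => [c|i|p q ep eq|p q ep eq].
- by rewrite gC mevC.
- by rewrite gX mevX.
- by rewrite !rmorphD ep eq.
- by rewrite !rmorphM ep eq.
Qed.

(** The chain rule for any derivation of [S] that kills the constants: formal derivatives, partial
    derivatives after substitution, and directional derivatives acting on coefficients are all
    instances. *)
Lemma mev_derivation (D : S -> S) :
  (forall a b, D (a + b) = D a + D b) -> (forall a b, D (a * b) = D a * b + a * D b) ->
  (forall c, D (phi c) = 0) ->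
  forall p, D (mev x p) = \sum_i D (x 0 i) * mev x p^`M(i).
Proof.
move=> DD DM DC; apply: mpoly_ring_ind => [c|i|p q ep eq|p q ep eq].
- by rewrite mevC DC big1 // => i _; rewrite mderivC rmorph0 mulr0.
- rewrite mevX (bigD1 i) //= big1 ?addr0 => [|j ji].
    rewrite mderivX mnm1E eqxx scale1r.
    have -> : (U_(i) - U_(i) = 0)%MM by apply/mnmP => k; rewrite mnmBE subnn mnm0E.
    by rewrite mpolyX0 rmorph1 mulr1.
  by rewrite mderivX mnm1E eq_sym (negbTE ji) scale0r rmorph0 mulr0.
- rewrite rmorphD DD ep eq -big_split /=; apply: eq_bigr => i _.
  by rewrite mderivD rmorphD mulrDr.
- rewrite rmorphM DM ep eq mulr_suml mulr_sumr -big_split /=.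
  by apply: eq_bigr => i _; rewrite mderivM rmorphD !rmorphM /=; ring.
Qed.

End Mev.

Lemma mev_morph (K S T : comNzRingType) (phi : {rmorphism K -> S})
  (psi : {rmorphism K -> T}) (g : {rmorphism S -> T}) n (x : 'rV[S]_n) :
  (forall c, g (phi c) = psi c) ->
  forall p, g (mev phi x p) = mev psi (map_mx g x) p.
Proof.
move=> e p; apply: (@mev_unique _ _ psi n (map_mx g x) (g \o mev phi x)) => [c|i] /=.
  by rewrite mevC.
by rewrite mevX mxE.
Qed.

Section Muni.
Variables (n : nat) (K : comNzRingType).

Definition row_init (S : Type) (x : 'rV[S]_n.+1) : 'rV[S]_n :=
  \row_i x 0 (widen_ord (leqnSn n) i).

Lemma muni_widen i : muni ('X_(widen_ord (leqnSn n) i) : {mpoly K[n.+1]}) = ('X_i)%:P.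
Proof.
rewrite muniE msuppX big_seq1 mcoeffX eqxx scale1r.
rewrite mnm1E; have -> : (widen_ord (leqnSn n) i == ord_max) = false.
  by apply/eqP => /(congr1 val) /= e; have := ltn_ord i; rewrite e ltnn.
rewrite expr0 alg_polyC; congr ('X_[_])%:P; apply/mnmP => j.
by rewrite mnmE !mnm1E.
Qed.

Lemma muni_max : muni ('X_ord_max : {mpoly K[n.+1]}) = 'X.
Proof.
rewrite muniE msuppX big_seq1 mcoeffX eqxx scale1r mnm1E eqxx expr1.
set m := [multinom _ | _ < _]; have -> : m = 0%MM.
  apply/mnmP => j; rewrite mnmE mnm1E mnm0E.
  by case: eqP => // /(congr1 val) /= e; have := ltn_ord j; rewrite -e ltnn.
by rewrite mpolyX0 scale1r.
Qed.

Lemma mev_muni (S : comNzRingType) (phi : {rmorphism K -> S}) (x : 'rV[S]_n.+1) p :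
  mev phi x p = (map_poly (mev phi (row_init x)) (muni p)).[x 0 ord_max].
Proof.
pose g := horner_eval (x 0 ord_max) \o (map_poly (mev phi (row_init x)) \o @muni n K).
symmetry; apply: (@mev_unique _ _ phi _ x g) => [c|i] /=.
  by rewrite /g /= /horner_eval muniC map_polyC hornerC /= mevC.
rewrite /g /= /horner_eval; case: (unliftP ord_max i) => [j ->|->].
  have -> : lift ord_max j = widen_ord (leqnSn n) j by apply/val_inj; exact: lift_max.
  by rewrite muni_widen map_polyC hornerC /= mevX mxE.
by rewrite muni_max map_polyX hornerX.
Qed.

End Muni.

Lemma ufd_iso (R T : idomainType) (g : {rmorphism R -> T}) (h : {rmorphism T -> R}) :
  cancel g h -> cancel h g -> ufd R -> ufd T.
Proof.
move=> gK hK fR.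
have unit_g u : u \is a GRing.unit -> g u \is a GRing.unit by apply: rmorph_unit.
have prime_g p : prime_elt p -> prime_elt (g p).
  move=> [p0 pN hp]; split.
  - by rewrite -(rmorph0 g) (can_eq gK).
  - by apply: contra pN => /(rmorph_unit h); rewrite gK.
  - move=> a b [c e].
    have : divides p (h a * h b) by exists (h c); rewrite -(gK p) -!rmorphM e.
    case/hp=> -[z ez]; [left|right]; exists (g z); by rewrite -rmorphM -ez hK.
move=> a a0; have ha0 : h a != 0 by rewrite -(rmorph0 h) (can_eq hK).
have [s [ps [u Uu e]]] := fR _ ha0.
exists (map g s); split=> [p /mapP[q qs ->]|]; first by apply: prime_g; apply: ps.
by exists (g u); [exact: unit_g | rewrite big_map -rmorph_prod -rmorphM -e hK].
Qed.

Section MpolyFactorial.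
Variable K : fieldType.

Definition of_muni n (q : {poly {mpoly K[n]}}) : {mpoly K[n.+1]} :=
  (map_poly (@mwiden n K) q).['X_ord_max].

HB.instance Definition _ n := GRing.RMorphism.copy (@of_muni n)
  (horner_eval 'X_ord_max \o map_poly (@mwiden n K)).

Lemma mwidenXU n i : mwiden ('X_i : {mpoly K[n]}) = 'X_(widen_ord (leqnSn n) i).
Proof. by rewrite mwidenX mnmwiden1. Qed.

Lemma mev_id n (p : {mpoly K[n]}) : mev (@mpolyC n K) (\row_i 'X_i) p = p.
Proof.
by apply/esym/(@mev_unique _ _ (@mpolyC n K) n (\row_i 'X_i) idfun) => // i; rewrite mxE.
Qed.

Lemma muniK n : cancel (@muni n K) (@of_muni n).
Proof.
move=> p; rewrite -[RHS]mev_id.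
apply: (@mev_unique _ _ (@mpolyC n.+1 K) n.+1 (\row_i 'X_i) (@of_muni n \o @muni n K)) => [c|i] /=.
  by rewrite muniC /of_muni map_polyC hornerC /= mwidenC.
rewrite mxE; case: (unliftP ord_max i) => [j ->|->].
  have -> : lift ord_max j = widen_ord (leqnSn n) j by apply/val_inj; exact: lift_max.
  by rewrite muni_widen /of_muni map_polyC hornerC /= mwidenXU.
by rewrite muni_max /of_muni map_polyX hornerX.
Qed.

Lemma of_muniK n : cancel (@of_muni n) (@muni n K).
Proof.
move=> q.
have muni_wide (c : {mpoly K[n]}) : muni (mwiden c) = c%:P.
  rewrite -[in RHS](mev_id c).
  have -> : (mev (@mpolyC n K) (\row_i 'X_i) c)%:P =
            mev (polyC \o @mpolyC n K) (map_mx polyC (\row_i 'X_i)) c.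
    exact: mev_morph.
  apply: (@mev_unique _ _ (polyC \o @mpolyC n K) n (map_mx polyC (\row_i 'X_i))
           (@muni n K \o @mwiden n K)) => [a|i] /=.
    by rewrite mwidenC muniC.
  by rewrite mwidenXU muni_widen !mxE.
elim/poly_ind: q => [|q c IHq]; first by rewrite !rmorph0.
rewrite !rmorphD !rmorphM /= IHq /of_muni map_polyX hornerX muni_max.
by rewrite map_polyC hornerC /= muni_wide.
Qed.

Lemma ufd_mpoly n : ufd {mpoly K[n]}.
Proof.
elim: n => [|n IHn].
  move=> p p0; exists [::]; split=> //; exists p; last by rewrite big_nil mulr1.
  have -> : p = (p@_0)%:MP by rewrite (mpolyKC p).
  apply: rmorph_unit; rewrite unitfE.
  by apply: contraNneq p0 => e; rewrite -(mpolyKC p) e mpolyC0.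
by apply: (ufd_iso (@of_muniK n) (@muniK n)); apply: ufd_poly.
Qed.

End MpolyFactorial.

Section Homog.
Variables (n : nat) (K : comNzRingType).
Implicit Types (p q : {mpoly K[n]}).

Lemma mev_homog (S : comNzRingType) (phi : {rmorphism K -> S}) d p t (x : 'rV[S]_n) :
  p \is d.-homog -> mev phi (t *: x) p = t ^+ d * mev phi x p.
Proof.
move/dhomogP => hp; rewrite /mev /mmap mulr_sumr; apply: eq_big_seq => m mp.
have hd : mdeg m = d := hp m mp.
rewrite mulrCA; congr (_ * _); rewrite /mmap1 -hd mdegE -prodrXr -big_split /=.
by apply: eq_bigr => i _; rewrite mxE exprMn.
Qed.

Lemma mderiv_homog d p i : p \is d.-homog -> p^`M(i) \is d.-1.-homog.
Proof.
move/dhomogP => hp; apply/dhomogP => m; rewrite mcoeff_msupp mcoeff_deriv => h.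
have /hp : (m + U_(i))%MM \in msupp p.
  by rewrite mcoeff_msupp; apply: contraNneq h => ->; rewrite mul0rn.
by move=> /= <-; have -> : mdeg (m + U_(i)) = (mdeg m).+1 by rewrite mdegD mdeg1 addn1.
Qed.

Lemma Euler_homog d p : p \is d.-homog -> \sum_i 'X_i * p^`M(i) = d%:R *: p.
Proof.
move/dhomogP => hp; rewrite {2}(mpolyE p) scaler_sumr.
under eq_bigr => i _ do rewrite {1}(mpolyE p) raddf_sum mulr_sumr.
rewrite exchange_big /=; apply: eq_big_seq => m mp.
have hd : mdeg m = d := hp m mp.
rewrite -hd mdegE natr_sum scaler_suml; apply: eq_bigr => i _.
rewrite mderivZ mderivX -!scalerAr !scalerA [_ * p@_m]mulrC.
case: (posnP (m i)) => [->|mi]; first by rewrite mulr0 !scale0r.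
congr (_ *: _); rewrite -mpolyXD; congr 'X_[_]; apply/mnmP => j.
by rewrite mnmDE mnmBE mnm1E; case: eqP => [<-|_]; rewrite ?subnKC ?subn0.
Qed.

Lemma mev_Euler (S : comNzRingType) (phi : {rmorphism K -> S}) d p (x : 'rV[S]_n) :
  p \is d.-homog -> \sum_i x 0 i * mev phi x p^`M(i) = d%:R * mev phi x p.
Proof.
move/Euler_homog/(congr1 (mev phi x)); rewrite mevZ rmorph_nat => <-.
by rewrite rmorph_sum; apply: eq_bigr => i _; rewrite rmorphM /= mevX.
Qed.

End Homog.

Section Subst.
Variables (n : nat) (K : comNzRingType).
Implicit Types (p q : {mpoly K[n]}) (P : 'M[K]_n).

(** The coordinate change that sends a row [x] to [x *m P]; the rows of [P] are the new basis
    vectors. *)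
Definition msub P p : {mpoly K[n]} :=
  mev (@mpolyC n K) ((\row_i 'X_i) *m map_mx (@mpolyC n K) P) p.

HB.instance Definition _ P := GRing.RMorphism.copy (msub P)
  (mev (@mpolyC n K) ((\row_i 'X_i) *m map_mx (@mpolyC n K) P)).

Lemma msubC P c : msub P c%:MP = c%:MP.
Proof. exact: mevC. Qed.

Lemma msubX P i : msub P 'X_i = \sum_j P j i *: 'X_j.
Proof.
rewrite /msub mevX mxE; apply: eq_bigr => j _.
by rewrite !mxE mulrC mul_mpolyC.
Qed.

Lemma msubZ P c p : msub P (c *: p) = c *: msub P p.
Proof. by rewrite /msub mevZ mul_mpolyC. Qed.

Lemma mev_msub (S : comNzRingType) (phi : {rmorphism K -> S}) (y : 'rV[S]_n) P p :
  mev phi y (msub P p) = mev phi (y *m map_mx phi P) p.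
Proof.
apply: (@mev_unique _ _ phi n (y *m map_mx phi P) (mev phi y \o msub P)) => [c|i] /=.
  by rewrite msubC mevC.
rewrite msubX rmorph_sum mxE; apply: eq_bigr => j _.
by rewrite /= mevZ mevX mxE mulrC.
Qed.

Lemma mderiv_msub P p i : (msub P p)^`M(i) = \sum_j P i j *: msub P p^`M(j).
Proof.
rewrite (@mev_derivation _ _ _ _ _ (mderiv i)) => [|a b|a b|c].
- apply: eq_bigr => j _; rewrite mxE raddf_sum (bigD1 i) //= big1 ?addr0 => [|k ki].
    rewrite !mxE ['X_i * _]mulrC mul_mpolyC mderivZ mderivX mnm1E eqxx scale1r.
    have -> : (U_(i) - U_(i) = 0)%MM by apply/mnmP => k; rewrite mnmBE subnn mnm0E.
    by rewrite mpolyX0 -scalerAl mul1r.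
  by rewrite !mxE mulrC mul_mpolyC /= mderivZ mderivX mnm1E (negbTE ki) scale0r scaler0.
- exact: mderivD.
- exact: mderivM.
- exact: mderivC.
Qed.

Lemma msub_homog d P p : p \is d.-homog -> msub P p \is d.-homog.
Proof.
move/dhomogP => hp; rewrite {1}(mpolyE p) rmorph_sum big_seq; apply: rpred_sum => m mp.
have hd : mdeg m = d := hp m mp.
rewrite /= msubZ; apply: rpredZ; rewrite -hd mpolyXE_id rmorph_prod mdegE.
elim/big_rec2: _ => [|i e q _ hq]; first exact: dhomog1.
apply: dhomogM => //; rewrite rmorphXn -[e in e.-homog]mul1n.
apply: dhomogMn; rewrite /= msubX; apply: rpred_sum => j _.
by apply: rpredZ; rewrite dhomogX; apply/eqP; exact: mdeg1.
Qed.

End Subst.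

Section Msub2.
Variables (n : nat) (K : fieldType).
Lemma msubM (P Q : 'M[K]_n) p : msub P (msub Q p) = msub (P *m Q) p.
Proof.
have -> : msub (P *m Q) p =
  mev (@mpolyC n K) ((\row_i 'X_i) *m map_mx (@mpolyC n K) P *m map_mx (@mpolyC n K) Q) p.
  by rewrite -mulmxA -map_mxM.
exact: (mev_msub (@mpolyC n K) ((\row_i 'X_i) *m map_mx (@mpolyC n K) P) Q p).
Qed.

Lemma msub1 (p : {mpoly K[n]}) : msub 1%:M p = p.
Proof. by rewrite /msub map_mx1 mulmx1 mev_id. Qed.
End Msub2.

Notation ev := (mev idfun).

Definition polyCC (R : comNzRingType) (c : R) : {poly {poly R}} := c%:P%:P.

HB.instance Definition _ (R : comNzRingType) := GRing.RMorphism.copy (@polyCC R) (polyC \o polyC).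

Section ClosedField.
Variable K : closedFieldType.

Lemma mpoly_nonzero_point n (p : {mpoly K[n]}) : p != 0 -> exists x, ev x p != 0.
Proof.
elim: n p => [|n IHn] p p0.
  exists 0; rewrite -(mpolyKC p) mevC; apply: contraNneq p0 => e.
  by rewrite -(mpolyKC p); move: e => /= ->; rewrite mpolyC0.
have m0 : muni p != 0 by rewrite -(rmorph0 (@muni n K)) (can_eq (@muniK K n)).
have l0 : lead_coef (muni p) != 0 by rewrite lead_coef_eq0.
have [x' hx'] := IHn _ l0.
have q0 : map_poly (ev x') (muni p) != 0.
  apply: contraNneq hx' => /polyP/(_ (size (muni p)).-1).
  by rewrite coef_map coef0 => ->.
have /closed_nonrootP[y hy] := q0.
exists (\row_i if unlift ord_max i is Some j then x' 0 j else y).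
rewrite mev_muni mxE unlift_none.
suff -> : row_init (\row_i (if unlift ord_max i is Some j then x' 0 j else y)) = x' by [].
apply/rowP => j; rewrite !mxE.
have -> : widen_ord (leqnSn n) j = lift ord_max j by apply/val_inj/esym/lift_max.
by rewrite liftK.
Qed.

Lemma mpoly_eq_ev n (p q : {mpoly K[n]}) : (forall x, ev x p = ev x q) -> p = q.
Proof.
move=> e; apply/eqP; rewrite -subr_eq0; apply/negPn/negP => /mpoly_nonzero_point[x].
by rewrite rmorphB /= e subrr eqxx.
Qed.

Lemma avoid_hyperplanes n (cs : seq 'cV[K]_n) : all (fun c => c != 0) cs ->
  exists v : 'rV[K]_n, all (fun c => (v *m c) 0 0 != 0) cs.
Proof.
move=> /allP cs0.
pose l (c : 'cV[K]_n) : {mpoly K[n]} := \sum_i c i 0 *: 'X_i.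
have evl v c : ev v (l c) = (v *m c) 0 0.
  rewrite rmorph_sum mxE; apply: eq_bigr => i _; by rewrite /= mevZ mevX mulrC.
have l0 c : c != 0 -> l c != 0.
  apply: contraNneq => lc0; apply/eqP/colP => i; rewrite mxE.
  have := evl (delta_mx 0 i) c; rewrite lc0 rmorph0 -rowE mxE.
  by move=> ->.
have /mpoly_nonzero_point[v hv] : \prod_(c <- cs) l c != 0.
  by rewrite prodf_seq_neq0; apply/allP => c /cs0 /=; apply: l0.
exists v; apply/allP => c cc.
move: hv; rewrite rmorph_prod prodf_seq_neq0 => /allP/(_ c cc).
by rewrite /= evl.
Qed.

End ClosedField.

#[global] Opaque mev msub muni mderiv.

(** * Factors of homogeneous polynomials *)

Lemma monomial_factor (R : idomainType) (A B : {poly R}) (c : R) d :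
  c != 0 -> A * B = c *: 'X^d -> exists i a, A = a *: 'X^i.
Proof.
move=> c0; elim: d A B => [|d IHd] A B e.
  rewrite expr0 alg_polyC in e.
  have AB0 : A * B != 0 by rewrite e polyC_eq0.
  have [A0 B0] : A != 0 /\ B != 0.
    by move: AB0; rewrite mulf_eq0 negb_or => /andP.
  have := congr1 (size : {poly R} -> nat) e.
  rewrite size_polyC c0 size_mul // => es.
  have sA : (size A <= 1)%N.
    by move: es; rewrite -!size_poly_gt0 in A0 B0; move: (size A) (size B) A0 B0 => x y; lia.
  by exists 0%N, A`_0; rewrite expr0 alg_polyC; apply: size1_polyC.
have split0 (q : {poly R}) : q`_0 = 0 -> exists r, q = r * 'X.
  move=> q0; have /factor_theorem[r ->] : root q 0 by rewrite /root horner_coef0 q0.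
  by exists r; rewrite subr0.
have /eqP := congr1 (fun p : {poly R} => p`_0) e.
rewrite /= coef0M coefZ coefXn mulr0 mulf_eq0 => /orP[] /eqP /split0[r er].
  have [|i [a ra]] := IHd r B.
    apply: (mulIf (negbT (polyX_eq0 R))).
    by rewrite mulrAC -er e exprSr scalerAl.
  by exists i.+1, a; rewrite er ra exprSr scalerAl.
apply: (IHd A r); apply: (mulIf (negbT (polyX_eq0 R))).
by rewrite -mulrA -er e exprSr scalerAl.
Qed.

Section HomogFactor.
Variables (n : nat) (K : fieldType).
Implicit Types p : {mpoly K[n]}.

Local Notation scl := (mev (polyC \o @mpolyC n K) ('X *: map_mx polyC (\row_i 'X_i))).

Let scl_homog d p : p \is d.-homog -> scl p = p *: 'X^d.
Proof.
move=> hp; rewrite (mev_homog _ _ _ hp).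
have -> : mev (polyC \o @mpolyC n K) (map_mx polyC (\row_i 'X_i)) p = p%:P.
  by rewrite -[in RHS](mev_id p); apply/esym/mev_morph.
by rewrite mulrC mul_polyC.
Qed.

Let scl_coef p k : (scl p)`_k = pihomog mdeg k p.
Proof.
rewrite {1}(mpolyE p) pihomogE rmorph_sum coef_sum [RHS]big_mkcond /=.
apply: eq_bigr => m _; rewrite -mul_mpolyC rmorphM /= mevC /=.
rewrite (@scl_homog (mdeg m)) ?dhomogX // coefCM coefZ coefXn mul_mpolyC eq_sym.
by case: eqP => _; rewrite ?mulr0n ?mulr1n ?mulr1 ?mulr0 ?scaler0 ?mul_mpolyC.
Qed.

(** [scl p] is [p (t x)] as a polynomial in [t], with the homogeneous parts of [p] as coefficients;
    a factor of a monomial in [t] is a monomial. *)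
Lemma homog_factor d p q : p * q != 0 -> p * q \is d.-homog -> exists i, p \is i.-homog.
Proof.
move=> pq0 hpq; have [|i [a e]] := monomial_factor (d := d) (A := scl p) (B := scl q) pq0.
  by rewrite -rmorphM /= (scl_homog hpq).
exists i; apply/dhomogP => m; rewrite mcoeff_msupp => pm.
apply/eqP; apply: contraNT pm => mi.
have /(congr1 (mcoeff m)) : pihomog mdeg (mdeg m) p = 0.
  by rewrite -scl_coef e coefZ coefXn (negbTE mi) mulr0.
rewrite mcoeff0 pihomogE raddf_sum /= => e0; apply/eqP; rewrite -[RHS]e0 {e0}.
rewrite {1}(mpolyE p) raddf_sum [RHS]big_mkcond /=; apply: eq_bigr => k _.
rewrite !mcoeffZ mcoeffX; case: ifP => // h.
by case: (k =P m) h => [->|_ _]; rewrite ?eqxx ?mulr0n ?mulr0.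
Qed.

End HomogFactor.

Section MuniHomog.
Variables (n : nat) (K : fieldType).
Implicit Types p : {mpoly K[n.+1]}.

Lemma mdeg_muni (m : 'X_{1..n.+1}) :
  (mdeg [multinom m (widen_ord (leqnSn n) i) | i < n] + m ord_max)%N = mdeg m.
Proof.
rewrite !mdegE big_ord_recr /=; congr (_ + _)%N.
by apply: eq_bigr => i _; rewrite mnmE.
Qed.

Lemma coef_muni p k : (muni p)`_k =
  \sum_(m <- msupp p | m ord_max == k)
     p@_m *: 'X_[[multinom m (widen_ord (leqnSn n) i) | i < n]].
Proof.
rewrite muniE coef_sum [RHS]big_mkcond; apply: eq_bigr => m _.
by rewrite coefZ coefXn eq_sym; case: eqP => _; rewrite ?mulr0n ?mulr1n ?mulr1 ?mulr0.
Qed.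

Lemma muni_coef_homog d p k : p \is d.-homog -> (muni p)`_k \is (d - k).-homog.
Proof.
move/dhomogP => hp; rewrite coef_muni big_seq_cond; apply: rpred_sum => m /andP[mp /eqP mk].
apply: rpredZ; rewrite dhomogX; apply/eqP.
have hd : mdeg m = d := hp m mp; rewrite -hd -(mdeg_muni m) mk /=.
by rewrite addnK.
Qed.

Lemma muni_coef_gt d p k : p \is d.-homog -> (d < k)%N -> (muni p)`_k = 0.
Proof.
move/dhomogP => hp dk; rewrite coef_muni big_seq_cond big1 // => m /andP[mp /eqP mk].
have hd : mdeg m = d := hp m mp; move: dk; rewrite -hd -(mdeg_muni m) mk.
by rewrite ltnNge leq_addl.
Qed.

End MuniHomog.

Lemma rmorph_resultant (R S : nzRingType) (g : {rmorphism R -> S}) (p q : {poly R}) :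
  g (lead_coef p) != 0 -> g (lead_coef q) != 0 ->
  g (resultant p q) = resultant (map_poly g p) (map_poly g q).
Proof.
move=> gp gq; rewrite /resultant -det_map_mx /Sylvester_mx !size_map_poly_id0 // map_col_mx.
by congr (\det (col_mx _ _)); apply: map_lin1_mx => v; rewrite map_poly_rV rmorphM /= map_rVpoly.
Qed.

(** * Elimination and common zeros *)

Lemma elim_eval (R S : comNzRingType) (g : {rmorphism R -> S}) r (u v p q : {poly R}) z :
  r%:P = u * p + v * q -> g r = (map_poly g u).[z] * (map_poly g p).[z] +
                                (map_poly g v).[z] * (map_poly g q).[z].
Proof.
move/(congr1 (fun p => (map_poly g p).[z])).
by rewrite map_polyC hornerC rmorphD !rmorphM hornerD !hornerM.
Qed.

(** The witness is the resultant. It lies in the ideal of [a] and [b], hence vanishes under [g0];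
    where both leading coefficients survive, its vanishing produces a common root. *)
Lemma common_root (R : idomainType) (F : closedFieldType) (g0 : {rmorphism R -> F})
    (a b : {poly R}) : (1 < size a)%N -> (1 < size b)%N ->
  (map_poly g0 a).[0] = 0 -> (map_poly g0 b).[0] = 0 ->
  exists2 h : R, g0 h = 0 & forall g : {rmorphism R -> F},
    g (lead_coef a) != 0 -> g (lead_coef b) != 0 -> g h = 0 ->
    exists z, (map_poly g a).[z] = 0 /\ (map_poly g b).[z] = 0.
Proof.
move=> sa sb a0 b0; exists (resultant a b).
  have [uv _ e] := resultant_in_ideal sa sb.
  by rewrite (elim_eval g0 0 e) a0 b0 !mulr0 addr0.
move=> g la lb; rewrite rmorph_resultant // => /eqP; rewrite resultant_eq0 => sg.
have /closed_rootP[z] : size (gcdp (map_poly g a) (map_poly g b)) != 1%N.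
  by rewrite gtn_eqF.
by rewrite root_gcd => /andP[/rootP za /rootP zb]; exists z.
Qed.

(** * Frames in general position *)

Section Frames.
Variable K : closedFieldType.

Definition frame (v0 v1 v2 v3 : 'rV[K]_4) : 'M[K]_4 :=
  \matrix_(i < 4) nth 0 [:: v0; v1; v2; v3] i.

Lemma rank_adds_gt n m (v : 'rV[K]_n) (A : 'M[K]_(m, n)) :
  ~~ (v <= A)%MS -> (\rank A < \rank (v + A)%MS)%N.
Proof.
move=> vA; apply: rank_ltmx; apply/andP; split; first exact: addsmxSr.
by apply: contra vA => h; apply: submx_trans h; apply: addsmxSl.
Qed.

Lemma frame_unit (v0 v1 v2 v3 : 'rV[K]_4) :
  v3 != 0 -> ~~ (v2 <= v3)%MS -> ~~ (v1 <= v2 + v3)%MS ->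
  ~~ (v0 <= v1 + (v2 + v3))%MS -> frame v0 v1 v2 v3 \in unitmx.
Proof.
move=> h3 h2 h1 h0; rewrite -row_free_unit /row_free eqn_leq rank_leq_row /=.
have r3 : (1 <= \rank v3)%N by rewrite lt0n mxrank_eq0.
have r2 := leq_ltn_trans r3 (rank_adds_gt h2).
have r1 := leq_ltn_trans r2 (rank_adds_gt h1).
have r0 := leq_ltn_trans r1 (rank_adds_gt h0).
apply: leq_trans r0 _; apply: mxrankS.
have s (i : 'I_4) v : nth 0 [:: v0; v1; v2; v3] i = v -> (v <= frame v0 v1 v2 v3)%MS.
  by move=> <-; rewrite -(rowK (fun i : 'I_4 => nth 0 [:: v0; v1; v2; v3] i) i) row_sub.
rewrite !addsmx_sub; apply/and4P; split.
- exact: (s (@Ordinal 4 0 isT)).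
- exact: (s (@Ordinal 4 1 isT)).
- exact: (s (@Ordinal 4 2 isT)).
- exact: (s (@Ordinal 4 3 isT)).
Qed.

(** A nonzero column of the cokernel of [A] is a linear form vanishing on [A]; a point off all these
    hyperplanes is taken. *)
Lemma pick_outside n (As : seq 'M[K]_n) : all (fun A => \rank A < n)%N As ->
  exists v : 'rV[K]_n, all (fun A => ~~ (v <= A)%MS) As.
Proof.
move=> /allP hA.
pose c (A : 'M[K]_n) : 'cV[K]_n :=
  if [pick j | col j (cokermx A) != 0] is Some j then col j (cokermx A) else 0.
have cA A : (\rank A < n)%N -> c A != 0.
  move=> rA; rewrite /c; case: pickP => // h.
  have : cokermx A = 0.
    by apply/matrixP => i j; have /negbFE/eqP/colP/(_ i) := h j; rewrite !mxE.
  move/eqP; rewrite -mxrank_eq0 mxrank_coker subn_eq0 leqNgt rA //.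
have [|v /allP hv] := @avoid_hyperplanes K n (map c As).
  by apply/allP => _ /mapP[A /hA /= rA ->]; apply: cA.
exists v; apply/allP => A AA; have := hv (c A) (map_f c AA).
apply: contraNN; rewrite submxE => /eqP vA; rewrite /c; case: pickP => [j _|_].
  by rewrite colE mulmxA vA mul0mx mxE.
by rewrite mulmx0 mxE.
Qed.

Lemma frame_last (e : 'rV[K]_4) : e != 0 ->
  exists v0 v1 v2, frame v0 v1 v2 e \in unitmx.
Proof.
move=> e0.
have re : (\rank (<<e>>%MS) <= 1)%N by rewrite mxrank_gen rank_leq_row.
have add1 (v : 'rV[K]_4) m (A : 'M[K]_(m, 4)) :
    (\rank (v + A)%MS <= 1 + \rank A)%N.
  by apply: leq_trans (mxrank_adds_leqif _ _) _; rewrite leq_add2r rank_leq_row.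
have [|v2] := @pick_outside 4 [:: <<e>>%MS]; first by rewrite /= (leq_ltn_trans re).
rewrite /= andbT genmxE => h2.
have r2 : (\rank (v2 + e)%MS <= 2)%N.
  by apply: leq_trans (add1 _ _ _) _; rewrite leq_add2l rank_leq_row.
have [|v1] := @pick_outside 4 [:: (v2 + e)%MS]; first by rewrite /= (leq_ltn_trans r2).
rewrite /= andbT => h1.
have r1 : (\rank (v1 + (v2 + e))%MS <= 3)%N.
  by apply: leq_trans (add1 _ _ _) _; rewrite (leq_add2l 1 _ 2).
have [|v0] := @pick_outside 4 [:: (v1 + (v2 + e))%MS]; first by rewrite /= (leq_ltn_trans r1).
rewrite /= andbT => h0.
by exists v0, v1, v2; apply: frame_unit.
Qed.

End Frames.

Section Prime.
Variable K : closedFieldType.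
Implicit Types f A B : {mpoly K[4]}.

Let e3 : 'rV[K]_4 := delta_mx 0 ord_max.

Lemma muni_lead i A x : A \is i.-homog -> ev e3 A != 0 ->
  size (muni A) = i.+1 /\ ev x (lead_coef (muni A)) != 0.
Proof.
move=> hA eA.
have c0 : ev (0 : 'rV_3) (muni A)`_i != 0.
  apply: contraNneq eA => c0; rewrite mev_muni.
  have -> : row_init e3 = 0.
    apply/rowP => j; rewrite !mxE /=.
    have -> : (widen_ord (leqnSn 3) j == ord_max) = false.
      by apply/eqP => /(congr1 val) /= e; have := ltn_ord j; rewrite e.
    by [].
  have -> : map_poly (ev (0 : 'rV[K]_3)) (muni A) = 0.
    apply/polyP => k; rewrite coef_map coef0 /=.
    case: (ltngtP k i) => [ki|ik|->] //; last by rewrite (muni_coef_gt hA ik) rmorph0.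
    rewrite -(scale0r (0 : 'rV[K]_3)) (mev_homog _ _ _ (muni_coef_homog k hA)).
    by rewrite expr0n subn_eq0 leqNgt ki mul0r.
  by rewrite horner0.
have ci : (muni A)`_i != 0 by apply: contraNneq c0 => ->; rewrite rmorph0.
have sA : size (muni A) = i.+1.
  apply/eqP; rewrite eqn_leq; apply/andP; split.
    by apply/leq_sizeP => k; apply: muni_coef_gt.
  by rewrite ltnNge; apply: contra ci => /leq_sizeP ->.
split=> //; rewrite lead_coefE sA /=.
move: c0; rewrite -(scale0r x) (mev_homog _ _ _ (muni_coef_homog i hA)).
by rewrite subnn expr0 mul1r.
Qed.

(** If the specialisation at some [s != 0] is not a nonzero constant, it has a root. Otherwise all
    coefficients of positive degree in the outer variable vanish away from [0], so [H] depends on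
    [s] alone and [(0, 1)] is a zero. *)
Lemma two_var_zero (H : {poly {poly K}}) : H.[0].[0] = 0 ->
  exists s u, ((s, u) != (0, 0)) /\ H.[u%:P].[s] = 0.
Proof.
move=> H0.
have ev_s s u : H.[u%:P].[s] = (map_poly (horner_eval s) H).[u].
  by rewrite -[u in RHS](hornerC u s) -/(horner_eval s u%:P) horner_map.
have [[s [s0 hs]]|h] := classic (exists s, s != 0 /\ size (map_poly (horner_eval s) H) != 1%N).
  have [u /rootP ru] := closed_rootP _ hs.
  by exists s, u; rewrite ev_s ru xpair_eqE (negbTE s0).
have Hk k : H`_k.+1 = 0.
  apply/eqP/negPn/negP => c0.
  have /closed_nonrootP[s] : H`_k.+1 * 'X != 0 by rewrite mulf_neq0 ?polyX_eq0.
  rewrite rootM negb_or rootX => /andP[hs s0]; case: h; exists s; split=> //.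
  apply/negP => /eqP s1; case/negP: hs; rewrite /root.
  have -> : (H`_k.+1).[s] = (map_poly (horner_eval s) H)`_k.+1 by rewrite coef_map.
  by rewrite nth_default // s1.
exists 0, 1; split; first by rewrite xpair_eqE oner_eq0 andbF.
have -> : H = (H`_0)%:P by apply/polyP => -[|k]; rewrite coefC //= Hk.
by rewrite hornerC -(horner_coef0 H).
Qed.

Lemma row_init0 n (S : nmodType) : row_init (0 : 'rV[S]_n.+1) = 0.
Proof. by apply/rowP => k; rewrite !mxE. Qed.

Lemma common_zero_mod i j A B : A \is i.+1.-homog -> B \is j.+1.-homog ->
  ev e3 A != 0 -> ev e3 B != 0 ->
  exists2 h : {mpoly K[3]}, ev 0 h = 0 & forall x', ev x' h = 0 ->
    exists z, forall x : 'rV_4, row_init x = x' -> x 0 ord_max = z -> ev x A = 0 /\ ev x B = 0.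
Proof.
move=> hA hB eA eB.
have [sA _] := muni_lead 0 hA eA; have [sB _] := muni_lead 0 hB eB.
have sA1 : (1 < size (muni A))%N by rewrite sA.
have sB1 : (1 < size (muni B))%N by rewrite sB.
have z (C : {mpoly K[4]}) l : C \is l.+1.-homog ->
    (map_poly (mev idfun (0 : 'rV_3)) (muni C)).[0] = 0.
  move=> hC; have := mev_muni idfun (0 : 'rV[K]_4) C; rewrite mxE row_init0.
  by move <-; rewrite -(scale0r (0 : 'rV[K]_4)) (mev_homog _ _ _ hC) expr0n mul0r.
have [h h0 hg] := common_root sA1 sB1 (z A i hA) (z B j hB).
exists h => // x' hx'.
have [_ lA] := muni_lead x' hA eA; have [_ lB] := muni_lead x' hB eB.
have [w [wA wB]] := hg _ lA lB hx'; exists w => x rx xw.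
split.
- have e := mev_muni idfun x A.
  rewrite rx xw in e.
  rewrite e.
  exact: wA.
- have e := mev_muni idfun x B.
  rewrite rx xw in e.
  rewrite e.
  exact: wB.
Qed.

(** Two surfaces in space meet: the resultant in the last coordinate vanishes at the origin, hence
    at some nonzero [(s, u, 0)], and that zero lifts. *)
Lemma common_zero i j A B : A \is i.+1.-homog -> B \is j.+1.-homog ->
  ev e3 A != 0 -> ev e3 B != 0 -> exists2 x, x != 0 & ev x A = 0 /\ ev x B = 0.
Proof.
move=> hA hB eA eB.
have [h h0 hz] := common_zero_mod hA hB eA eB.
pose y : 'rV[{poly {poly K}}]_3 := \row_k nth 0 [:: 'X%:P; 'X; 0] k.
have evy s u : (mev (@polyCC K) y h).[u%:P].[s] = ev (\row_k nth 0 [:: s; u; 0] k) h.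
  have := @mev_morph _ _ _ (@polyCC K) idfun (horner_eval s \o horner_eval u%:P) 3 y _ h.
  rewrite /= /horner_eval => ->; last by move=> c; rewrite /= /polyCC !hornerC.
  congr (mev _ _ _); apply/rowP => k; rewrite !mxE /= /horner_eval.
  case: k => [[|[|[|//]]]] /= _; by rewrite ?hornerX ?hornerC ?hornerX ?hornerC ?horner0.
have [|s [u [su hsu]]] := @two_var_zero (mev (@polyCC K) y h).
  rewrite -[0 in X in X.[0]]polyC0 evy -[RHS]h0; congr (mev _ _ _).
  by apply/rowP => k; rewrite !mxE; case: k => [[|[|[|//]]]].
rewrite evy in hsu; set x' := \row_k _ in hsu.
have [z {}hz] := hz _ hsu.
pose x : 'rV[K]_4 := \row_k nth 0 [:: s; u; 0; z] k.
have rx : row_init x = x' by apply/rowP => k; rewrite !mxE; case: k => [[|[|[|//]]]].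
exists x; last by apply: hz; rewrite // mxE.
apply: contraNneq su => x0; rewrite xpair_eqE.
move/rowP: (x0) => /(_ (@Ordinal 4 0 isT)); rewrite !mxE /= => ->.
by move/rowP: x0 => /(_ (@Ordinal 4 1 isT)); rewrite !mxE /= => ->; rewrite eqxx.
Qed.

End Prime.

(** * Smooth forms are prime *)

Section EvLemmas.
Variables (K : fieldType) (n : nat).

Lemma ev_msub (y : 'rV[K]_n) P p : ev y (msub P p) = ev (y *m P) p.
Proof.
rewrite mev_msub; congr (mev _ (_ *m _) _).
by apply/matrixP => i j; rewrite mxE.
Qed.

Lemma deriv_mev (x : 'rV[{poly K}]_n) p :
  (mev polyC x p)^`() = \sum_i (x 0 i)^`() * mev polyC x p^`M(i).
Proof.
rewrite (@mev_derivation _ _ _ _ _ (@deriv K)) // => [a b|a b|c].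
- exact: derivD.
- exact: derivM.
- exact: derivC.
Qed.

Lemma horner_mev (x : 'rV[{poly K}]_n) p t :
  (mev polyC x p).[t] = ev (map_mx (horner_eval t) x) p.
Proof.
have := @mev_morph _ _ _ polyC idfun (horner_eval t) n x _ p.
by rewrite /= /horner_eval => -> // c; rewrite /= hornerC.
Qed.

Definition pline (x v : 'rV[K]_n) : 'rV[{poly K}]_n := map_mx polyC x + 'X *: map_mx polyC v.

Lemma horner_pline x v t : map_mx (horner_eval t) (pline x v) = x + t *: v.
Proof. by apply/rowP => i; rewrite !mxE /horner_eval hornerD hornerM hornerX !hornerC. Qed.

Lemma deriv_pline x v p :
  (mev polyC (pline x v) p)^`() = \sum_i (v 0 i)%:P * mev polyC (pline x v) p^`M(i).
Proof.
rewrite deriv_mev; apply: eq_bigr => i _; congr (_ * _).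
by rewrite !mxE derivD derivM derivX !derivC add0r mul1r mulr0 addr0.
Qed.

Lemma ev0_homog d (p : {mpoly K[n]}) : p \is d.+1.-homog -> ev 0 p = 0.
Proof.
by move=> hp; rewrite -(scale0r (0 : 'rV[K]_n)) (mev_homog _ _ _ hp) expr0n mul0r.
Qed.

End EvLemmas.

Lemma prime_iso (R T : idomainType) (g : {rmorphism R -> T}) (h : {rmorphism T -> R}) p :
  cancel g h -> cancel h g -> prime_elt p -> prime_elt (g p).
Proof.
move=> gK hK [p0 pN hp]; split.
- by rewrite -(rmorph0 g) (can_eq gK).
- by apply: contra pN => /(rmorph_unit h); rewrite gK.
- move=> a b [c e].
  have : divides p (h a * h b) by exists (h c); rewrite -(gK p) -!rmorphM e.
  by case/hp=> -[z ez]; [left|right]; exists (g z); rewrite -rmorphM -ez hK.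
Qed.

Lemma prime_unitM (R : idomainType) (u p : R) :
  u \is a GRing.unit -> prime_elt p -> prime_elt (u * p).
Proof.
move=> Uu [p0 pN hp]; split.
- by rewrite mulf_neq0 // (memPn _ _ Uu) // unitr0.
- by rewrite unitrM (negbTE pN) andbF.
- have e x : divides (u * p) x <-> divides p x.
    split=> -[c ->]; first by exists (u * c); ring.
    by exists (u^-1 * c); rewrite mulrACA divrr // mul1r.
  by move=> a b /e/hp[]/e; [left|right].
Qed.

Section SmoothPrime.
Variable K : closedFieldType.
Implicit Types f A B : {mpoly K[4]}.

Definition smooth f := forall x : 'rV[K]_4, x != 0 ->
  ~ (ev x f = 0 /\ forall i, ev x f^`M(i) = 0).

Lemma homog0_const n (A : {mpoly K[n]}) : A \is 0.-homog -> A = (ev 0 A)%:MP.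
Proof.
move=> hA; apply: mpoly_eq_ev => x; rewrite mevC /= -(scale0r x) (mev_homog _ _ _ hA).
by rewrite expr0 mul1r.
Qed.

Lemma smooth_neq0 f : smooth f -> f != 0.
Proof.
move=> sf; apply/negP => /eqP f0.
have e0 : delta_mx 0 0 != 0 :> 'rV[K]_4.
  by apply/negP => /eqP/rowP/(_ 0); rewrite !mxE /= => /eqP; rewrite oner_eq0.
by case: (sf _ e0); rewrite f0 rmorph0; split=> // i; rewrite mderiv0 rmorph0.
Qed.

(** With two or more prime factors, [f = p * B] for homogeneous [p] and [B] of positive degree; all
    partial derivatives then vanish at a common zero of the two. A frame moves the centre of
    projection off both surfaces. *)
Lemma smooth_prime d f : f \is d.+1.-homog -> smooth f -> prime_elt f.
Proof.
move=> hf sf; have f0 := smooth_neq0 sf.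
have [s [ps [u Uu ef]]] := ufd_mpoly f0.
have nU : f \isn't a GRing.unit.
  by apply/negP => /(rmorph_unit (mev idfun 0)); rewrite /= (ev0_homog hf) unitr0.
case: s ps ef => [|p [|q s]] ps ef.
- by case/negP: nU; rewrite ef big_nil mulr1.
- by rewrite ef big_seq1; apply: prime_unitM => //; apply: ps; rewrite inE.
exfalso.
have [p0 pN _] : prime_elt p by apply: ps; rewrite inE eqxx.
have [_ qN _] : prime_elt q by apply: ps; rewrite !inE eqxx orbT.
have {u Uu ef} [B ef BN] : exists2 B, f = p * B & B \isn't a GRing.unit.
  exists (u * (q * \prod_(j <- s) j)); first by rewrite ef !big_cons; ring.
  by rewrite !unitrM (negbTE qN) andbF.
have pos A C : f = A * C -> A \isn't a GRing.unit -> exists i, A \is i.+1.-homog.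
  move=> e AN; have [||[|i] hA] := @homog_factor 4 K d.+1 A C; rewrite -?e //; last by exists i.
  case/negP: AN; rewrite (homog0_const hA); apply: rmorph_unit; rewrite unitfE.
  by apply: contraNneq f0 => c0; rewrite e (homog0_const hA) c0 mpolyC0 mul0r.
have [i hp] := pos p B ef pN.
have [j hB] : exists j, B \is j.+1.-homog by apply: (pos B p) => //; rewrite mulrC.
have [e he] := mpoly_nonzero_point f0.
have e0 : e != 0 by apply: contraNneq he => ->; rewrite (ev0_homog hf).
have [v0 [v1 [v2 UP]]] := frame_last e0; set P := frame _ _ _ _ in UP.
have eP : delta_mx 0 ord_max *m P = e by rewrite -rowE rowK.
move: he; rewrite ef rmorphM mulf_eq0 negb_or => /andP[he1 he2].
have [|||| y y0 [yp yB]] := @common_zero K i j (msub P p) (msub P B).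
- exact: msub_homog.
- exact: msub_homog.
- by rewrite ev_msub eP.
- by rewrite ev_msub eP.
have x0 : y *m P != 0.
  by apply: contraNneq y0 => x0; rewrite -(mulmxK UP y) x0 mul0mx.
rewrite !ev_msub in yp yB; case: (sf _ x0); split=> [|k].
  by rewrite ef rmorphM /= yp mul0r.
by rewrite ef mderivM rmorphD !rmorphM /= yp yB mul0r mulr0 addr0.
Qed.

(** Without the last variable the surface would be a cone, singular at its vertex [e3]. *)
Lemma size_muni_gt1 d f : f \is d.+2.-homog -> smooth f -> (1 < size (muni f))%N.
Proof.
move=> hf sf; rewrite ltnNge; apply/negP => sf1.
have [c fc] : exists c, muni f = c%:P by exists (muni f)`_0; apply: size1_polyC.
pose e3 : 'rV[K]_4 := delta_mx 0 ord_max.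
have e30 : e3 != 0.
  by apply/negP => /eqP/rowP/(_ ord_max); rewrite !mxE /= => /eqP; rewrite oner_eq0.
have evS (x v : 'rV[{poly K}]_4) : row_init x = row_init v -> mev polyC x f = mev polyC v f.
  by move=> e; rewrite !mev_muni e fc !map_polyC !hornerC.
have line v : mev polyC (pline e3 v) f = mev polyC ('X *: map_mx polyC v) f.
  apply: evS; apply/rowP => j; rewrite !mxE.
  have -> : (widen_ord (leqnSn 3) j == ord_max) = false.
    by apply/eqP => /(congr1 val) /= e; have := ltn_ord j; rewrite e.
  by rewrite /= polyC0 add0r.
have z (v : 'rV[K]_4) : \sum_i v 0 i * ev e3 f^`M(i) = 0.
  have := congr1 (fun p : {poly K} => p^`().[0]) (line v).
  have z0 (q : {poly K}) : ('X^(d.+2) * q)^`().[0] = 0.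
    by rewrite horner_coef0 coef_deriv coefXnM mul0rn.
  rewrite /= deriv_pline horner_sum (mev_homog _ _ _ hf) z0.
  move=> e; rewrite -[RHS]e; apply: eq_bigr => i _.
  rewrite hornerM hornerC horner_mev; congr (_ * ev _ _).
  by rewrite horner_pline scale0r addr0.
apply: (sf _ e30); split=> [|i].
  have := mev_Euler idfun e3 hf; rewrite z => /esym/eqP.
  have := line 0; move/(congr1 (horner^~ 0)); rewrite /= horner_mev horner_pline scale0r addr0 => -> _.
  rewrite horner_mev -[RHS](ev0_homog hf); congr (mev _ _ _).
  by apply/rowP => j; rewrite !mxE /horner_eval hornerM hornerX mul0r.
have := z (delta_mx 0 i); rewrite (bigD1 i) //= big1 => [|j ji]; last first.
  by rewrite mxE eqxx /= (negbTE ji) mul0r.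
by rewrite mxE !eqxx mul1r addr0.
Qed.

End SmoothPrime.

(** * Degree of the eliminant *)

(** A vanishing resultant gives a common factor [g] of positive degree with [p] dividing [x * g]. If
    [p] divides [x], sizes contradict; if it divides [g], it divides a constant multiple of [q],
    hence [q]. *)
Lemma prime_resultant_neq0 (R : idomainType) (p q : {poly R}) :
  prime_elt p -> (1 < size p)%N -> ~ divides p q -> resultant p q != 0.
Proof.
move=> [p0 pN hp] sp npq; rewrite resultant_eq0; apply/negP => sg.
set g := gcdp p q in sg.
have g0 : g != 0 by rewrite -size_poly_gt0 ltnW.
have [[c x] /= c0 ex] := Pdiv.Idomain.dvdpP _ _ (dvdp_gcdl p q).
have [[c' y] /= c'0 ey] := Pdiv.Idomain.dvdpP _ _ (dvdp_gcdr p q).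
rewrite -/g in ex ey.
have : divides p (x * g) by rewrite -ex; exists c%:P; rewrite mulrC mul_polyC.
case/hp => -[k ek].
  have /(mulfI p0) e : p * (k * g) = p * c%:P by rewrite mulrA -ek -ex mulrC mul_polyC.
  have := congr1 (size : {poly R} -> nat) e.
  have k0 : k != 0.
    by apply/negP => /eqP k0; move/eqP: e; rewrite k0 mul0r eq_sym polyC_eq0 (negbTE c0).
  rewrite size_polyC c0 size_mul //; move: k0 sg; rewrite -size_poly_gt0.
  by move: (size k) (size g) => a b; lia.
have : divides p (c'%:P * q).
  by exists (y * k); rewrite mul_polyC ey ek; ring.
case/hp => // -[z ez]; have := congr1 (size : {poly R} -> nat) ez.
have z0 : z != 0.
  by apply/negP => /eqP z0; move/eqP: ez; rewrite z0 mulr0 polyC_eq0 (negbTE c'0).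
rewrite size_polyC c'0 size_mul //; move: z0 sp; rewrite -size_poly_gt0.
by move: (size z) (size p) => a b; lia.
Qed.

Lemma size_prod_bound (S : comNzRingType) (I : finType) (F : I -> {poly S}) (a : I -> nat) :
  (forall i, size (F i) <= (a i).+1)%N -> (size (\prod_i F i)%R <= (\sum_i a i).+1)%N.
Proof.
move=> h; elim/big_rec2: _ => [|i n p _ hp]; first by rewrite size_poly1.
apply: leq_trans (size_polyMleq _ _) _; have := h i; move: hp.
by move: (size p) (size (F i)) => x y; lia.
Qed.

(** A nonzero entry in row [i], column [j] has degree at most [w i - j], so each term of the
    determinant has degree at most the sum of the [w i] minus that of the columns. With the actual
    degrees [dp] and [dq] this is [m * dq + n * dp - dp * dq], and [(m - dp) * (n - dq) >= 0]. *)
Lemma Sylvester_degree (R S : comNzRingType) (g : {rmorphism R -> {poly S}})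
    (p q : {poly R}) m n :
  (size p <= m.+1)%N -> (size q <= n.+1)%N ->
  (forall k, (size (g (p`_k)%R) <= m.+1 - k)%N) -> (forall k, (size (g (q`_k)%R) <= n.+1 - k)%N) ->
  (size (g (resultant p q)) <= (m * n).+1)%N.
Proof.
move=> sp sq hp hq; rewrite /resultant -det_map_mx /determinant.
set dq := (size q).-1; set dp := (size p).-1; set N := (dq + dp)%N.
have ldq : (dq <= n)%N by rewrite /dq; move: (size q) sq => x; lia.
have ldp : (dp <= m)%N by rewrite /dp; move: (size p) sp => x; lia.
apply: leq_trans (size_sum _ _ _) _; apply/bigmax_leqP => s _.
have sgn (b : bool) (P : {poly S}) : size ((-1) ^+ b * P) = size P.
  by case: b; rewrite ?expr0 ?mul1r // expr1 mulN1r size_polyN.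
rewrite {}sgn.
pose w (i : 'I_N) := match split i with inl k => (m + k)%N | inr k => (n + k)%N end.
pose M := map_mx g (Sylvester_mx p q).
have hM (i j : 'I_N) : M i j = 0 \/ ((size (M i j)).-1 + j <= w i)%N.
  rewrite /M mxE Sylvester_mxE /w; case: (split i) => k.
    case: leqP => [kj|_]; last by left; rewrite mulr0n rmorph0.
    have [->|nz] := eqVneq (g (p`_(j - k) *+ true)) 0; [by left|right].
    move: nz; rewrite mulr1n -size_poly_gt0; have := hp (j - k)%N.
    by move: (size (g p`_(j - k))) kj => x; lia.
  case: leqP => [kj|_]; last by left; rewrite mulr0n rmorph0.
  have [->|nz] := eqVneq (g (q`_(j - k) *+ true)) 0; [by left|right].
  move: nz; rewrite mulr1n -size_poly_gt0; have := hq (j - k)%N.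
  by move: (size (g q`_(j - k))) kj => x; lia.
have [[i zi]|nz] := classic (exists i, M i (s i) = 0).
  by rewrite (bigD1 i) //= -/M zi mul0r size_poly0.
apply: leq_trans (size_prod_bound (a := fun i => (size (M i (s i))).-1) _) _.
  by move=> i; rewrite /M; case: (size _).
rewrite ltnS.
have hs : (\sum_i ((size (M i (s i))).-1 + s i) <= \sum_i w i)%N.
  by apply: leq_sum => i _; case: (hM i (s i)) => // z; case: nz; exists i.
move: hs; rewrite big_split /=.
have -> : (\sum_i (s i : nat) = \sum_(i < N) i)%N.
  by rewrite [RHS](reindex_inj (@perm_inj _ s)).
have -> : (\sum_i w i = \sum_(k < dq) (m + k) + \sum_(k < dp) (n + k))%N.
  rewrite big_split_ord /= /w; congr (_ + _)%N; apply: eq_bigr => k _.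
    by rewrite (unsplitK (inl k : 'I_dq + 'I_dp)).
  by rewrite (unsplitK (inr k : 'I_dq + 'I_dp)).
rewrite [X in (_ + X)%N]big_split_ord /= !big_split /= !sum_nat_const !card_ord.
move: (\sum_i (size _).-1)%N (\sum_(i < dq) i)%N (\sum_(i < dp) i)%N => a b c.
have := leq_mul (leq_subr dp m) (leqnn (n - dq)).
by move: ldq ldp; clear; nia.
Qed.

(** [Phi] is the resultant, except for [q] constant in the main variable, where [q] itself serves;
    there [0 < m] gives the degree bound. *)
Lemma elimination (R : idomainType) (p q : {poly R}) :
  prime_elt p -> (1 < size p)%N -> ~ divides p q ->
  exists Phi u v, [/\ Phi != 0, Phi%:P = u * p + v * q &
    forall (S : comNzRingType) (g : {rmorphism R -> {poly S}}) m n,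
     (0 < m)%N -> (size p <= m.+1)%N -> (size q <= n.+1)%N ->
     (forall k, (size (g (p`_k)%R) <= m.+1 - k)%N) -> (forall k, (size (g (q`_k)%R) <= n.+1 - k)%N) ->
     (size (g Phi) <= (m * n).+1)%N].
Proof.
move=> pp sp npq.
have q0 : q != 0 by apply/negP => /eqP q0; apply: npq; exists 0; rewrite mulr0.
have [sq|sq] := leqP (size q) 1.
  have qc := size1_polyC sq; exists q`_0, 0, 1; split.
  - by rewrite -polyC_eq0 -qc.
  - by rewrite -qc mul0r add0r mul1r.
  - move=> S g m n m0 _ _ _ /(_ 0%N); rewrite subn0 => h; apply: leq_trans h _.
    by rewrite ltnS leq_pmull.
have [uv _ e] := resultant_in_ideal sp sq.
exists (resultant p q), uv.1, uv.2; split=> //; first exact: prime_resultant_neq0.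
by move=> S g m n _; apply: Sylvester_degree.
Qed.

Section ElimMpoly.
Variable K : closedFieldType.
Implicit Types f g : {mpoly K[4]}.

Local Notation wd := (widen_ord (leqnSn 3)).

Lemma size_muni_weight (w : 'I_3 -> nat) f m :
  (forall mo, mo \in msupp f -> (\sum_i w i * mo (wd i) + mo ord_max <= m)%N) ->
  (size (muni f) <= m.+1)%N.
Proof.
move=> h; apply/leq_sizeP => k mk; rewrite coef_muni big_seq_cond big1 // => mo /andP[/h + /eqP e].
by rewrite e; move: (\sum_i _)%N mk => s; lia.
Qed.

Lemma size_coef_weight (S : comNzRingType) (phi : {rmorphism K -> {poly S}})
    (y : 'rV[{poly S}]_3) (w : 'I_3 -> nat) f m k :
  (forall c, size (phi c) <= 1)%N -> (forall i, size (y 0%R i) <= (w i).+1)%N ->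
  (forall mo, mo \in msupp f -> (\sum_i w i * mo (wd i) + mo ord_max <= m)%N) ->
  (size (mev phi y (muni f)`_k)%R <= m.+1 - k)%N.
Proof.
move=> hphi hy h; rewrite coef_muni rmorph_sum.
apply: leq_trans (size_sum _ _ _) _; apply/bigmax_leqP_seq => mo /h hmo /eqP mk.
rewrite /= mevZ; apply: leq_trans (size_polyMleq _ _) _.
have {}hphi := hphi f@_mo.
have : (size (mev phi y 'X_[[multinom mo (wd i) | i < 3]])%R <= (\sum_i w i * mo (wd i)).+1)%N.
  rewrite mpolyXE_id rmorph_prod; apply: size_prod_bound => i /=.
  rewrite rmorphXn /= mevX mnmE; apply: leq_trans (size_poly_exp_leq _ _) _.
  by rewrite ltnS leq_mul2r; have := hy i; move: (size _) => z; lia.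
move: hphi hmo; rewrite mk; move: (size _) (size _) (\sum_i _)%N => a b s; lia.
Qed.

(** The eliminated variable has weight 1 and the others have weights [w]. All weights 1 will give
    the degree of a projected curve; weights [(1, 0, 0)] exploit a centre lying on a line of both
    surfaces. *)
Theorem elim_mpoly f g : prime_elt f -> (1 < size (muni f))%N -> ~ divides f g ->
  exists Phi : {mpoly K[3]}, [/\ Phi != 0,
    forall (S : comNzRingType) (phi : {rmorphism K -> S}) (x : 'rV[S]_4),
      exists a b, mev phi (row_init x) Phi = a * mev phi x f + b * mev phi x g &
    forall (S : comNzRingType) (phi : {rmorphism K -> {poly S}}) (y : 'rV[{poly S}]_3)
      (w : 'I_3 -> nat) m n,
      (forall c, size (phi c) <= 1)%N -> (forall i, size (y 0%R i) <= (w i).+1)%N ->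
      (0 < m)%N ->
      (forall mo, mo \in msupp f -> (\sum_i w i * mo (wd i) + mo ord_max <= m)%N) ->
      (forall mo, mo \in msupp g -> (\sum_i w i * mo (wd i) + mo ord_max <= n)%N) ->
      (size (mev phi y Phi) <= (m * n).+1)%N].
Proof.
move=> pf sf nfg.
have pf' : prime_elt (muni f) := prime_iso (@muniK K 3) (@of_muniK K 3) pf.
have nfg' : ~ divides (muni f) (muni g).
  move=> [c e]; apply: nfg; exists (of_muni c).
  by rewrite -[LHS](@muniK K 3) e rmorphM /= (@muniK K 3).
have [Phi [u [v [P0 e hd]]]] := elimination pf' sf nfg'.
exists Phi; split=> //.
  move=> S phi x.
  exists (map_poly (mev phi (row_init x)) u).[x 0 ord_max], (map_poly (mev phi (row_init x)) v).[x 0 ord_max].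
  rewrite (elim_eval (mev phi (row_init x)) (x 0 ord_max) e).
  by rewrite (mev_muni phi x f) (mev_muni phi x g).
move=> S phi y w m n hphi hy m0 hf hg.
apply: (hd S (mev phi y) m n m0 (size_muni_weight hf) (size_muni_weight hg)) => k.
  exact: size_coef_weight hy hf.
exact: size_coef_weight hy hg.
Qed.

End ElimMpoly.

(** * The flecnodal covariant *)

(** [T M] is [M] plus ['X] times the identity; its determinant is monic, hence regular and
    cancellable. Setting ['X] to [0] returns to [M]. *)
Lemma adjM (R : comNzRingType) n (A B : 'M[R]_n) : \adj (A *m B) = \adj B *m \adj A.
Proof.
pose T (M : 'M[R]_n) := char_poly_mx (- M).
have T0 M : map_mx (horner_eval 0) (T M) = M.
  apply/matrixP => i j; rewrite !mxE /horner_eval hornerD hornerN hornerC hornerMn hornerX.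
  by rewrite mul0rn add0r opprK.
suff e : \adj (T A *m T B) = \adj (T B) *m \adj (T A).
  have := congr1 (map_mx (horner_eval (0 : R))) e.
  by rewrite map_mxM !map_mx_adj map_mxM /= !T0.
have reg : GRing.lreg (\det (T A *m T B)).
  by rewrite det_mulmx; apply: monic_lreg; apply: rpredM; exact: char_poly_monic.
have reg0 m (X : 'M[{poly R}]_(n, m)) : \det (T A *m T B) *: X = 0 -> X = 0.
  move=> /matrixP h; apply/matrixP => i j; apply: reg.
  by have := h i j; rewrite !mxE mulr0.
apply/eqP; rewrite -subr_eq0; apply/eqP; apply: reg0.
rewrite -mul_mx_scalar -(mul_mx_adj (T A *m T B)) mulmxA mulmxBl mul_adj_mx.
rewrite mulmxA -[_ *m T A]mulmxA mul_adj_mx mul_mx_scalar -scalemxAl mul_adj_mx.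
by rewrite det_mulmx scale_scalar_mx subrr mul0mx.
Qed.

Section Flec.
Variable R : comNzRingType.

Lemma exchange_big4 (I J : finType) (F : I -> I -> J -> J -> R) :
  \sum_i \sum_j \sum_a \sum_b F i j a b = \sum_a \sum_b \sum_i \sum_j F i j a b.
Proof.
transitivity (\sum_i \sum_a \sum_j \sum_b F i j a b).
  by apply: eq_bigr => i _; exact: exchange_big.
rewrite exchange_big; apply: eq_bigr => a _.
transitivity (\sum_i \sum_b \sum_j F i j a b); last exact: exchange_big.
by apply: eq_bigr => i _; exact: exchange_big.
Qed.

Lemma contract2 n (U' U P : 'M[R]_n) D (W : 'I_n -> 'I_n -> R) :
  (forall a b, \sum_i \sum_j U' i j * (P i a * P j b) = D ^+ 2 * U a b) ->
  \sum_i \sum_j U' i j * (D ^+ 4 * \sum_a \sum_b P i a * P j b * W a b) =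
  D ^+ 6 * \sum_a \sum_b U a b * W a b.
Proof.
move=> UP; transitivity (\sum_i \sum_j \sum_a \sum_b
    U' i j * (D ^+ 4 * (P i a * P j b * W a b))).
  apply: eq_bigr => i _; apply: eq_bigr => j _; rewrite !mulr_sumr.
  by apply: eq_bigr => a _; rewrite !mulr_sumr.
rewrite exchange_big4 mulr_sumr; apply: eq_bigr => a _; rewrite mulr_sumr.
apply: eq_bigr => b _; rewrite (_ : _ * _ = D ^+ 4 * (D ^+ 2 * U a b) * W a b); last by ring.
rewrite -UP mulr_sumr mulr_suml; apply: eq_bigr => i _.
by rewrite mulr_sumr mulr_suml; apply: eq_bigr => j _; ring.
Qed.

(* [u] plays the Hessian and [C i] the derivatives of the Hessian. *)
Definition flecF n (u : 'M[R]_n) (C : 'I_n -> 'M[R]_n) : R :=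
  4%:R * (\sum_i \sum_j \adj u i j * \tr (\adj u *m C i *m (\adj u *m C j)))
  - 3%:R * (\sum_i \sum_j \adj u i j * (\tr (\adj u *m C i) * \tr (\adj u *m C j))).

Definition cubic_sub n (P : 'M[R]_n) (C : 'I_n -> 'M[R]_n) (i : 'I_n) : 'M[R]_n :=
  \sum_a P i a *: (P *m C a *m P^T).

(** Each term contracts the six indices of three adjugates with the six indices of two cubic
    tensors; in each contraction [P] meets its adjugate and leaves one factor [\det P]. *)
Lemma flecF_sub n (P u : 'M[R]_n) C :
  flecF (P *m u *m P^T) (cubic_sub P C) = \det P ^+ 6 * flecF u C.
Proof.
pose A := \adj P; pose U := \adj u; set D := \det P.
have AP : A *m P = D%:M by apply: mul_adj_mx.
have PA : P *m A = D%:M by apply: mul_mx_adj.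
have adjE : \adj (P *m u *m P^T) = A^T *m U *m A.
  by rewrite adjM adjM trmx_adj mulmxA.
pose C' i := \sum_a P i a *: (A^T *m U *m C a *m P^T).
have UC i : \adj (P *m u *m P^T) *m cubic_sub P C i = D *: C' i.
  rewrite adjE /cubic_sub /C' mulmx_sumr scaler_sumr; apply: eq_bigr => a _.
  rewrite -scalemxAr scalerA mulrC -scalerA; congr (_ *: _).
  by rewrite !mulmxA -[_ *m A *m P]mulmxA AP mul_mx_scalar -!scalemxAl.
have PTAT : P^T *m A^T = D%:M by rewrite -trmx_mul AP tr_scalar_mx.
have trC i : \tr (D *: C' i) = D ^+ 2 * \sum_a P i a * \tr (U *m C a).
  rewrite mxtraceZ /C' raddf_sum /= expr2 -mulrA; congr (_ * _).
  rewrite mulr_sumr; apply: eq_bigr => a _; rewrite mxtraceZ.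
  rewrite mxtrace_mulC !mulmxA PTAT -!mulmxA mul_scalar_mx mxtraceZ; ring.
have trCC i j : \tr ((D *: C' i) *m (D *: C' j)) =
    D ^+ 4 * \sum_a \sum_b P i a * P j b * \tr (U *m C a *m (U *m C b)).
  rewrite -scalemxAl -scalemxAr !mxtraceZ.
  suff -> : \tr (C' i *m C' j) =
      D ^+ 2 * \sum_a \sum_b P i a * P j b * \tr (U *m C a *m (U *m C b)) by ring.
  rewrite /C' mulmx_suml raddf_sum mulr_sumr /=.
  apply: eq_bigr => a _; rewrite mulmx_sumr raddf_sum mulr_sumr /=.
  apply: eq_bigr => b _; rewrite -scalemxAl -scalemxAr !mxtraceZ.
  have -> : A^T *m U *m C a *m P^T *m (A^T *m U *m C b *m P^T) =
            D *: (A^T *m (U *m C a *m (U *m C b) *m P^T)).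
    by rewrite !mulmxA -[_ *m P^T *m A^T]mulmxA PTAT mul_mx_scalar -!scalemxAl.
  rewrite mxtraceZ mxtrace_mulC -[_ *m P^T *m A^T]mulmxA PTAT mul_mx_scalar mxtraceZ; ring.
have UP a b : \sum_i \sum_j \adj (P *m u *m P^T) i j * (P i a * P j b) = D ^+ 2 * U a b.
  have gen (U' : 'M[R]_n) : \sum_i \sum_j U' i j * (P i a * P j b) = (P^T *m U' *m P) a b.
    rewrite mxE exchange_big /=; apply: eq_bigr => j _; rewrite mxE mulr_suml.
    by apply: eq_bigr => i _; rewrite mxE; ring.
  rewrite gen adjE !mulmxA PTAT -!mulmxA AP mul_scalar_mx mul_mx_scalar scalerA [LHS]mxE.
  by ring.
rewrite /flecF mulrBr; congr (_ - _); rewrite mulrCA; congr (_ * _).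
  rewrite -(contract2 (fun a b => \tr (U *m C a *m (U *m C b))) UP).
  by apply: eq_bigr => i _; apply: eq_bigr => j _; rewrite !UC trCC.
rewrite -(contract2 (fun a b => \tr (U *m C a) * \tr (U *m C b)) UP).
apply: eq_bigr => i _; apply: eq_bigr => j _; rewrite !UC !trC; congr (_ * _).
rewrite mulrACA -exprD; congr (_ * _); rewrite big_distrlr /=.
by apply: eq_bigr => a _; apply: eq_bigr => b _; ring.
Qed.

End Flec.

Notation o0 := (@Ordinal 4 0 isT).
Notation o1 := (@Ordinal 4 1 isT).
Notation o2 := (@Ordinal 4 2 isT).
Notation o3 := (@Ordinal 4 3 isT).

Lemma ord4_ind (P : 'I_4 -> Prop) : P o0 -> P o1 -> P o2 -> P o3 -> forall i, P i.
Proof.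
move=> p0 p1 p2 p3 [[|[|[|[|//]]]] h].
- by rewrite (bool_irrelevance h isT).
- by rewrite (bool_irrelevance h isT).
- by rewrite (bool_irrelevance h isT).
- by rewrite (bool_irrelevance h isT).
Qed.

Lemma sum_ord4 (V : nmodType) (F : 'I_4 -> V) : \sum_i F i = F o0 + F o1 + F o2 + F o3.
Proof.
rewrite !big_ord_recr big_ord0 /= add0r; congr (F _ + F _ + F _ + F _); exact: val_inj.
Qed.

Section FrameEval.
Variable R : comNzRingType.

(* Resultant of the binary quadratic form (A, 2B, C) and the binary cubic (a0, 3 a1, 3 a2, a3):
   it vanishes iff the two have a common zero, that is, a flecnodal direction. *)
Definition binres (A B C a0 a1 a2 a3 : R) : R :=
  C^+3*a0^+2 - 6%:R*B*C^+2*a0*a1 + 9%:R*A*C^+2*a1^+2 + 12%:R*B^+2*C*a0*a2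
  - 18%:R*A*B*C*a1*a2 + 9%:R*A^+2*C*a2^+2 - 8%:R*B^+3*a0*a3 + 12%:R*A*B^+2*a1*a3
  - 6%:R*A^+2*B*a2*a3 + A^+3*a3^+2 - 6%:R*A*C^+2*a0*a2 + 6%:R*A*B*C*a0*a3
  - 6%:R*A^+2*C*a1*a3.

Definition det3 (F : nat -> nat -> R) : R :=
  F 0 0 * (F 1 1 * F 2 2 - F 1 2 * F 2 1) - F 0 1 * (F 1 0 * F 2 2 - F 1 2 * F 2 0)
  + F 0 2 * (F 1 0 * F 2 1 - F 1 1 * F 2 0).

Lemma det_mx2 (F : nat -> nat -> R) :
  \det (\matrix_(i < 2, j < 2) F i j) = F 0 0 * F 1 1 - F 0 1 * F 1 0.
Proof.
rewrite (expand_det_row _ ord0) !big_ord_recl big_ord0 /cofactor !det_mx11 !mxE /=.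
rewrite /bump /=; ring.
Qed.

Lemma det_mx3 (F : nat -> nat -> R) : \det (\matrix_(i < 3, j < 3) F i j) = det3 F.
Proof.
have minor k : \det (row' ord0 (col' k (\matrix_(i < 3, j < 3) F i j))) =
    F 1 (bump k 0) * F 2 (bump k 1) - F 1 (bump k 1) * F 2 (bump k 0).
  rewrite -(det_mx2 (fun i j => F i.+1 (bump k j))); congr (\det _).
  by apply/matrixP => i j; rewrite !mxE.
rewrite (expand_det_row _ ord0) !big_ord_recl big_ord0 /cofactor !minor !mxE /=.
rewrite /bump /= /det3; ring.
Qed.

Lemma adj_mx4 (F : nat -> nat -> R) (i j : 'I_4) :
  \adj (\matrix_(i < 4, j < 4) F i j) i j =
  (-1) ^+ (j + i) * det3 (fun k l => F (bump j k) (bump i l)).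
Proof.
rewrite mxE /cofactor -det_mx3; congr (_ * \det _).
by apply/matrixP => k l; rewrite !mxE.
Qed.

Section Eval.
Variables (k n A B C D E G c111 c112 c122 c222 c113 c123 c223 c133 c233 c333 : R).

(** The Hessian in a frame [x, a, b, e] with [x] on the surface and [a, b] tangent: Euler's relation
    kills row 0 except for the entry [k]. In [cf], the third derivatives, an index 0 reduces to the
    Hessian with the Euler factor [n]. *)
Definition uf (i j : nat) : R :=
  nth 0 (nth [::] [:: [:: 0; 0; 0; k]; [:: 0; A; B; D]; [:: 0; B; C; E]; [:: k; D; E; G]] i) j.

Definition cf (a i j : nat) : R :=
  nth 0 (nth [::] (nth [::] [::
   [:: [:: 0; 0; 0; n*k]; [:: 0; n*A; n*B; n*D]; [:: 0; n*B; n*C; n*E]; [:: n*k; n*D; n*E; n*G]];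
   [:: [:: 0; n*A; n*B; n*D]; [:: n*A; c111; c112; c113]; [:: n*B; c112; c122; c123];
       [:: n*D; c113; c123; c133]];
   [:: [:: 0; n*B; n*C; n*E]; [:: n*B; c112; c122; c123]; [:: n*C; c122; c222; c223];
       [:: n*E; c123; c223; c233]];
   [:: [:: n*k; n*D; n*E; n*G]; [:: n*D; c113; c123; c133]; [:: n*E; c123; c223; c233];
       [:: n*G; c133; c233; c333]]] a) i) j.

Definition Uf (i j : nat) : R :=
  let T := A*(C*G-E*E)-B*(B*G-E*D)+D*(B*E-C*D) in
  let U01 := k*(D*C-B*E) in let U02 := k*(A*E-B*D) in let U03 := - k*(A*C-B*B) in
  let U11 := - k*k*C in let U12 := k*k*B in let U22 := - k*k*A in
  nth 0 (nth [::] [:: [:: T; U01; U02; U03]; [:: U01; U11; U12; 0];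
    [:: U02; U12; U22; 0]; [:: U03; 0; 0; 0]] i) j.

Lemma adj_uf : \adj (\matrix_(i < 4, j < 4) uf i j) = \matrix_(i < 4, j < 4) Uf i j.
Proof.
apply/matrixP => i j; rewrite adj_mx4 [RHS]mxE.
by elim/ord4_ind: i; elim/ord4_ind: j; rewrite /det3 /bump /uf /Uf /=; ring.
Qed.

Lemma flecF_table :
  flecF (\matrix_(i < 4, j < 4) uf i j) (fun a => \matrix_(i < 4, j < 4) cf a i j) =
  - k ^+ 6 * binres A B C c111 c112 c122 c222.
Proof.
rewrite /flecF adj_uf; set U := \matrix_(i, j) Uf i j.
pose M (a i j : nat) := Uf i 0 * cf a 0 j + Uf i 1 * cf a 1 j + Uf i 2 * cf a 2 j + Uf i 3 * cf a 3 j.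
have UC (a : 'I_4) : U *m (\matrix_(i < 4, j < 4) cf a i j) = \matrix_(i < 4, j < 4) M a i j.
  by apply/matrixP => i j; rewrite mxE sum_ord4 !mxE.
have tr1 (a : 'I_4) : \tr (\matrix_(i < 4, j < 4) M a i j) = M a 0 0 + M a 1 1 + M a 2 2 + M a 3 3.
  by rewrite /mxtrace sum_ord4 !mxE.
pose M2 (a b i : nat) := M a i 0 * M b 0 i + M a i 1 * M b 1 i + M a i 2 * M b 2 i + M a i 3 * M b 3 i.
have tr2 (a b : 'I_4) : \tr ((\matrix_(i < 4, j < 4) M a i j) *m (\matrix_(i < 4, j < 4) M b i j)) =
   M2 a b 0 + M2 a b 1 + M2 a b 2 + M2 a b 3.
  by rewrite /mxtrace sum_ord4 !mxE !sum_ord4 !mxE.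
have -> : \sum_i \sum_j U i j * \tr (U *m (\matrix_(i0, j0) cf i i0 j0) *m (U *m (\matrix_(i0, j0) cf j i0 j0)))
  = \sum_(i < 4) \sum_(j < 4) Uf i j * (M2 i j 0 + M2 i j 1 + M2 i j 2 + M2 i j 3).
  by apply: eq_bigr => i _; apply: eq_bigr => j _; rewrite !UC tr2 mxE.
have -> : \sum_i \sum_j U i j * (\tr (U *m (\matrix_(i0, j0) cf i i0 j0)) * \tr (U *m (\matrix_(i0, j0) cf j i0 j0)))
  = \sum_(i < 4) \sum_(j < 4) Uf i j * ((M i 0 0 + M i 1 1 + M i 2 2 + M i 3 3) * (M j 0 0 + M j 1 1 + M j 2 2 + M j 3 3)).
  by apply: eq_bigr => i _; apply: eq_bigr => j _; rewrite !UC !tr1 mxE.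
rewrite !sum_ord4 /= /M2 /M /Uf /cf /= /binres.
ring.
Qed.
End Eval.
End FrameEval.

Lemma flecF_ext (R : comNzRingType) n (u u' : 'M[R]_n) (C C' : 'I_n -> 'M[R]_n) :
  u = u' -> (forall a, C a = C' a) -> flecF u C = flecF u' C'.
Proof.
move=> -> e; rewrite /flecF; congr (_ * _ - _ * _);
  by apply: eq_bigr => i _; apply: eq_bigr => j _; rewrite !e.
Qed.

Lemma flecF_morph (R S : comNzRingType) (g : {rmorphism R -> S}) n (u : 'M[R]_n) C :
  g (flecF u C) = flecF (map_mx g u) (fun a => map_mx g (C a)).
Proof.
rewrite /flecF rmorphB !rmorphM !rmorph_nat !rmorph_sum /=; congr (_ * _ - _ * _);
  apply: eq_bigr => i _; rewrite rmorph_sum; apply: eq_bigr => j _.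
  by rewrite rmorphM -map_mx_adj [map_mx _ _ _ _]mxE -!map_mxM trace_map_mx.
by rewrite !rmorphM -map_mx_adj [map_mx _ _ _ _]mxE -!map_mxM !trace_map_mx.
Qed.

Lemma flecF_frame (R : comNzRingType) (u : 'M[R]_4) (C : 'I_4 -> 'M[R]_4) (n : R) :
  (forall i j, u i j = u j i) ->
  (forall a i j, C a i j = C i a j) -> (forall a i j, C a i j = C a j i) ->
  (forall i j, C o0 i j = n * u i j) -> u o0 o0 = 0 -> u o0 o1 = 0 -> u o0 o2 = 0 ->
  flecF u C = - u o0 o3 ^+ 6 * binres (u o1 o1) (u o1 o2) (u o2 o2)
    (C o1 o1 o1) (C o1 o1 o2) (C o1 o2 o2) (C o2 o2 o2).
Proof.
move=> us C1 C2 C0 u00 u01 u02.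
rewrite -(flecF_table _ n _ _ _ (u o1 o3) (u o2 o3) (u o3 o3) _ _ _ _ (C o1 o1 o3) (C o1 o2 o3)
  (C o2 o2 o3) (C o1 o3 o3) (C o2 o3 o3) (C o3 o3 o3)).
apply: flecF_ext => [|a]; apply/matrixP => i j; rewrite mxE.
  by rewrite /uf; elim/ord4_ind: i; elim/ord4_ind: j => //=; rewrite us.
have C0' i' j' : C i' o0 j' = n * u i' j' by rewrite C1 C0.
have C0'' i' j' : C i' j' o0 = n * u i' j' by rewrite C2 C0'.
have C21 j' : C o2 o1 j' = C o1 o2 j' by apply: C1.
have C31 j' : C o3 o1 j' = C o1 o3 j' by apply: C1.
have C32 j' : C o3 o2 j' = C o2 o3 j' by apply: C1.
have D21 i' : C i' o2 o1 = C i' o1 o2 by apply: C2.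
have D31 i' : C i' o3 o1 = C i' o1 o3 by apply: C2.
have D32 i' : C i' o3 o2 = C i' o2 o3 by apply: C2.
have [u10 u20] : u o1 o0 = 0 /\ u o2 o0 = 0 by rewrite !(us _ o0).
have [u30 u21] : u o3 o0 = u o0 o3 /\ u o2 o1 = u o1 o2 by split; apply: us.
have [u31 u32] : u o3 o1 = u o1 o3 /\ u o3 o2 = u o2 o3 by split; apply: us.
have E212 : C o1 o2 o1 = C o1 o1 o2 by [].
rewrite /cf; elim/ord4_ind: a; elim/ord4_ind: i; elim/ord4_ind: j;
  rewrite /= ?C0 ?C0' ?C0'' ?u00 ?u01 ?u02 ?u10 ?u20 ?u30 ?u21 ?u31 ?u32 ?mulr0 //;
  by rewrite ?C21 ?C31 ?C32 ?D21 ?D31 ?D32 ?C21 ?C31 ?C32.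
Qed.

(** * Directional derivatives and the covariance of the flecnodal form *)

Section Dd.
Variables (K : closedFieldType) (n : nat).
Implicit Types (p q : {mpoly K[n]}) (v w : 'rV[K]_n).

Lemma mderiv_sum (I : finType) (F : I -> {mpoly K[n]}) i :
  (\sum_j F j)^`M(i) = \sum_j (F j)^`M(i).
Proof. exact: raddf_sum. Qed.

Definition dd v p := \sum_i v 0 i *: p^`M(i).

Lemma ddD v p q : dd v (p + q) = dd v p + dd v q.
Proof. by rewrite /dd -big_split /=; apply: eq_bigr => i _; rewrite mderivD scalerDr. Qed.

Lemma ddM v p q : dd v (p * q) = dd v p * q + p * dd v q.
Proof.
rewrite /dd mulr_suml mulr_sumr -big_split /=; apply: eq_bigr => i _.
by rewrite mderivM scalerDr -scalerAl -scalerAr.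
Qed.

Lemma dd_comm v w p : dd v (dd w p) = dd w (dd v p).
Proof.
rewrite /dd; under eq_bigr => i _ do rewrite mderiv_sum scaler_sumr.
rewrite exchange_big /=; apply: eq_bigr => i _; rewrite mderiv_sum [RHS]scaler_sumr.
by apply: eq_bigr => j _; rewrite !mderivZ mderiv_comm !scalerA mulrC.
Qed.

Lemma ddDl v w p : dd (v + w) p = dd v p + dd w p.
Proof. by rewrite /dd -big_split /=; apply: eq_bigr => i _; rewrite mxE scalerDl. Qed.

Lemma ddZl c v p : dd (c *: v) p = c *: dd v p.
Proof. by rewrite /dd scaler_sumr; apply: eq_bigr => i _; rewrite mxE scalerA. Qed.

Lemma dd_delta i p : dd (delta_mx 0 i) p = p^`M(i).
Proof.
rewrite /dd (bigD1 i) //= big1 ?addr0 => [|j ji].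
  by rewrite mxE !eqxx scale1r.
by rewrite mxE eqxx (negbTE ji) scale0r.
Qed.

Lemma dd_homog d v p : p \is d.-homog -> dd v p \is d.-1.-homog.
Proof. by move=> hp; apply: rpred_sum => i _; apply: rpredZ; apply: mderiv_homog. Qed.

Lemma ev_dd x v p : ev x (dd v p) = \sum_i v 0 i * ev x p^`M(i).
Proof. by rewrite rmorph_sum; apply: eq_bigr => i _; rewrite /= mevZ. Qed.

Lemma dd_Euler d x p : p \is d.-homog -> ev x (dd x p) = d%:R * ev x p.
Proof. by move=> hp; rewrite ev_dd (mev_Euler _ _ hp). Qed.

Lemma deriv_line x v p :
  (mev polyC (pline x v) p)^`() = mev polyC (pline x v) (dd v p).
Proof. by rewrite deriv_pline rmorph_sum; apply: eq_bigr => i _; rewrite /= mevZ. Qed.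

Lemma dd_msub P v p : dd v (msub P p) = msub P (dd (v *m P) p).
Proof.
rewrite /dd rmorph_sum; under eq_bigr => i _ do rewrite mderiv_msub scaler_sumr.
rewrite exchange_big /=; apply: eq_bigr => j _; rewrite msubZ mxE scaler_suml.
by apply: eq_bigr => i _; rewrite scalerA.
Qed.

End Dd.

Section FlecPoly.
Variable K : closedFieldType.
Implicit Types (f : {mpoly K[4]}) (x a b e : 'rV[K]_4).

Definition hess f : 'M[{mpoly K[4]}]_4 := \matrix_(i, j) f^`M(i)^`M(j).
Definition cubm f (a : 'I_4) : 'M[{mpoly K[4]}]_4 := \matrix_(i, j) f^`M(a)^`M(i)^`M(j).
Definition flec f : {mpoly K[4]} := flecF (hess f) (cubm f).

Lemma flec_msub P f : flec (msub P f) = \det P ^+ 6 *: msub P (flec f).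
Proof.
pose P' := map_mx (@mpolyC 4 K) P.
have -> : \det P ^+ 6 *: msub P (flec f) = \det P' ^+ 6 * msub P (flec f).
  by rewrite det_map_mx -rmorphXn /= mul_mpolyC.
rewrite flecF_morph -flecF_sub; apply: flecF_ext => [|k].
  apply/matrixP => i j; rewrite !mxE mderiv_msub mderiv_sum.
  under eq_bigr => a _ do rewrite mderivZ mderiv_msub scaler_sumr.
  rewrite exchange_big; apply: eq_bigr => b _; rewrite !mxE mulr_suml.
  apply: eq_bigr => a _; rewrite !mxE mul_mpolyC mulrC mul_mpolyC !scalerA.
  by rewrite mulrC.
apply/matrixP => i j; rewrite !mxE summxE mderiv_msub !mderiv_sum.
apply: eq_bigr => c _; rewrite !mderivZ !mxE mderiv_msub mul_mpolyC; congr (_ *: _).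
rewrite mderiv_sum; under eq_bigr => a _ do rewrite mderivZ mderiv_msub scaler_sumr.
rewrite exchange_big; apply: eq_bigr => b _; rewrite !mxE mulr_suml.
apply: eq_bigr => a _; rewrite !mxE mul_mpolyC mulrC mul_mpolyC !scalerA.
by rewrite mulrC.
Qed.

End FlecPoly.

Section FlecHomog.
Variable K : closedFieldType.
Implicit Types (f g : {mpoly K[4]}) (x a b : 'rV[K]_4).

Lemma det_homog n e (M : 'M[{mpoly K[4]}]_n) :
  (forall i j, M i j \is e.-homog) -> \det M \is (n * e).-homog.
Proof.
move=> hM; apply: rpred_sum => s _.
have : \prod_i M i (s i) \is (n * e).-homog.
  rewrite -[X in (X * e)%N](card_ord n) -sum1_card big_distrl /=.
  by elim/big_rec2: _ => [|i k p _ hp]; [exact: dhomog1 | rewrite mul1n; apply: dhomogM].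
by case: odd_perm; rewrite ?expr0 ?mul1r // expr1 mulN1r dhomogN.
Qed.

Lemma mulmx_homog m n p d e (A : 'M[{mpoly K[4]}]_(m, n)) (B : 'M_(n, p)) :
  (forall i j, A i j \is d.-homog) -> (forall i j, B i j \is e.-homog) ->
  forall i j, (A *m B) i j \is (d + e).-homog.
Proof. by move=> hA hB i j; rewrite mxE; apply: rpred_sum => k _; apply: dhomogM. Qed.

(** Three adjugates of the Hessian, each of degree [3 (d + 1)], and two third derivatives of degree
    [d]. *)
Lemma flec_homog d f : f \is d.+3.-homog -> flec f \is (11 * d + 9).-homog.
Proof.
move=> hf; pose U := \adj (hess f).
have hU i j : U i j \is (3 * d.+1).-homog.
  rewrite mxE /cofactor -signr_odd.
  have h : \det (row' j (col' i (hess f))) \is (3 * d.+1).-homog.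
    by apply: det_homog => k l; rewrite !mxE; exact: (mderiv_homog _ (mderiv_homog _ hf)).
  by case: odd; rewrite ?expr0 ?mul1r // expr1 mulN1r dhomogN.
have hC c i j : cubm f c i j \is d.-homog.
  by rewrite mxE; exact: (mderiv_homog _ (mderiv_homog _ (mderiv_homog _ hf))).
have hUC c := mulmx_homog hU (hC c).
have htr e (M : 'M[{mpoly K[4]}]_4) : (forall i j, M i j \is e.-homog) -> \tr M \is e.-homog.
  by move=> h; apply: rpred_sum => i _; apply: h.
rewrite /flec /flecF -/U !mulr_natl; apply: rpredB; apply: rpredMn;
  apply: rpred_sum => i _; apply: rpred_sum => j _.
  have -> : (11 * d + 9 = 3 * d.+1 + ((3 * d.+1 + d) + (3 * d.+1 + d)))%N by lia.
  by apply: dhomogM => //; apply: htr; apply: mulmx_homog; apply: hUC.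
have -> : (11 * d + 9 = 3 * d.+1 + ((3 * d.+1 + d) + (3 * d.+1 + d)))%N by lia.
by apply: dhomogM => //; apply: dhomogM; apply: htr; apply: hUC.
Qed.

(** This identifies [flec]: on the surface it is, up to frame factors, the resultant of the second
    and third derivatives along the tangent directions [a] and [b]. *)
Lemma flec_frame d f x a b (e : 'rV[K]_4) : f \is d.-homog ->
  ev x f = 0 -> ev x (dd a f) = 0 -> ev x (dd b f) = 0 ->
  \det (frame x a b e) ^+ 6 * ev x (flec f) =
  - ev x (dd x (dd e f)) ^+ 6 * binres (ev x (dd a (dd a f))) (ev x (dd a (dd b f)))
     (ev x (dd b (dd b f))) (ev x (dd a (dd a (dd a f)))) (ev x (dd a (dd a (dd b f))))
     (ev x (dd a (dd b (dd b f)))) (ev x (dd b (dd b (dd b f)))).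
Proof.
move=> hf fx fa fb; set P := frame x a b e.
pose r i := row i P.
have rE i : r i = nth 0 [:: x; a; b; e] i by rewrite /r rowK.
have eu p i j : (P *m map_mx (mev idfun x) (hess p) *m P^T) i j = ev x (dd (r i) (dd (r j) p)).
  rewrite {2}/dd rmorph_sum mxE /=.
  under eq_bigr => l _ do rewrite mxE mulr_suml.
  rewrite exchange_big; apply: eq_bigr => k _; rewrite mevZ /dd mderiv_sum rmorph_sum mulr_sumr.
  by apply: eq_bigr => l _; rewrite /= mderivZ mevZ !mxE [p^`M(k)^`M(l)]mderiv_comm; rewrite /=; ring.
have ec k i j : cubic_sub P (fun c => map_mx (mev idfun x) (cubm f c)) k i j =
    ev x (dd (r k) (dd (r i) (dd (r j) f))).
  rewrite /cubic_sub summxE {3}/dd rmorph_sum; apply: eq_bigr => c _; rewrite [LHS]mxE /= mevZ.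
  congr (_ * _); first by rewrite /r [RHS]mxE.
  rewrite -dd_delta (dd_comm _ (r i)) (dd_comm _ (r j)) dd_delta -eu; congr ((_ *m _ *m _) i j).
have h1 v : dd v f \is d.-1.-homog by apply: dd_homog.
have h2 v w : dd v (dd w f) \is d.-1.-1.-homog by apply: dd_homog.
have fe := flecF_sub P (map_mx (mev idfun x) (hess f)) (fun c => map_mx (mev idfun x) (cubm f c)).
rewrite -(flecF_morph (mev idfun x)) -/(flec f) in fe; rewrite -fe.
rewrite (@flecF_frame _ _ _ (d.-1.-1)%:R); rewrite ?eu ?ec ?rE //=.
- by move=> i j; rewrite !eu dd_comm.
- by move=> c i j; rewrite !ec dd_comm.
- by move=> c i j; rewrite !ec (dd_comm (r i)).
- by move=> i j; rewrite ec eu rE /= (dd_Euler _ (h2 _ _)).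
- by rewrite (dd_Euler _ (h1 x)) (dd_Euler _ hf) fx !mulr0.
- by rewrite (dd_Euler _ (h1 a)) fa mulr0.
- by rewrite (dd_Euler _ (h1 b)) fb mulr0.
Qed.

End FlecHomog.

Lemma binres00 (R : comNzRingType) (B C a1 a2 a3 : R) : binres 0 B C 0 a1 a2 a3 = 0.
Proof. by rewrite /binres; ring. Qed.

(** * Polynomials vanishing on the surface *)

Section Good.
Variable K : closedFieldType.
Implicit Types (f g : {mpoly K[4]}) (x v w : 'rV[K]_4).

Definition good d f := [/\ f \is d.-homog, smooth f, (3 <= d)%N &
  forall p, p \in [pchar K] -> (d < p)%N].

Lemma good_natr d f k : good d f -> (0 < k <= d)%N -> k%:R != 0 :> K.
Proof.
move=> [_ _ _ hc] /andP[k0 kd]; apply/negP => /eqP kz.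
have [p pK] := natf0_pchar k0 (introT eqP kz).
have pk : (p %| k)%N by rewrite (dvdn_pcharf pK) kz.
by have := leq_trans (hc p pK) (dvdn_leq k0 pk); rewrite ltnNge kd.
Qed.

Lemma natr_tail_eq (p : {poly K}) : (forall t, p.[t] = 0) -> p = 0.
Proof.
move=> h; apply/eqP/negPn/negP => /closed_nonrootP[t]; rewrite /root h eqxx //.
Qed.

Lemma row_ext n (x' : 'rV[K]_n) (z : K) :
  exists2 x : 'rV[K]_n.+1, row_init x = x' & x 0 ord_max = z.
Proof.
exists (\row_i if unlift ord_max i is Some j then x' 0 j else z); last by rewrite mxE unlift_none.
apply/rowP => j; rewrite !mxE.
have -> : widen_ord (leqnSn n) j = lift ord_max j by apply/val_inj/esym/lift_max.
by rewrite liftK.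
Qed.

Lemma good_prime d f : good d f -> prime_elt f /\ (1 < size (muni f))%N.
Proof.
case: d => [|[|d]] [hf sf d3 _] //; split; first exact: (smooth_prime hf).
exact: (size_muni_gt1 hf).
Qed.

Lemma root_over (R : idomainType) (p : {poly R}) (r : R) (g : {rmorphism R -> K}) :
  (1 < size p)%N -> g (lead_coef p * r) != 0 -> exists2 z, (map_poly g p).[z] = 0 & g r != 0.
Proof.
move=> sp; rewrite rmorphM mulf_eq0 negb_or => /andP[lp gr].
have /closed_rootP[z /rootP z0] : size (map_poly g p) != 1%N.
  by rewrite size_map_poly_id0 // gtn_eqF.
by exists z.
Qed.

(** The Nullstellensatz for a prime [f]: otherwise there is a nonzero eliminant [Phi]; a point where
    neither [Phi] nor the leading coefficient of [f] vanishes lifts to a zero of [f], hence of [g],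
    and there [Phi] must vanish. *)
Lemma vanish_divides d f g : good d f -> (forall x, ev x f = 0 -> ev x g = 0) -> divides f g.
Proof.
move=> gf h; apply: NNPP => nd; have [pf sf] := good_prime gf.
have [Phi [P0 hP _]] := elim_mpoly pf sf nd.
have l0 : lead_coef (muni f) != 0.
  by rewrite lead_coef_eq0 -size_poly_gt0 ltnW.
have lP : lead_coef (muni f) * Phi != 0 by apply: mulf_neq0.
have [x' hx'] := mpoly_nonzero_point lP.
have [z z0 nP] := root_over sf hx'.
have [x rx xz] := row_ext x' z.
have fx : ev x f = 0 by have e := mev_muni idfun x f; rewrite rx xz in e; rewrite e; exact: z0.
have [a [b e]] := hP _ idfun x.
by case/negP: nP; rewrite rx in e; rewrite /= e fx (h _ fx) !mulr0 addr0.
Qed.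

Lemma tangent_vanish d f g x v : good d f -> (forall x, ev x f = 0 -> ev x g = 0) ->
  ev x f = 0 -> ev x (dd v f) = 0 -> ev x (dd v g) = 0.
Proof.
move=> gf h fx fv; have [c ->] := vanish_divides gf h.
by rewrite ddM rmorphD !rmorphM /= fx fv !mul0r addr0.
Qed.

Lemma line_poly0 f x v : (forall t, ev (x + t *: v) f = 0) -> mev polyC (pline x v) f = 0.
Proof. by move=> h; apply: natr_tail_eq => t; rewrite horner_mev horner_pline h. Qed.

Lemma line_dd f x v : (forall t, ev (x + t *: v) f = 0) ->
  forall t, ev (x + t *: v) (dd v f) = 0.
Proof.
move=> /line_poly0 h t; have := deriv_line x v f; rewrite h deriv0.
move/(congr1 (horner^~ t)); rewrite /= horner0 horner_mev horner_pline => <-.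
by [].
Qed.

Definition gradc f x : 'cV[K]_4 := \col_i ev x f^`M(i).

Lemma gradcE f x v : ev x (dd v f) = (v *m gradc f x) 0 0.
Proof. by rewrite ev_dd mxE; apply: eq_bigr => i _; rewrite mxE. Qed.

Lemma gradc_neq0 f x : smooth f -> x != 0 -> ev x f = 0 -> gradc f x != 0.
Proof.
move=> sf x0 fx; apply/negP => /eqP/colP g0; apply: (sf x x0); split=> // i.
by have := g0 i; rewrite !mxE.
Qed.

Lemma frame_unit_fwd (v0 v1 v2 v3 : 'rV[K]_4) :
  v0 != 0 -> ~~ (v1 <= v0)%MS -> ~~ (v2 <= v1 + v0)%MS ->
  ~~ (v3 <= v2 + (v1 + v0))%MS -> frame v0 v1 v2 v3 \in unitmx.
Proof.
move=> h3 h2 h1 h0; rewrite -row_free_unit /row_free eqn_leq rank_leq_row /=.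
have r3 : (1 <= \rank v0)%N by rewrite lt0n mxrank_eq0.
have r2 := leq_ltn_trans r3 (rank_adds_gt h2).
have r1 := leq_ltn_trans r2 (rank_adds_gt h1).
have r0 := leq_ltn_trans r1 (rank_adds_gt h0).
apply: leq_trans r0 _; apply: mxrankS.
have s (i : 'I_4) v : nth 0 [:: v0; v1; v2; v3] i = v -> (v <= frame v0 v1 v2 v3)%MS.
  by move=> <-; rewrite -(rowK (fun i : 'I_4 => nth 0 [:: v0; v1; v2; v3] i) i) row_sub.
rewrite !addsmx_sub; apply/and4P; split.
- exact: (s o3).
- exact: (s o2).
- exact: (s o1).
- exact: (s o0).
Qed.

Lemma rank_adds1 m (v : 'rV[K]_4) (A : 'M[K]_(m, 4)) k :
  (\rank A <= k)%N -> (\rank (v + A)%MS <= k.+1)%N.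
Proof.
move=> h; apply: leq_trans (mxrank_adds_leqif _ _) _.
exact: (leq_add (rank_leq_row v) h).
Qed.

Lemma pick_tangent (G : 'cV[K]_4) m (A : 'M[K]_(m, 4)) : (\rank A <= 2)%N ->
  exists2 b : 'rV[K]_4, (b *m G) 0 0 = 0 & ~~ (b <= A)%MS.
Proof.
move=> rA.
have : ~~ (kermx G <= A)%MS.
  apply/negP => /mxrankS; rewrite mxrank_ker => h.
  by have := leq_trans h rA; have := rank_leq_col G; move: (\rank G) => z; lia.
case/row_subPn => i hi; exists (row i (kermx G)) => //.
by rewrite -row_mul mulmx_ker !mxE.
Qed.

(** The direction of the line is a common zero of the quadratic and the cubic form in
    [flec_frame]. *)
Lemma flec_on_line d f x v : good d f -> x != 0 -> ~~ (v <= x)%MS ->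
  (forall t, ev (x + t *: v) f = 0) -> ev x (flec f) = 0.
Proof.
move=> [hf sf _ _] x0 vx hl.
have l0 p : (forall t, ev (x + t *: v) p = 0) -> ev x p = 0.
  by move=> /(_ 0); rewrite scale0r addr0.
have hl1 := line_dd hl; have hl2 := line_dd hl1; have hl3 := line_dd hl2.
have r1 : (\rank (v + x)%MS <= 2)%N by apply: rank_adds1; apply: rank_leq_row.
have [b fb hb] := pick_tangent (gradc f x) r1.
have [|e] := @pick_outside K 4 [:: (b + (v + x))%MS].
  by rewrite /= andbT ltnS; apply: rank_adds1.
rewrite /= andbT => he.
have U := frame_unit_fwd x0 vx hb he.
have := flec_frame e hf (l0 _ hl) (l0 _ hl1) (etrans (gradcE _ _ _) fb).
have e2 := l0 _ hl2; have e3 := l0 _ hl3.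
rewrite e2 e3 binres00 mulr0 => /eqP; rewrite mulf_eq0 expf_eq0 /=.
by move: U; rewrite unitmxE unitfE => /negbTE -> /= /eqP.
Qed.

End Good.

(** * The flecnodal covariant in a tangent frame along a line *)

Section Binres.
Variable R : comNzRingType.
Implicit Types A B C : R.

(** Along a line of the surface [A] and [a0] vanish; writing [binres] through them with cofactors
    [binres_l] and [binres_r] leaves only these cofactors in a first derivative. *)
Definition binres_l A B C a0 a1 a2 a3 : R :=
  9%:R*C^+2*a1^+2 - 18%:R*B*C*a1*a2 + 9%:R*A*C*a2^+2 + 12%:R*B^+2*a1*a3
  - 6%:R*A*B*a2*a3 + A^+2*a3^+2 - 6%:R*C^+2*a0*a2 + 6%:R*B*C*a0*a3 - 6%:R*A*C*a1*a3.

Definition binres_r B C a0 a1 a2 a3 : R :=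
  C^+3*a0 - 6%:R*B*C^+2*a1 + 12%:R*B^+2*C*a2 - 8%:R*B^+3*a3.

Lemma binres_split A B C a0 a1 a2 a3 : binres A B C a0 a1 a2 a3 =
  A * binres_l A B C a0 a1 a2 a3 + a0 * binres_r B C a0 a1 a2 a3.
Proof. by rewrite /binres /binres_l /binres_r; ring. Qed.

(** For [A = a0 = 0] both forms share a linear factor; this is the resultant of the residual forms
    [(2B, C)] and [(3 a1, 3 a2, a3)]. *)
Definition quad_q B C a1 a2 a3 : R := 3%:R*C^+2*a1 - 6%:R*B*C*a2 + 4%:R*B^+2*a3.

Lemma binres_l00 B C a1 a2 a3 :
  binres_l 0 B C 0 a1 a2 a3 = 3%:R * a1 * quad_q B C a1 a2 a3.
Proof. by rewrite /binres_l /quad_q; ring. Qed.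

Lemma binres_r0 B C a1 a2 a3 :
  binres_r B C 0 a1 a2 a3 = - (2%:R * B * quad_q B C a1 a2 a3).
Proof. by rewrite /binres_r /quad_q; ring. Qed.

End Binres.

Lemma binres_morph (R S : comNzRingType) (g : {rmorphism R -> S}) (A B C a0 a1 a2 a3 : R) :
  g (binres A B C a0 a1 a2 a3) = binres (g A) (g B) (g C) (g a0) (g a1) (g a2) (g a3).
Proof.
by rewrite /binres; ring.
Qed.

Section Tensors.
Variable R : comNzRingType.
(* Second and third derivatives along combinations of [r e1 - s e3] and [r e2 - t e3], from
   the corresponding partial derivatives. *)
Definition quad2 (r s a b c : R) := r ^+ 2 * a - 2%:R * r * s * b + s ^+ 2 * c.
Definition bil2 (r s t m12 m13 m23 m33 : R) := r * (r * m12 - t * m13) - s * (r * m23 - t * m33).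
Definition cub3 (r s a b c e : R) :=
  r ^+ 3 * a - 3%:R * r ^+ 2 * s * b + 3%:R * r * s ^+ 2 * c - s ^+ 3 * e.
Definition mix3 (r s t a b c a' b' c' : R) := r * quad2 r s a b c - t * quad2 r s a' b' c'.
End Tensors.

Section TensorMorph.
Variables (R S : comNzRingType) (g : {rmorphism R -> S}).
Lemma quad2_morph r s a b c : g (quad2 r s a b c) = quad2 (g r) (g s) (g a) (g b) (g c).
Proof. by rewrite /quad2; ring. Qed.
Lemma bil2_morph r s t a b c e :
  g (bil2 r s t a b c e) = bil2 (g r) (g s) (g t) (g a) (g b) (g c) (g e).
Proof. by rewrite /bil2; ring. Qed.
Lemma cub3_morph r s a b c e : g (cub3 r s a b c e) = cub3 (g r) (g s) (g a) (g b) (g c) (g e).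
Proof. by rewrite /cub3; ring. Qed.
Lemma mix3_morph r s t a b c a' b' c' : g (mix3 r s t a b c a' b' c') =
  mix3 (g r) (g s) (g t) (g a) (g b) (g c) (g a') (g b') (g c').
Proof. by rewrite /mix3 rmorphB !rmorphM !quad2_morph. Qed.
End TensorMorph.

Section Fields.
Variable K : closedFieldType.
Variable f : {mpoly K[4]}.

(** [tA], [tB], [tC] and [t0] to [t3] are the second and third derivatives along the tangent fields
    [avec] and [bvec], the vectors being held fixed while differentiating. As polynomials in the
    point they can be differentiated again. *)
Definition tA := quad2 f;;o3 f;;o1 f;;o1;;o1 f;;o1;;o3 f;;o3;;o3.
Definition tB := bil2 f;;o3 f;;o1 f;;o2 f;;o1;;o2 f;;o1;;o3 f;;o2;;o3 f;;o3;;o3.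
Definition tC := quad2 f;;o3 f;;o2 f;;o2;;o2 f;;o2;;o3 f;;o3;;o3.
Definition t0 := cub3 f;;o3 f;;o1 f;;o1;;o1;;o1 f;;o1;;o1;;o3 f;;o1;;o3;;o3 f;;o3;;o3;;o3.
Definition t1 := mix3 f;;o3 f;;o1 f;;o2 f;;o1;;o1;;o2 f;;o1;;o2;;o3 f;;o2;;o3;;o3
  f;;o1;;o1;;o3 f;;o1;;o3;;o3 f;;o3;;o3;;o3.
Definition t2 := mix3 f;;o3 f;;o2 f;;o1 f;;o1;;o2;;o2 f;;o1;;o2;;o3 f;;o1;;o3;;o3
  f;;o2;;o2;;o3 f;;o2;;o3;;o3 f;;o3;;o3;;o3.
Definition t3 := cub3 f;;o3 f;;o2 f;;o2;;o2;;o2 f;;o2;;o2;;o3 f;;o2;;o3;;o3 f;;o3;;o3;;o3.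

Lemma tAE : tA = quad2 f;;o3 f;;o1 f;;o1;;o1 f;;o1;;o3 f;;o3;;o3. Proof. by []. Qed.
Lemma t0E : t0 = cub3 f;;o3 f;;o1 f;;o1;;o1;;o1 f;;o1;;o1;;o3 f;;o1;;o3;;o3 f;;o3;;o3;;o3.
Proof. by []. Qed.

Lemma tensors_morph (S : comNzRingType) (g : {rmorphism {mpoly K[4]} -> S}) :
  [/\ g tA = quad2 (g f;;o3) (g f;;o1) (g f;;o1;;o1) (g f;;o1;;o3) (g f;;o3;;o3),
      g tB = bil2 (g f;;o3) (g f;;o1) (g f;;o2) (g f;;o1;;o2) (g f;;o1;;o3) (g f;;o2;;o3) (g f;;o3;;o3),
      g tC = quad2 (g f;;o3) (g f;;o2) (g f;;o2;;o2) (g f;;o2;;o3) (g f;;o3;;o3) &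
  [/\ g t0 = cub3 (g f;;o3) (g f;;o1) (g f;;o1;;o1;;o1) (g f;;o1;;o1;;o3) (g f;;o1;;o3;;o3) (g f;;o3;;o3;;o3),
      g t1 = mix3 (g f;;o3) (g f;;o1) (g f;;o2) (g f;;o1;;o1;;o2) (g f;;o1;;o2;;o3) (g f;;o2;;o3;;o3)
        (g f;;o1;;o1;;o3) (g f;;o1;;o3;;o3) (g f;;o3;;o3;;o3),
      g t2 = mix3 (g f;;o3) (g f;;o2) (g f;;o1) (g f;;o1;;o2;;o2) (g f;;o1;;o2;;o3) (g f;;o1;;o3;;o3)
        (g f;;o2;;o2;;o3) (g f;;o2;;o3;;o3) (g f;;o3;;o3;;o3) &
      g t3 = cub3 (g f;;o3) (g f;;o2) (g f;;o2;;o2;;o2) (g f;;o2;;o2;;o3) (g f;;o2;;o3;;o3) (g f;;o3;;o3;;o3)]].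
Proof.
split; last split.
- exact: quad2_morph.
- exact: bil2_morph.
- exact: quad2_morph.
- exact: cub3_morph.
- exact: mix3_morph.
- exact: mix3_morph.
- exact: cub3_morph.
Qed.

Definition avec (x : 'rV[K]_4) : 'rV[K]_4 :=
  ev x f;;o3 *: delta_mx 0 o1 + (- ev x f;;o1) *: delta_mx 0 o3.
Definition bvec (x : 'rV[K]_4) : 'rV[K]_4 :=
  ev x f;;o3 *: delta_mx 0 o2 + (- ev x f;;o2) *: delta_mx 0 o3.

Lemma ev_dd2 (x : 'rV[K]_4) (r s : K) i j p :
  ev x (dd (r *: delta_mx 0 i + s *: delta_mx 0 j) p) = r * ev x p;;i + s * ev x p;;j.
Proof. by rewrite ddDl !ddZl !dd_delta rmorphD /= !mevZ. Qed.

Lemma mderiv_dd2 (r s : K) i j k (p : {mpoly K[4]}) :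
  (dd (r *: delta_mx 0 i + s *: delta_mx 0 j) p);;k =
  dd (r *: delta_mx 0 i + s *: delta_mx 0 j) p;;k.
Proof. by rewrite -[LHS]dd_delta dd_comm dd_delta. Qed.

Lemma tensor_eval x :
  [/\ ev x (dd (avec x) (dd (avec x) f)) = ev x tA,
      ev x (dd (avec x) (dd (bvec x) f)) = ev x tB,
      ev x (dd (bvec x) (dd (bvec x) f)) = ev x tC &
  [/\ ev x (dd (avec x) (dd (avec x) (dd (avec x) f))) = ev x t0,
      ev x (dd (avec x) (dd (avec x) (dd (bvec x) f))) = ev x t1,
      ev x (dd (avec x) (dd (bvec x) (dd (bvec x) f))) = ev x t2 &
      ev x (dd (bvec x) (dd (bvec x) (dd (bvec x) f))) = ev x t3]].
Proof.
have c21 (p : {mpoly K[4]}) : p;;o2;;o1 = p;;o1;;o2 by apply: mderiv_comm.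
have c31 (p : {mpoly K[4]}) : p;;o3;;o1 = p;;o1;;o3 by apply: mderiv_comm.
have c32 (p : {mpoly K[4]}) : p;;o3;;o2 = p;;o2;;o3 by apply: mderiv_comm.
have /= [e1 e2 e3 [e4 e5 e6 e7]] := tensors_morph (mev idfun x).
split; last split; [rewrite e1|rewrite e2|rewrite e3|rewrite e4|rewrite e5|rewrite e6|rewrite e7];
rewrite /avec /bvec /mix3 /quad2 /bil2 /cub3 !(ev_dd2, mderiv_dd2) ?(c21, c31, c32);
repeat match goal with |- context [mev ?a ?b ?c] => move: (mev a b c) => ? end; ring.
Qed.

End Fields.
#[global] Opaque tA tB tC t0 t1 t2 t3.

Lemma size_mul_le (R : nzRingType) m n (p q : {poly R}) :
  (size p <= m.+1)%N -> (size q <= n.+1)%N -> (size (p * q)%R <= (m + n).+1)%N.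
Proof.
move=> hp hq; apply: leq_trans (size_polyMleq _ _) _.
by move: hp hq; move: (size p) (size q) => a b; lia.
Qed.

Lemma binres_eq (R : comNzRingType) (A B C a0 a1 a2 a3 A' B' C' a0' a1' a2' a3' : R) :
  A = A' -> B = B' -> C = C' -> a0 = a0' -> a1 = a1' -> a2 = a2' -> a3 = a3' ->
  binres A B C a0 a1 a2 a3 = binres A' B' C' a0' a1' a2' a3'.
Proof. by move=> -> -> -> -> -> -> ->. Qed.

Lemma binres_l_morph (R S : comNzRingType) (g : {rmorphism R -> S}) (A B C a0 a1 a2 a3 : R) :
  g (binres_l A B C a0 a1 a2 a3) = binres_l (g A) (g B) (g C) (g a0) (g a1) (g a2) (g a3).
Proof. by rewrite /binres_l; ring. Qed.

Lemma binres_r_morph (R S : comNzRingType) (g : {rmorphism R -> S}) (B C a0 a1 a2 a3 : R) :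
  g (binres_r B C a0 a1 a2 a3) = binres_r (g B) (g C) (g a0) (g a1) (g a2) (g a3).
Proof. by rewrite /binres_r; ring. Qed.

Section LineRestriction.
Variable K : closedFieldType.
Implicit Types f p q : {mpoly K[4]}.

(** Restriction to the fixed line [e0 + y e1]; any other line is brought here by [msub] with a
    frame. *)
Definition Lp p : {poly K} := mev polyC (pline (delta_mx 0 o0) (delta_mx 0 o1)) p.

HB.instance Definition _ := GRing.RMorphism.copy Lp
  (mev polyC (pline (delta_mx 0 o0 : 'rV[K]_4) (delta_mx 0 o1))).

Definition pt (y : K) : 'rV[K]_4 := delta_mx 0 o0 + y *: delta_mx 0 o1.

Lemma horner_Lp p y : (Lp p).[y] = ev (pt y) p.
Proof. by rewrite /Lp horner_mev horner_pline. Qed.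

Lemma deriv_Lp p : (Lp p)^`() = Lp p;;o1.
Proof. by rewrite /Lp deriv_line dd_delta. Qed.

Lemma LpZ c p : Lp (c *: p) = c%:P * Lp p.
Proof. by rewrite /Lp mevZ. Qed.

Lemma poly_eq_horner (p q : {poly K}) : (forall y, p.[y] = q.[y]) -> p = q.
Proof.
move=> h; apply/eqP; rewrite -subr_eq0; apply/eqP/natr_tail_eq => t.
by rewrite hornerD hornerN h subrr.
Qed.

Lemma pt_neq0 y : pt y != 0.
Proof.
apply/negP => /eqP/rowP/(_ o0); rewrite !mxE /= mulr0 addr0 => /eqP.
by rewrite oner_eq0.
Qed.

Lemma Lp_X0 : Lp 'X_o0 = 1.
Proof. by rewrite /Lp mevX !mxE /= mulr0 addr0. Qed.

Lemma size_pline n d (x v : 'rV[K]_n) (p : {mpoly K[n]}) :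
  p \is d.-homog -> (size (mev polyC (pline x v) p) <= d.+1)%N.
Proof.
move=> hp; rewrite {1}[p]mpolyE rmorph_sum /=.
apply: leq_trans (size_sum _ _ _) _; apply/bigmax_leqP_seq => m mp _.
have hd : mdeg m = d by apply: (dhomogP _ _ _ hp).
rewrite mevZ -[d]add0n; apply: size_mul_le; first exact: size_polyC_leq1.
have -> : mev polyC (pline x v) 'X_[m] = \prod_(i < n) pline x v 0%R i ^+ m i.
  rewrite mpolyXE_id rmorph_prod /=; apply: eq_bigr => i _.
  by rewrite rmorphXn /= mevX.
rewrite -hd mdegE; elim/big_rec2: _ => [|i k q _ IH]; first by rewrite size_poly1.
apply: size_mul_le IH; apply: leq_trans (size_poly_exp_leq _ _) _; rewrite ltnS.
have : (size (pline x v 0%R i) <= 2)%N.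
  rewrite !mxE; apply: leq_trans (size_polyD _ _) _; rewrite geq_max.
  rewrite (leq_trans (size_polyC_leq1 _)) //=.
  apply: leq_trans (size_polyMleq _ _) _; rewrite size_polyX /=.
  by rewrite ltnS size_polyC_leq1.
by case: (size _) => [|[|[]]] //= _; rewrite ?mul0n ?mul1n //; lia.
Qed.

Lemma size_Lp d p : p \is d.-homog -> (size (Lp p) <= d.+1)%N.
Proof. exact: size_pline. Qed.

Variable f : {mpoly K[4]}.

(* The derivative along the tangent direction b = f3 e2 - f2 e3, at the points of the line. *)
Definition Db p : {poly K} := Lp f;;o3 * Lp p;;o2 - Lp f;;o2 * Lp p;;o3.

Lemma DbD p q : Db (p + q) = Db p + Db q.
Proof. by rewrite /Db !mderivD !rmorphD /=; ring. Qed.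

Lemma DbN p : Db (- p) = - Db p.
Proof. by rewrite /Db !mderivN !rmorphN /=; ring. Qed.

Lemma DbM p q : Db (p * q) = Db p * Lp q + Lp p * Db q.
Proof. by rewrite /Db !mderivM !rmorphD !rmorphM /=; ring. Qed.

Lemma Db_nat n : Db n%:R = 0.
Proof.
by rewrite /Db -mpolyC_nat !mderivC rmorph0 !mulr0 subr0.
Qed.

Lemma horner_Db p y : (Db p).[y] = ev (pt y) (dd (bvec f (pt y)) p).
Proof. by rewrite /bvec ev_dd2 /Db hornerD hornerN !hornerM !horner_Lp; ring. Qed.

Lemma bvec_tangent x : ev x (dd (bvec f x) f) = 0.
Proof. by rewrite /bvec ev_dd2; ring. Qed.

Lemma avec_tangent x : ev x (dd (avec f x) f) = 0.
Proof. by rewrite /avec ev_dd2; ring. Qed.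

Lemma det_frame_ab x : \det (frame x (avec f x) (bvec f x) (delta_mx 0 o3)) = x 0 o0 * ev x f;;o3 ^+ 2.
Proof.
rewrite -det_tr det_trig; last first.
  apply/is_trig_mxP => i j; rewrite !mxE.
  case: j => [[|[|[|[|]]]]] //= hj; case: i => [[|[|[|[|]]]]] //= hi _; rewrite !mxE //=;
  by rewrite ?(mulr0, mulr0n, addr0).
rewrite !big_ord_recr big_ord0 /= !mxE /= ?mxE /=.
rewrite !(mulr1n, mulr0n, mulr1, mulr0, addr0, add0r, mul1r, oppr0) expr2 mulrA.
by congr (x 0 _ * _ * _); apply: val_inj.
Qed.

(** [flec_frame] for the polynomial tangent frame [x, avec, bvec, e3], whose determinant is
    [x0 * f3 ^ 2]. *)
Lemma flec_tensor d x : f \is d.-homog -> ev x f = 0 ->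
  (x 0 o0 * ev x f;;o3 ^+ 2) ^+ 6 * ev x (flec f) =
  - (d.-1%:R * ev x f;;o3) ^+ 6 * ev x (binres (tA f) (tB f) (tC f) (t0 f) (t1 f) (t2 f) (t3 f)).
Proof.
move=> hf fx; have := flec_frame (delta_mx 0 o3) hf fx (avec_tangent x) (bvec_tangent x).
rewrite det_frame_ab => ->; rewrite (dd_Euler (d := d.-1)) ?dd_delta; last exact: mderiv_homog.
congr (_ * _); rewrite binres_morph; have [eA eB eC [e0 e1 e2 e3]] := tensor_eval f x.
exact: binres_eq.
Qed.

Variable d : nat.
Hypothesis gf : good d f.
Hypothesis fL : Lp f = 0.

Lemma Db_vanish p : (forall x, ev x f = 0 -> ev x p = 0) -> Db p = 0.
Proof.
move=> h; apply: natr_tail_eq => y; rewrite horner_Db.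
apply: (tangent_vanish gf h); last exact: bvec_tangent.
by rewrite -horner_Lp fL horner0.
Qed.

Let g2 := Lp f;;o2.
Let g3 := Lp f;;o3.

(* [Qp] is the form Q of the header and [Wp] the numerator of the Schwarzian derivative of
   [g2 / g3], in the affine coordinate of the line. *)
Definition w1 := g3 * g2^`() - g2 * g3^`().
Definition w2 := g3 * g2^`()^`() - g2 * g3^`()^`().
Definition w3 := g3 * g2^`()^`()^`() - g2 * g3^`()^`()^`().
Definition ubb := quad2 g3 g2 (Lp f;;o2;;o2) (Lp f;;o2;;o3) (Lp f;;o3;;o3).
Definition c1bb := quad2 g3 g2 (Lp f;;o1;;o2;;o2) (Lp f;;o1;;o2;;o3) (Lp f;;o1;;o3;;o3).
Definition cbbb := cub3 g3 g2 (Lp f;;o2;;o2;;o2) (Lp f;;o2;;o2;;o3) (Lp f;;o2;;o3;;o3) (Lp f;;o3;;o3;;o3).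
Definition Qp := quad_q w1 ubb w2 c1bb cbbb.
Definition Wp := 2%:R * w1 * (g3 * w3 - 3%:R * g3^`()^`() * w1)
  - 3%:R * w2 * (g3 * w2 - 2%:R * g3^`() * w1).
Definition Omega := Db (flec f).

Lemma Lp_1 : Lp f;;o1 = 0. Proof. by rewrite -deriv_Lp fL deriv0. Qed.
Lemma Lp_11 : Lp f;;o1;;o1 = 0. Proof. by rewrite -deriv_Lp Lp_1 deriv0. Qed.
Lemma Lp_111 : Lp f;;o1;;o1;;o1 = 0. Proof. by rewrite -deriv_Lp Lp_11 deriv0. Qed.

Lemma mderiv1C p i : Lp p;;o1;;i = (Lp p;;i)^`().
Proof. by rewrite deriv_Lp mderiv_comm. Qed.

Lemma mderiv11C p i : Lp p;;o1;;o1;;i = (Lp p;;i)^`()^`().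
Proof. by rewrite !mderiv1C. Qed.

Lemma Db_1 : Db f;;o1 = w1.
Proof. by rewrite /Db !mderiv1C /w1 /g2 /g3. Qed.
Lemma Db_11 : Db f;;o1;;o1 = w2.
Proof. by rewrite /Db !mderiv1C /w2 /g2 /g3. Qed.
Lemma Db_111 : Db f;;o1;;o1;;o1 = w3.
Proof. by rewrite /Db !mderiv1C /w3 /g2 /g3. Qed.

Lemma Lp_tensors : [/\ Lp (tA f) = 0, Lp (tB f) = g3 * w1, Lp (tC f) = ubb &
  [/\ Lp (t0 f) = 0, Lp (t1 f) = g3 ^+ 2 * w2, Lp (t2 f) = g3 * c1bb & Lp (t3 f) = cbbb]].
Proof.
have z := (Lp_111, Lp_11, Lp_1, mderiv11C, mderiv1C).
have [eA eB eC [e0 e1 e2 e3]] := tensors_morph f Lp.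
have q0 (r b c : {poly K}) : quad2 r 0 0 b c = 0 by rewrite /quad2; ring.
have q1 (r a b c : {poly K}) : quad2 r 0 a b c = r ^+ 2 * a by rewrite /quad2; ring.
split; last split.
- by rewrite eA /= !z q0.
- by rewrite eB /= !z /bil2 -/g2 -/g3 /w1 mul0r subr0.
- by rewrite eC.
- by rewrite e0 /= !z /cub3; ring.
- rewrite e1 /mix3 /= !z !q1 -/g2 -/g3 /w2.
  by move: (g2^`()^`()) (g3^`()^`()) => a b; ring.
- by rewrite e2 /mix3 /= Lp_1 mul0r subr0.
- by rewrite e3.
Qed.

Lemma Db_quad2 r s a b c : Lp s = 0 -> Lp a = 0 ->
  Db (quad2 r s a b c) = Lp r ^+ 2 * Db a - 2%:R * Lp r * Db s * Lp b.
Proof.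
move=> s0 a0; rewrite /quad2 !expr2 !(Db_nat, DbD, DbN, DbM) !(rmorph_nat, rmorphM) /= s0 a0.
by move: (Lp r) (Lp b) (Lp c) (Db r) (Db s) (Db a) (Db b) (Db c); clear; intros; ring.
Qed.

Lemma Db_cub3 r s a b c e : Lp s = 0 -> Lp a = 0 ->
  Db (cub3 r s a b c e) = Lp r ^+ 3 * Db a - 3%:R * Lp r ^+ 2 * Db s * Lp b.
Proof.
move=> s0 a0; rewrite /cub3 !exprS !expr0 !mulr1 !(Db_nat, DbD, DbN, DbM) !(rmorph_nat, rmorphM) /= s0 a0.
by move: (Lp r) (Lp b) (Lp c) (Lp e) (Db r) (Db s) (Db a) (Db b) (Db c) (Db e); clear; intros; ring.
Qed.

Lemma Db_tA : Db (tA f) = g3 * (g3 * w2 - 2%:R * g3^`() * w1).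
Proof.
rewrite tAE (Db_quad2 _ _ _ Lp_1 Lp_11) Db_1 Db_11 mderiv1C -/g3.
by move: (g3^`()) w1 w2 => a b c; ring.
Qed.

Lemma Db_t0 : Db (t0 f) = g3 ^+ 2 * (g3 * w3 - 3%:R * g3^`()^`() * w1).
Proof.
rewrite t0E (Db_cub3 _ _ _ _ Lp_1 Lp_111) Db_1 Db_111 mderiv11C -/g3.
by move: (g3^`()^`()) w1 w3 => a b c; ring.
Qed.

Lemma Db_combination (p F q A l a r : {mpoly K[4]}) : Lp F = 0 -> Lp A = 0 -> Lp a = 0 ->
  Db (p * F + q * (A * l + a * r)) = Lp p * Db F + Lp q * (Db A * Lp l + Db a * Lp r).
Proof.
move=> F0 A0 a0; rewrite !(DbD, DbM) rmorphD !rmorphM F0 A0 a0.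
by rewrite !(mulr0, mul0r, addr0, add0r) /= A0 a0 !mul0r addr0 mulr0 add0r.
Qed.

(** The identity [flec_tensor] holds on the whole surface, so it may be differentiated in the
    tangent direction [bvec]. On the line [flec], [tA] and [t0] vanish, and only their own
    derivatives survive; the two cofactors share [quad_q], which yields [Qp], and what remains is
    [Wp]. *)
Lemma Omega_eq : g3 ^+ 12 * Omega = d.-1%:R ^+ 6 * g3 ^+ 11 * Qp * Wp.
Proof.
have [hf _ _ _] := gf; have [lA lB lC [l0 l1 l2 l3]] := Lp_tensors.
pose G := ('X_o0 * f;;o3 ^+ 2) ^+ 6 * flec f + (d.-1%:R * f;;o3) ^+ 6 *
  binres (tA f) (tB f) (tC f) (t0 f) (t1 f) (t2 f) (t3 f).
have hG x : ev x f = 0 -> ev x G = 0.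
  move=> fx; have := flec_tensor hf fx; rewrite /G.
  move: (binres _ _ _ _ _ _ _) (flec f) => u v.
  rewrite !(rmorph_nat, rmorphXn, rmorphM, rmorphD) /= mevX => ->.
  by move: (ev x f;;o3) (ev x u) => a b; ring.
have := Db_vanish hG; rewrite /G binres_split.
have lF : Lp (flec f) = 0.
  apply: natr_tail_eq => y; rewrite horner_Lp; apply: (flec_on_line (v := delta_mx 0 o1) gf (pt_neq0 y)).
    apply/negP => /sub_rVP[c] /rowP e.
    have := e o0; have := e o1; rewrite !mxE /= !(mulr0, addr0, mulr1, add0r) => e1 c0.
    by move: e1; rewrite -c0 mul0r => /eqP; rewrite oner_eq0.
  move=> t; rewrite -addrA -scalerDl -/(pt _) -horner_Lp fL horner0 //.
rewrite (Db_combination _ _ _ _ lF lA l0) Db_tA Db_t0 -/Omega.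
have -> : Lp (('X_o0 * f;;o3 ^+ 2) ^+ 6) = g3 ^+ 12.
  by rewrite rmorphXn rmorphM rmorphXn /= Lp_X0 mul1r -exprM.
have -> : Lp ((d.-1%:R * f;;o3) ^+ 6) = (d.-1%:R * g3) ^+ 6.
  by rewrite rmorphXn rmorphM rmorph_nat.
have -> : Lp (binres_l (tA f) (tB f) (tC f) (t0 f) (t1 f) (t2 f) (t3 f)) =
   binres_l 0 (g3 * w1) ubb 0 (g3 ^+ 2 * w2) (g3 * c1bb) cbbb.
  by rewrite binres_l_morph /= lA lB lC l0 l1 l2 l3.
have -> : Lp (binres_r (tB f) (tC f) (t0 f) (t1 f) (t2 f) (t3 f)) =
   binres_r (g3 * w1) ubb 0 (g3 ^+ 2 * w2) (g3 * c1bb) cbbb.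
  by rewrite binres_r_morph /= lB lC l0 l1 l2 l3.
rewrite binres_l00 binres_r0 /Qp /Wp /quad_q => e.
apply/eqP; rewrite -subr_eq0 -e; apply/eqP.
move: Omega w1 w2 w3 c1bb cbbb ubb (g3^`()) (g3^`()^`()) => O a1 a2 a3 b1 b2 b3 h1 h2.
by ring.
Qed.
End LineRestriction.

(** * The Schwarzian derivative *)

Section Poly.
Variable K : closedFieldType.
Implicit Types p q g h : {poly K}.

(** The change of affine coordinate from [y] to its inverse on the projective line. *)
Lemma poly_rev n p q : (size p <= n.+1)%N ->
  (forall y, y != 0 -> p.[y] = y ^+ n * q.[y^-1]) -> (size q <= n.+1)%N ->
  forall i, (i <= n)%N -> p`_i = q`_(n - i).
Proof.
move=> sp e sq i ni; pose c := \poly_(i < n.+1) q`_(n - i).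
suff -> : p = c by rewrite coef_poly ltnS ni.
apply/eqP; rewrite -subr_eq0 -[_ == _]orFb -(polyX_eq0 K) -mulf_eq0; apply/eqP.
apply: natr_tail_eq => y; rewrite hornerM hornerX.
have [->|y0] := eqVneq y 0; first by rewrite mul0r.
suff e1 : p.[y] = c.[y] by rewrite hornerD hornerN e1 subrr mulr0.
rewrite e // (horner_coef_wide _ sq) mulr_sumr horner_poly (reindex_inj rev_ord_inj) /=.
apply: eq_bigr => k _; have kn : (k <= n)%N by rewrite -ltnS.
rewrite subSS -{1}(subnK kn) exprD exprVn.
have : y ^+ (n - k) != 0 by rewrite expf_neq0.
by move: (y ^+ (n - k)) (y ^+ k) (q`_(n - k)) => a b r a0; field.
Qed.

Lemma coprimep_closed p q : (forall y, ~ (p.[y] = 0 /\ q.[y] = 0)) -> coprimep p q.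
Proof.
move=> h; apply/negPn/negP => /closed_rootP[y].
by rewrite root_gcd => /andP[/rootP a /rootP b]; apply: (h y).
Qed.

Definition wron p q := q * p^`() - p * q^`().

Lemma deriv_wron p q : (wron p q)^`() = q * p^`()^`() - p * q^`()^`().
Proof.
rewrite /wron derivB !derivM.
by move: (p^`()^`()) (q^`()^`()) (p^`()) (q^`()) => a b c e; ring.
Qed.

Lemma deriv2_small n p : (forall k, (0 < k <= n)%N -> k%:R != 0 :> K) -> (size p <= n.+1)%N ->
  p^`()^`() = 0 -> (1 < n)%N -> p`_n = 0.
Proof.
case: n => [|[|n]] // hn sp p0 _; have := congr1 (fun p : {poly K} => p`_n) p0.
rewrite !coef_deriv coef0 => /eqP; rewrite -mulr_natr mulf_eq0 (negbTE (hn _ _)) ?orbF; last by lia.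
by rewrite -mulr_natr mulf_eq0 (negbTE (hn _ _)) ?orbF; [move/eqP|lia].
Qed.

(** A map of the projective line of degree [n > 1] cannot be unramified at all finite points. If the
    Wronskian is a nonzero constant, its derivative gives [q * p'' = p * q'']; coprimality and
    degrees force both second derivatives to vanish, hence both top coefficients. *)
Lemma wron_root n p q : (forall k, (0 < k <= n)%N -> k%:R != 0 :> K) -> (1 < n)%N ->
  (size p <= n.+1)%N -> (size q <= n.+1)%N -> (forall y, ~ (p.[y] = 0 /\ q.[y] = 0)) ->
  ~ (p`_n = 0 /\ q`_n = 0) -> exists y, (wron p q).[y] = 0.
Proof.
move=> hn n1 sp sq hpq hn'; apply: NNPP => nr.
have s1 : size (wron p q) == 1%N.
  by apply: contraT => /closed_rootP[y /rootP y0]; case: nr; exists y.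
have : (wron p q)^`() = 0 by have /size_poly1P[c _ ->] := s1; rewrite derivC.
rewrite deriv_wron => /eqP; rewrite subr_eq0 => /eqP e.
have cpq : coprimep p q by apply: coprimep_closed.
have key (a b : {poly K}) : coprimep a b -> a %| b * a^`()^`() -> a^`()^`() = 0.
  move=> cab; rewrite Gauss_dvdpr // => ab; apply/eqP/negPn/negP => a0.
  have := dvdp_leq a0 ab; rewrite leqNgt => /negP; apply.
  have a1 : a^`() != 0 by apply: contraNneq a0 => ->; rewrite deriv0.
  have a2 : a != 0 by apply: contraNneq a1 => ->; rewrite deriv0.
  exact: (ltn_trans (lt_size_deriv a1) (lt_size_deriv a2)).
apply: hn'; split; apply: deriv2_small => //.
  by apply: (key p q) => //; rewrite e dvdp_mulr.
by apply: (key q p); rewrite 1?coprimep_sym // -e dvdp_mulr.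
Qed.

(** This is [2 * h * w ^ 2] times the Schwarzian derivative of [g / h]. *)
Definition schwarz g h := let w := wron g h in
  2%:R * w * (h * (h * g^`()^`()^`() - g * h^`()^`()^`()) - 3%:R * h^`()^`() * w)
  - 3%:R * w^`() * (h * w^`() - 2%:R * h^`() * w).

Lemma schwarzE g h : let w := wron g h in
  schwarz g h = h * (2%:R * w * w^`()^`() - 3%:R * w^`() ^+ 2) + 4%:R * h^`() * w * w^`()
    - 4%:R * h^`()^`() * w ^+ 2.
Proof.
rewrite /schwarz /= deriv_wron derivB !derivM /wron.
by move: (g^`()^`()^`()) (h^`()^`()^`()) (g^`()^`()) (h^`()^`()) (g^`()) (h^`()) => *; ring.
Qed.

(* The Schwarzian derivative of g/h has a double pole at a ramification point. *)
Lemma schwarz_neq0 k g h : (forall i, (0 < i <= k.+3)%N -> i%:R != 0 :> K) ->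
  g.[0] != 0 -> h.[0] != 0 -> schwarz ('X^(k.+2) * g) h != 0.
Proof.
move=> hk g0 h0; set w := wron ('X^(k.+2) * g) h.
pose v := h * (k.+2%:R * g + 'X * g^`()) - 'X * g * h^`().
pose u := k.+1%:R * v + 'X * v^`().
have dX n : ('X^(n.+1) : {poly K})^`() = n.+1%:R * 'X^n by rewrite derivXn mulr_natl.
have ew : w = 'X^(k.+1) * v.
  rewrite /w /wron derivM dX /v.
  by rewrite (exprS 'X k.+1); move: 'X^(k.+1) (g^`()) (h^`()) => *; ring.
have ew1 : w^`() = 'X^k * u.
  rewrite ew derivM dX /u (exprS 'X k).
  by move: 'X^k (v^`()) => *; ring.
have ew2 : 'X * w^`()^`() = 'X^k * (k%:R * u + 'X * u^`()).
  rewrite ew1 derivM; case: (k) => [|m]; first by rewrite derivXn /=; move: (u^`()) => *; ring.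
  by rewrite dX (exprS 'X m); move: 'X^m (u^`()) => *; ring.
pose Z := h * (2%:R * v * (k%:R * u + 'X * u^`()) - 3%:R * u ^+ 2) + 4%:R * h^`() * 'X * v * u
    - 4%:R * h^`()^`() * 'X ^+ 2 * v ^+ 2.
have eW : schwarz ('X^(k.+2) * g) h = 'X^k ^+ 2 * Z.
  rewrite schwarzE -/w.
  have -> : 2%:R * w * w^`()^`() = 2%:R * 'X^k * v * ('X * w^`()^`()).
    by rewrite ew (exprS 'X k); move: ('X^k) (w^`()^`()) => *; ring.
  rewrite ew2 ew1 ew /Z (exprS 'X k); move: ('X^k) (u^`()) (h^`()) (h^`()^`()) => *; ring.
rewrite eW mulf_neq0 ?expf_neq0 ?polyX_eq0 //.
have nat n : (n%:R : {poly K}).[0] = n%:R by rewrite -polyC_natr hornerC.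
have v0 : v.[0] = h.[0] * k.+2%:R * g.[0].
  by rewrite /v hornerD hornerN !hornerM hornerD !hornerM nat hornerX; ring.
have u0 : u.[0] = k.+1%:R * v.[0] by rewrite /u hornerD !hornerM nat hornerX mul0r addr0.
apply/negP => /eqP/(congr1 (horner^~ 0)); rewrite horner0 => /= Z0.
(* With [u(0) = (k + 1) v(0)], the value at [0] is [h v ^ 2 (k + 1) (2 k - 3 (k + 1))], that is,
   minus the displayed product. *)
have : h.[0] * v.[0] ^+ 2 * k.+1%:R * k.+3%:R = 0.
  transitivity (- Z.[0]); last by rewrite Z0 oppr0.
  rewrite /Z; clear Z eW Z0; clearbody u; clear ew ew1 ew2 v0; clearbody v.
  rewrite !(nat, hornerD, hornerN, hornerM, horner_exp, hornerX) u0; move: (v.[0]) (h.[0]) (u^`().[0]) => *; ring.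
by move/eqP; rewrite v0 !mulf_eq0 (negbTE h0) (negbTE g0) /= !(negbTE (hk _ _)) //; lia.
Qed.

End Poly.

(** * Degree and zeros of the form [Q] on a line *)

Section DegreeBounds.
Variable R : idomainType.
Implicit Types p q r s a b c e : {poly R}.

Definition dle n p := (size p <= n.+1)%N.

Lemma dleD n p q : dle n p -> dle n q -> dle n (p + q).
Proof. by move=> hp hq; apply: leq_trans (size_polyD _ _) _; rewrite geq_max; apply/andP. Qed.

Lemma dleN n p : dle n p -> dle n (- p).
Proof. by rewrite /dle size_polyN. Qed.

Lemma dleM m n k p q : dle m p -> dle n q -> (m + n)%N = k -> dle k (p * q).
Proof. by move=> hp hq <-; apply: size_mul_le. Qed.

Lemma dle_nat m n p : dle n p -> dle n (m%:R * p).
Proof.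
move=> hp; apply: (dleM (m := 0)) hp _ => //.
by rewrite /dle -polyC_natr size_polyC_leq1.
Qed.

Lemma dleX m n p : dle n p -> dle (n * m) (p ^+ m).
Proof.
move=> hp; elim: m => [|m IH]; first by rewrite muln0 expr0 /dle size_poly1.
by rewrite exprS; apply: (dleM hp IH); rewrite mulnS.
Qed.

Lemma dle_quad2 m n k r s a b c : dle m r -> dle m s -> dle n a -> dle n b -> dle n c ->
  (m * 2 + n)%N = k -> dle k (quad2 r s a b c).
Proof.
move=> hr hs ha hb hc e; apply: dleD; first apply: dleD; try apply: dleN.
- exact: (dleM (dleX 2 hr) ha).
- apply: (dleM (m := (m * 2)%N) _ hb) => //; apply: (dleM (dle_nat 2 hr) hs); lia.
- exact: (dleM (dleX 2 hs) hc).
Qed.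

Lemma dle_cub3 m n k r s a b c e : dle m r -> dle m s -> dle n a -> dle n b -> dle n c -> dle n e ->
  (m * 3 + n)%N = k -> dle k (cub3 r s a b c e).
Proof.
move=> hr hs ha hb hc he <-; apply: dleD; first apply: dleD; first apply: dleD; try apply: dleN.
- exact: (dleM (dleX 3 hr) ha).
- apply: (dleM (m := (m * 3)%N) _ hb) => //.
  apply: (dleM (dle_nat 3 (dleX 2 hr)) hs); lia.
- apply: (dleM (m := (m * 3)%N) _ hc) => //.
  apply: (dleM (dle_nat 3 hr) (dleX 2 hs)); lia.
- exact: (dleM (dleX 3 hs) he).
Qed.

Lemma dle_quad_q i j k l m n B C a1 a2 a3 : dle i B -> dle j C -> dle k a1 -> dle l a2 -> dle m a3 ->
  (j * 2 + k)%N = n -> (i + j + l)%N = n -> (i * 2 + m)%N = n -> dle n (quad_q B C a1 a2 a3).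
Proof.
move=> hB hC h1 h2 h3 e1 e2 e3; apply: dleD; first apply: dleD; try apply: dleN.
- exact: (dleM (dle_nat 3 (dleX 2 hC)) h1).
- exact: (dleM (dleM (dle_nat 6 hB) hC (erefl _)) h2).
- exact: (dleM (dle_nat 4 (dleX 2 hB)) h3).
Qed.

Lemma dle_wedge m n k p q r s : dle m p -> dle n q -> dle m r -> dle n s -> (m + n)%N = k ->
  dle k (p * q - r * s).
Proof. by move=> *; apply: dleD; [|apply: dleN]; apply: dleM; eassumption. Qed.

End DegreeBounds.

Section QuadDegree.
Variable K : closedFieldType.
Implicit Types f p q : {mpoly K[4]}.

Lemma Euler_Lp e p : p \is e.-homog -> Lp p;;o0 + 'X * Lp p;;o1 = e%:R * Lp p.
Proof.
move=> hp; have := mev_Euler polyC (pline (delta_mx 0 o0) (delta_mx 0 o1)) hp.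
rewrite sum_ord4 -/(Lp _) !mxE /= !(mulr0, mulr1, addr0, add0r, mul0r, mul1r).
by rewrite ?(mulr0, mulr1, addr0, add0r, mul0r, mul1r) => <-.
Qed.

Variables (f : {mpoly K[4]}) (d : nat).
Hypothesis hf : f \is d.-homog.
Hypothesis d3 : (3 <= d)%N.

Let g2 := Lp f;;o2.
Let g3 := Lp f;;o3.
Let v1 := g3 * Lp f;;o2;;o0 - g2 * Lp f;;o3;;o0.
Let v2 := g3 * Lp f;;o2;;o0;;o0 - g2 * Lp f;;o3;;o0;;o0.
Let c0bb := quad2 g3 g2 (Lp f;;o2;;o2;;o0) (Lp f;;o2;;o3;;o0) (Lp f;;o3;;o3;;o0).

(** Euler's relation replaces derivatives along [e1] by derivatives along [e0]. The right side is
    visibly of degree at most [8 d - 12], so the factor ['X ^+ 2] brings [Qp] down to [8 d - 14]. *)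
Lemma Qp_shift : 'X ^+ 2 * Qp f = quad_q v1 (ubb f) v2 c0bb (cbbb f).
Proof.
have h1 i : f;;i \is d.-1.-homog by apply: mderiv_homog.
have h2 i j : f;;i;;j \is d.-2.-homog by apply: mderiv_homog.
have e1 i : Lp f;;i;;o0 = d.-1%:R * Lp f;;i - 'X * (Lp f;;i)^`().
  by rewrite -(Euler_Lp (h1 i)) deriv_Lp addrK.
have e2 i j : Lp f;;i;;j;;o0 = d.-2%:R * Lp f;;i;;j - 'X * (Lp f;;i;;j)^`().
  by rewrite -(Euler_Lp (h2 i j)) deriv_Lp addrK.
have e3 i : Lp f;;i;;o0;;o0 = d.-2%:R * (d.-1%:R * Lp f;;i - 'X * (Lp f;;i)^`())
   - 'X * (d.-1%:R * (Lp f;;i)^`() - ((Lp f;;i)^`() + 'X * (Lp f;;i)^`()^`())).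
  rewrite e2 e1; congr (_ - 'X * _).
  by rewrite derivB !derivM derivX -polyC_natr derivC mul0r add0r mul1r.
have ev1 : v1 = - ('X * w1 f).
  by rewrite /v1 !e1 /w1 -/g2 -/g3; move: (g2^`()) (g3^`()) => a b; ring.
have ev2 : v2 = 'X ^+ 2 * w2 f - 2%:R * d.-2%:R * 'X * w1 f.
  have ed : d.-1%:R = d.-2%:R + 1 :> {poly K} by rewrite natr1; congr (_%:R); lia.
  rewrite /v2 !e3 /w1 /w2 -/g2 -/g3 ed.
  by move: (g2^`()^`()) (g3^`()^`()) (g2^`()) (g3^`()) => *; ring.
have ec : c0bb = d.-2%:R * ubb f - 'X * c1bb f.
  rewrite /c0bb !e2 /ubb /c1bb -/g2 -/g3 !deriv_Lp.
  have c21 (p : {mpoly K[4]}) : p;;o2;;o1 = p;;o1;;o2 by apply: mderiv_comm.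
  have c31 (p : {mpoly K[4]}) : p;;o3;;o1 = p;;o1;;o3 by apply: mderiv_comm.
  rewrite !(c21, c31) /quad2.
  move: (Lp f;;o1;;o2;;o2) (Lp f;;o1;;o2;;o3) (Lp f;;o1;;o3;;o3).
  move: (Lp f;;o2;;o2) (Lp f;;o2;;o3) (Lp f;;o3;;o3) => *; ring.
rewrite ev1 ev2 ec /Qp /quad_q; move: (w1 f) (w2 f) (ubb f) (c1bb f) (cbbb f) => *; ring.
Qed.

Lemma size_Qp : (size (Qp f) <= 8 * d - 13)%N.
Proof.
have h1 i : f;;i \is d.-1.-homog by apply: mderiv_homog.
have h2 i j : f;;i;;j \is d.-2.-homog by apply: mderiv_homog.
have h3 i j k : f;;i;;j;;k \is d.-2.-1.-homog by apply: mderiv_homog.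
have s1 i := size_Lp (h1 i); have s2 i j := size_Lp (h2 i j); have s3 i j k := size_Lp (h3 i j k).
have : dle (8 * d - 12) ('X ^+ 2 * Qp f).
  rewrite Qp_shift; apply: (dle_quad_q (i := (2 * d - 3)%N) (j := (3 * d - 4)%N)
    (k := (2 * d - 4)%N) (l := (3 * d - 5)%N) (m := (4 * d - 6)%N)); try lia.
  - by apply: (dle_wedge (m := d.-1) (n := d.-2)) ; try first [exact: s1 | exact: s2 | exact: s3]; lia.
  - by apply: (dle_quad2 (m := d.-1) (n := d.-2)) ; try first [exact: s1 | exact: s2 | exact: s3]; lia.
  - by apply: (dle_wedge (m := d.-1) (n := d.-2.-1)) ; try first [exact: s1 | exact: s2 | exact: s3]; lia.
  - by apply: (dle_quad2 (m := d.-1) (n := d.-2.-1)) ; try first [exact: s1 | exact: s2 | exact: s3]; lia.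
  - by apply: (dle_cub3 (m := d.-1) (n := d.-2.-1)) ; try first [exact: s1 | exact: s2 | exact: s3]; lia.
rewrite /dle; have [->|Q0] := eqVneq (Qp f) 0; first by rewrite size_poly0.
by rewrite mulrC size_mulXn //; move: (size _) => z; lia.
Qed.

End QuadDegree.

Lemma small_roots_eq0 (F : fieldType) (p : {poly F}) (rs : seq F) :
  (size p <= size rs)%N -> uniq rs -> (forall a, a \in rs -> p.[a] = 0) -> p = 0.
Proof.
move=> sp u h; apply/eqP; apply: contraTT sp => p0; rewrite -ltnNge.
by apply: max_poly_roots u => //; apply/allP => a /h pa; apply/rootP.
Qed.

Lemma coef_vanish_dvd (R : comNzRingType) n (p : {poly R}) :
  (forall l, (l < n)%N -> p`_l = 0) -> exists q, p = 'X^n * q.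
Proof.
move=> h; exists (drop_poly n p); rewrite -{1}[p](poly_take_drop n) mulrC.
suff -> : take_poly n p = 0 by rewrite add0r mulrC.
by apply/polyP => l; rewrite coef_take_poly coef0; case: ifP => // /h.
Qed.

Lemma horner2_expand (R : comNzRingType) (G : {poly {poly R}}) N (t u : R) : (size G <= N)%N ->
  G.[t%:P].[u] = \sum_(i < N) t ^+ i * (G`_i).[u].
Proof.
move=> sG; rewrite (horner_coef_wide _ sG) horner_sum; apply: eq_bigr => i _.
by rewrite hornerM horner_exp hornerC mulrC.
Qed.

Lemma quad_q_morph (R S : comNzRingType) (g : {rmorphism R -> S}) (B C a b c : R) :
  g (quad_q B C a b c) = quad_q (g B) (g C) (g a) (g b) (g c).
Proof. by rewrite /quad_q; ring. Qed.

Section Order.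
Variable K : closedFieldType.
Implicit Types p : {mpoly K[4]}.

Definition prow : 'rV[{poly {poly K}}]_4 := \row_i nth 0 [:: 1; 'X%:P; 'X; 0] i.

(* f (e0 + eta e1 + s e2), with s the outer and eta the inner variable. *)
Definition Gp p : {poly {poly K}} := mev (@polyCC K) prow p.

Lemma deriv_Gp p : (Gp p)^`() = Gp p;;o2.
Proof.
rewrite /Gp (@mev_derivation _ _ _ _ _ (@deriv {poly K})) => [|a b|a b|c].
- rewrite sum_ord4 !mxE /= derivC derivX !derivC !mul0r mul1r !add0r addr0 //.
- exact: derivD.
- exact: derivM.
- by rewrite /polyCC derivC.
Qed.

Lemma coef0_Gp p : (Gp p)`_0 = Lp p.
Proof.
rewrite -horner_coef0 -/(horner_eval 0 _) /Gp.
rewrite (mev_morph (psi := polyC)) => [|c]; last by rewrite /= /horner_eval /polyCC hornerC.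
rewrite /Lp; congr mev; apply/rowP => i; rewrite !mxE.
case: i => [[|[|[|[|]]]]] //= hi; rewrite /horner_eval ?hornerC ?hornerX //;
  by rewrite ?(mulr0, mulr1, addr0, add0r).
Qed.

Lemma horner_Gp p (a t : K) :
  (Gp p).[t%:P].[a * t] = ev (delta_mx 0 o0 + t *: (a *: delta_mx 0 o1 + delta_mx 0 o2)) p.
Proof.
rewrite -/(horner_eval t%:P _) -/(horner_eval (a * t) _) /Gp.
rewrite -[LHS]/((horner_eval (a * t) \o horner_eval t%:P) _).
rewrite (mev_morph (psi := idfun)) => [|c]; last by rewrite /= /horner_eval /polyCC !hornerC.
congr mev; apply/rowP => i; rewrite !mxE.
case: i => [[|[|[|[|]]]]] //= hi; rewrite /horner_eval ?hornerC ?hornerX ?hornerC //;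
  rewrite ?(mulr0, mulr1, addr0, add0r) // mulrC //.
Qed.

Variable f : {mpoly K[4]}.
Hypothesis fL : Lp f = 0.
Variable rs : seq K.
Hypothesis urs : uniq rs.
Hypothesis hrs : forall a t, a \in rs ->
  ev (delta_mx 0 o0 + t *: (a *: delta_mx 0 o1 + delta_mx 0 o2)) f = 0.

Let G := Gp f.

Lemma coef_Gp_sum k a : a \in rs -> \sum_(i < k.+1) G`_i`_(k - i) * a ^+ (k - i) = 0.
Proof.
move=> ha; pose N := (k.+1 + size G)%N.
pose T : {poly K} := \sum_(i < N) 'X^i * (G`_i \Po (a *: 'X)).
have T0 : T = 0.
  apply: natr_tail_eq => t; rewrite -(hrs t ha) -horner_Gp -/G.
  rewrite (horner2_expand _ _ (leq_addl k.+1 (size G))) /T horner_sum.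
  by apply: eq_bigr => i _; rewrite hornerM horner_comp hornerZ hornerX hornerXn.
have := congr1 (fun p : {poly K} => p`_k) T0; rewrite coef0 /T coef_sum => e; rewrite -[RHS]e.
rewrite (big_ord_widen N (fun i => G`_i`_(k - i) * a ^+ (k - i))) ?leq_addr // [RHS]big_mkcond /=.
rewrite big_mkcond; apply: eq_bigr => i _; rewrite coefXnM ltnS; case: leqP => [ik|//].
have -> : G`_i \Po (a *: 'X) = \poly_(l < size G`_i) (G`_i`_l * a ^+ l).
  rewrite comp_polyE poly_def; apply: eq_bigr => l _.
  by rewrite exprZn scalerA.
by rewrite coef_poly; case: ltnP => // h; rewrite nth_default // mul0r.
Qed.

(** The part of degree [k = i + l] at [e0] of the section by the plane [e0 e1 e2] gives a polynomial
    in the slope [a] of degree below [k], since the section contains the line; all slopes in [rs]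
    are roots. *)
Lemma Gp_vanish i l : (i + l <= size rs)%N -> G`_i`_l = 0.
Proof.
move=> h; pose k := (i + l)%N.
have G0 : G`_0 = 0 by rewrite coef0_Gp.
case: i h @k => [|i] h k; first by rewrite G0 coef0.
pose P := \poly_(l < k) G`_(k - l)`_l.
have P0 : P = 0.
  apply: (small_roots_eq0 (rs := rs)) => //; first exact: leq_trans (size_poly _ _) h.
  move=> a ha; have := coef_Gp_sum k ha; rewrite (reindex_inj rev_ord_inj) /= big_ord_recr /=.
  rewrite subSS subnn G0 coef0 mul0r addr0 => e.
  rewrite /P horner_poly -[RHS]e; apply: eq_bigr => m _.
  by rewrite subSS subKn // ltnW.
have := congr1 (fun p : {poly K} => p`_l) P0.
by rewrite coef_poly coef0 /k addSn ltnS leq_addl -addSn addnK.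
Qed.

Lemma Lp_Gp1 : Lp f;;o2 = G`_1.
Proof. by rewrite -coef0_Gp -deriv_Gp coef_deriv. Qed.
Lemma Lp_Gp2 : Lp f;;o2;;o2 = 2%:R * G`_2.
Proof. by rewrite -coef0_Gp -!deriv_Gp !coef_deriv mulr_natl mulr1n. Qed.
Lemma Lp_Gp3 : Lp f;;o2;;o2;;o2 = 6%:R * G`_3.
Proof. by rewrite -coef0_Gp -!deriv_Gp !coef_deriv mulr1n -mulrnA mulr_natl. Qed.

(** The first, second and third [e2]-derivatives vanish to orders [k + 2], [k + 1] and [k] at the
    point, and each term of [Qp] collects enough powers of ['X] from them. *)
Lemma Qp_order2 k : size rs = k.+2 -> exists q, Qp f = 'X^(k.+2) * q.
Proof.
move=> sr.
have [a ea] : exists q, Lp f;;o2 = 'X^(k.+2) * q.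
  by apply: coef_vanish_dvd => l hl; rewrite Lp_Gp1 Gp_vanish // sr; lia.
have [b eb] : exists q, Lp f;;o2;;o2 = 'X^(k.+1) * q.
  by apply: coef_vanish_dvd => l hl; rewrite Lp_Gp2 mulr_natl coefMn Gp_vanish ?mul0rn // sr; lia.
have [c ec] : exists q, Lp f;;o2;;o2;;o2 = 'X^k * q.
  by apply: coef_vanish_dvd => l hl; rewrite Lp_Gp3 mulr_natl coefMn Gp_vanish ?mul0rn // sr; lia.
have dX n (q : {poly K}) : exists q', ('X^(n.+1) * q)^`() = 'X^n * q'.
  exists (n.+1%:R * q + 'X * q^`()); rewrite derivM derivXn -mulr_natl exprS /=.
  by move: 'X^n (q^`()) => *; ring.
have [a1 ea1] := dX k.+1 a; have [a2 ea2] := dX k a1; have [b1 eb1] := dX k b.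
have c12 : f;;o1;;o2 = f;;o2;;o1 by apply: mderiv_comm.
have c122 : Lp f;;o1;;o2;;o2 = 'X^k * b1 by rewrite c12 mderiv1C eb.
exists ('X^k ^+ 2 * quad_q (Lp f;;o3 * a1 - 'X * a * (Lp f;;o3)^`())
   (Lp f;;o3 ^+ 2 * b - 2%:R * Lp f;;o3 * ('X * a) * Lp f;;o2;;o3 + 'X^k * 'X^3 * a ^+ 2 * Lp f;;o3;;o3)
   (Lp f;;o3 * a2 - 'X^2 * a * (Lp f;;o3)^`()^`())
   (Lp f;;o3 ^+ 2 * b1 - 2%:R * Lp f;;o3 * ('X^2 * a) * Lp f;;o1;;o2;;o3 + 'X^k * 'X^4 * a ^+ 2 * Lp f;;o1;;o3;;o3)
   (Lp f;;o3 ^+ 3 * c - 3%:R * Lp f;;o3 ^+ 2 * ('X^2 * a) * Lp f;;o2;;o2;;o3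
     + 3%:R * Lp f;;o3 * ('X^2 * a) * ('X^(k.+2) * a) * Lp f;;o2;;o3;;o3
     - 'X^2 * a * ('X^(k.+2) * a) ^+ 2 * Lp f;;o3;;o3;;o3)).
rewrite /Qp /w1 /w2 /ubb /c1bb /cbbb c122 ec eb ea ea1 ea2 /quad_q /quad2 /cub3.
rewrite (exprS 'X k.+1) (exprS 'X k).
move: 'X^k (Lp f;;o3) ((Lp f;;o3)^`()) ((Lp f;;o3)^`()^`()) => *.
move: (Lp f;;o2;;o3) (Lp f;;o3;;o3) (Lp f;;o1;;o2;;o3) (Lp f;;o1;;o3;;o3) => *.
move: (Lp f;;o2;;o2;;o3) (Lp f;;o2;;o3;;o3) (Lp f;;o3;;o3;;o3) => *; ring.
Qed.

(** Orders of vanishing alone do not suffice for one line. Its direction is a common zero of the two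
    residual forms whose resultant is [Qp]: the relations [e2] and [e3] express this and make the
    terms cancel. *)
Lemma Qp_order1 : size rs = 1%N -> exists q, Qp f = 'X * q.
Proof.
move=> sr; have /hasP[a ha _] : has predT rs by rewrite has_predT sr.
have G0 : G`_0 = 0 by rewrite coef0_Gp.
have G10 : G`_1`_0 = 0 by apply: Gp_vanish; rewrite sr.
have e2 : G`_2`_0 = - (G`_1`_1 * a).
  have := coef_Gp_sum 2 ha; rewrite !big_ord_recl big_ord0 /= /bump /= G0 coef0 !mul0r addr0 add0r.
  by rewrite expr1 expr0 mulr1 addrC => /eqP; rewrite addr_eq0 => /eqP.
have e3 : G`_3`_0 = - (G`_2`_1 * a + G`_1`_2 * a ^+ 2).
  have := coef_Gp_sum 3 ha; rewrite !big_ord_recl big_ord0 /= /bump /= G0 coef0 !mul0r addr0 add0r.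
  rewrite expr1 expr0 mulr1 addrA [X in X + _]addrC addrC => /eqP; rewrite addr_eq0 => /eqP.
  by [].
suff Q0 : (Qp f).[0] = 0.
  have [q e] : exists q, Qp f = 'X^1 * q by apply: coef_vanish_dvd => -[|//] _; rewrite -horner_coef0.
  by exists q; rewrite e expr1.
have c122 : Lp f;;o1;;o2;;o2 = (2%:R * G`_2)^`().
  have c12 : f;;o1;;o2 = f;;o2;;o1 by apply: mderiv_comm.
  by rewrite c12 mderiv1C -Lp_Gp2.
have nat n (p : {poly K}) : (n%:R * p)`_0 = n%:R * p`_0 by rewrite mulr_natl coefMn mulr_natl.
have g20 : (Lp f;;o2).[0] = 0 by rewrite Lp_Gp1 horner_coef0.
have g21 : (Lp f;;o2)^`().[0] = G`_1`_1 by rewrite Lp_Gp1 horner_coef0 coef_deriv.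
have g22 : (Lp f;;o2)^`()^`().[0] = 2%:R * G`_1`_2.
  by rewrite Lp_Gp1 horner_coef0 !coef_deriv mulr1n mulr_natl.
have f22 : (Lp f;;o2;;o2).[0] = 2%:R * G`_2`_0 by rewrite Lp_Gp2 horner_coef0 nat.
have f122 : (Lp f;;o1;;o2;;o2).[0] = 2%:R * G`_2`_1.
  by rewrite c122 horner_coef0 coef_deriv mulr1n !mulr_natl coefMn.
have f222 : (Lp f;;o2;;o2;;o2).[0] = 6%:R * G`_3`_0 by rewrite Lp_Gp3 horner_coef0 nat.
have q20 (r b c e : K) : quad2 r 0 b c e = r ^+ 2 * b by rewrite /quad2; ring.
have c30 (r b c e g : K) : cub3 r 0 b c e g = r ^+ 3 * b by rewrite /cub3; ring.
have v1 : (w1 f).[0] = (Lp f;;o3).[0] * G`_1`_1.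
  by rewrite /w1 hornerD hornerN !hornerM g20 g21 mul0r subr0.
have v2 : (w2 f).[0] = (Lp f;;o3).[0] * (2%:R * G`_1`_2).
  by rewrite /w2 hornerD hornerN !hornerM g20 g22 mul0r subr0.
have v3 : (ubb f).[0] = (Lp f;;o3).[0] ^+ 2 * (2%:R * G`_2`_0).
  by rewrite -[LHS]/(horner_eval 0 _) /ubb quad2_morph /= /horner_eval g20 q20 f22.
have v4 : (c1bb f).[0] = (Lp f;;o3).[0] ^+ 2 * (2%:R * G`_2`_1).
  by rewrite -[LHS]/(horner_eval 0 _) /c1bb quad2_morph /= /horner_eval g20 q20 f122.
have v5 : (cbbb f).[0] = (Lp f;;o3).[0] ^+ 3 * (6%:R * G`_3`_0).
  by rewrite -[LHS]/(horner_eval 0 _) /cbbb cub3_morph /= /horner_eval g20 c30 f222.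
have -> : (Qp f).[0] = quad_q (w1 f).[0] (ubb f).[0] (w2 f).[0] (c1bb f).[0] (cbbb f).[0].
  by rewrite -[LHS]/(horner_eval 0 _) /Qp quad_q_morph.
rewrite v1 v2 v3 v4 v5 e2 e3 /quad_q.
by move: (G`_1`_1) (G`_2`_1) (G`_1`_2) (Lp f;;o3).[0]; clear => *; ring.
Qed.

Lemma Qp_order : exists q, Qp f = 'X^(size rs) * q.
Proof.
case e : (size rs) => [|[|k]]; last exact: Qp_order2.
  by exists (Qp f); rewrite mul1r.
by rewrite expr1; apply: Qp_order1.
Qed.

End Order.

(** * A surface containing a line is not flecnodal *)

Definition polyMC (n : nat) (R : comNzRingType) (c : R) : {poly {mpoly R[n]}} := (c%:MP)%:P.

HB.instance Definition _ (n : nat) (R : comNzRingType) :=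
  GRing.RMorphism.copy (@polyMC n R) (polyC \o @mpolyC n R).

Lemma coef_linear (R : nzRingType) (a b : R) l :
  (a%:P + 'X * b%:P)`_l = match l with 0 => a | 1 => b | _ => 0 end.
Proof.
rewrite coefD coefXM !coefC; case: l => [|[|l]] /=; by rewrite ?(addr0, add0r).
Qed.

Section PolyFacts.
Variable K : closedFieldType.

(* On a ruled surface the two transversal derivatives of the equation along a ruling satisfy
   this relation; it forces both to have degree at most 1. *)
Lemma ruling_relation n (Gw Ge : {poly K}) (a b : K) : (1 < n)%N ->
  Gw + 'X * (a%:P * Gw + b%:P * Ge) = 0 -> (forall y, ~ (Gw.[y] = 0 /\ Ge.[y] = 0)) ->
  Gw`_n = 0 /\ Ge`_n = 0.
Proof.
move=> n1 e nr; have cop := coprimep_closed nr.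
have lin_neq0 : 1 + a%:P * 'X != 0.
  apply/negP => /eqP/(congr1 (horner^~ 0)); rewrite /= !hornerE ?(mulr0, addr0) => /eqP.
  by rewrite oner_eq0.
have small (p q : {poly K}) : q != 0 -> p %| q -> (size q <= 2)%N -> p`_n = 0.
  move=> q0 pq sq; rewrite nth_default //; apply: leq_trans n1.
  exact: leq_trans (dvdp_leq q0 pq) sq.
have s2 (c e' : K) : (size (c%:P + e'%:P * 'X)%R <= 2)%N.
  by rewrite addrC size_MXaddC; case: ifP => // _; rewrite ltnS size_polyC_leq1.
have eq : Gw * (1 + a%:P * 'X) = - (b%:P * 'X) * Ge.
  by apply/eqP; rewrite -subr_eq0 -e; apply/eqP; ring.
split; last first.
  apply: (small _ (1 + a%:P * 'X)) => //; last by rewrite -polyC1; apply: s2.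
  by rewrite -(Gauss_dvdpr _ (_ : coprimep Ge Gw)) ?eq ?dvdp_mulIr // coprimep_sym.
have [b0|b0] := eqVneq b 0.
  move: eq; rewrite b0 polyC0 mul0r oppr0 mul0r => /eqP; rewrite mulf_eq0 (negbTE lin_neq0) orbF.
  by move/eqP ->; rewrite coef0.
apply: (small _ (- (b%:P * 'X))).
- by rewrite oppr_eq0 mulf_eq0 polyC_eq0 (negbTE b0) polyX_eq0.
- by rewrite -(Gauss_dvdpl _ cop) -eq dvdp_mulIl.
- by have := s2 0 b; rewrite polyC0 add0r size_polyN.
Qed.

(** The top coefficient is the value at the point at infinity of the parametrised line. *)
Lemma coef_pline_top n d (x v : 'rV[K]_n) (p : {mpoly K[n]}) :
  p \is d.-homog -> (mev polyC (pline x v) p)`_d = ev v p.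
Proof.
move=> hp; have := poly_rev (size_pline x v hp) _ (size_pline v x hp) (leqnn d).
rewrite subnn -[in RHS]horner_coef0 horner_mev horner_pline scale0r addr0 => -> // y y0.
rewrite !horner_mev !horner_pline -(mev_homog _ _ _ hp) /= scalerDr scalerA mulfV // scale1r addrC //.
Qed.

Lemma coef1_pline n (x v : 'rV[K]_n) (p : {mpoly K[n]}) :
  (mev polyC (pline x v) p)`_1 = ev x (dd v p).
Proof.
rewrite -[RHS](_ : (mev polyC (pline x v) (dd v p))`_0 = _).
  by rewrite -deriv_line coef_deriv.
by rewrite -horner_coef0 horner_mev horner_pline scale0r addr0.
Qed.

Lemma coef0_pline n (x v : 'rV[K]_n) (p : {mpoly K[n]}) : (mev polyC (pline x v) p)`_0 = ev x p.
Proof. by rewrite -horner_coef0 horner_mev horner_pline scale0r addr0. Qed.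

End PolyFacts.

(** * Translation along a polynomial vector field *)

Section VectorField.
Variable K : closedFieldType.
Local Notation M := {mpoly K[4]}.
Variable V : 'rV[M]_4.

(** The point [x + t V(x)] with generic [x]. The coefficients of [flow p] are the Taylor
    coefficients of [p] in the direction [V(x)], as polynomials in [x], so they can be
    differentiated along the surface. *)
Definition vflow : 'rV[{poly M}]_4 := \row_i (('X_i)%:P + 'X * (V 0 i)%:P).
Definition flow (p : M) : {poly M} := mev (@polyMC 4 K) vflow p.

Lemma flow_ev x (p : M) : map_poly (ev x) (flow p) = mev polyC (pline x (map_mx (ev x) V)) p.
Proof.
rewrite /flow -[LHS]/((map_poly (ev x)) _).
rewrite (mev_morph (psi := polyC)) => [|c]; last by rewrite /= /polyMC map_polyC /= mevC.
congr mev; apply/rowP => i; rewrite !mxE rmorphD rmorphM /= map_polyX !map_polyC /= mevX.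
by [].
Qed.

Lemma coef_flow x (p : M) k : ev x (flow p)`_k = (mev polyC (pline x (map_mx (ev x) V)) p)`_k.
Proof. by rewrite -flow_ev coef_map. Qed.

Variables (x w : 'rV[K]_4).

Lemma flow_deriv (p : M) k : ev x (dd w (flow p)`_k) =
  (\sum_i ((w 0 i)%:P + 'X * (ev x (dd w (V 0 i)))%:P)
     * mev polyC (pline x (map_mx (ev x) V)) p;;i)`_k.
Proof.
have d0 : dd w (0 : M) = 0 by rewrite /dd big1 // => i _; rewrite mderiv0 scaler0.
pose D (q : {poly M}) := map_poly (dd w) q.
have cD q l : (D q)`_l = dd w q`_l by rewrite coef_map_id0.
have Dadd a b : D (a + b) = D a + D b by apply/polyP => l; rewrite !(coefD, cD) ddD.
have DM a b : D (a * b) = D a * b + a * D b.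
  apply/polyP => l; rewrite cD coefD !coefM -big_split /=.
  rewrite -[dd w _](_ : \sum_(i < l.+1) dd w (a`_i * b`_(l - i)) = _).
    by apply: eq_bigr => i _; rewrite ddM !cD.
  by elim/big_rec2: _ => [|i q r _ e]; rewrite ?d0 // ddD e.
have dC c : dd w (c%:MP : M) = 0 by rewrite /dd big1 // => i _; rewrite mderivC scaler0.
have DC c : D (polyMC 4 c) = 0.
  by apply/polyP => l; rewrite cD [RHS]coef0 /polyMC coefC; case: ifP => _; [exact: dC|exact: d0].
have e : D (flow p) = \sum_i D (vflow 0 i) * flow p;;i := mev_derivation vflow Dadd DM DC p.
rewrite -cD e !coef_sum rmorph_sum; apply: eq_bigr => i _.
have dX : ev x (dd w ('X_i : M)) = w 0 i.
  rewrite ev_dd (bigD1 i) //= big1 ?addr0 => [|j ji]; rewrite mderivX mnm1E.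
    rewrite eqxx scale1r.
    have -> : (U_(i) - U_(i) = 0)%MM by apply/mnmP => l; rewrite mnmBE subnn mnm0E.
    by rewrite mpolyX0 rmorph1 mulr1.
  by rewrite eq_sym (negbTE ji) scale0r rmorph0 mulr0.
have h : map_poly (ev x) (D (vflow 0 i)) = (w 0 i)%:P + 'X * (ev x (dd w (V 0 i)))%:P;
  last by rewrite -h -flow_ev -rmorphM coef_map.
apply/polyP => l; rewrite [in RHS]coef_linear coef_map /= cD.
have -> : (vflow 0 i)`_l = match l with 0 => 'X_i | 1 => V 0 i | _ => 0 end.
  by rewrite mxE; apply: coef_linear.
by case: l => [|[|l]] //=; rewrite d0 rmorph0.
Qed.
End VectorField.

#[local] Opaque flow.

Section Frames.
Variable K : closedFieldType.

Lemma frame_row (v0 v1 v2 v3 : 'rV[K]_4) (c : 'rV[K]_4) :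
  c *m frame v0 v1 v2 v3 = c 0 o0 *: v0 + c 0 o1 *: v1 + c 0 o2 *: v2 + c 0 o3 *: v3.
Proof. by rewrite mulmx_sum_row sum_ord4 !rowK. Qed.

Lemma frame_decomp (v0 v1 v2 v3 v : 'rV[K]_4) : frame v0 v1 v2 v3 \in unitmx ->
  exists c0 c1 c2 c3, v = c0 *: v0 + c1 *: v1 + c2 *: v2 + c3 *: v3.
Proof.
move=> U; pose c := v *m invmx (frame v0 v1 v2 v3).
by exists (c 0 o0), (c 0 o1), (c 0 o2), (c 0 o3); rewrite -frame_row mulmxKV.
Qed.

Lemma frame_indep (v0 v1 v2 v3 : 'rV[K]_4) (c0 c1 c2 c3 : K) : frame v0 v1 v2 v3 \in unitmx ->
  c0 *: v0 + c1 *: v1 + c2 *: v2 + c3 *: v3 = 0 -> [/\ c0 = 0, c1 = 0, c2 = 0 & c3 = 0].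
Proof.
move=> U e; pose c : 'rV[K]_4 := \row_i nth 0 [:: c0; c1; c2; c3] i.
have : c *m frame v0 v1 v2 v3 = 0 by rewrite frame_row !mxE.
move/(congr1 (mulmx^~ (invmx (frame v0 v1 v2 v3)))); rewrite /= mulmxK // mul0mx => /rowP h.
by split; [have := h o0|have := h o1|have := h o2|have := h o3]; rewrite !mxE.
Qed.

Lemma smooth_frame (f : {mpoly K[4]}) (v0 v1 v2 v3 z : 'rV[K]_4) : smooth f ->
  frame v0 v1 v2 v3 \in unitmx -> z != 0 -> ev z f = 0 ->
  ev z (dd v0 f) = 0 -> ev z (dd v1 f) = 0 -> ev z (dd v2 f) = 0 -> ev z (dd v3 f) = 0 -> False.
Proof.
move=> sf U z0 fz h0 h1 h2 h3; apply: (sf z z0); split=> // i.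
rewrite -dd_delta; have [c0 [c1 [c2 [c3 ->]]]] := frame_decomp (delta_mx 0 i) U.
by rewrite !(ddDl, ddZl) !rmorphD /= !mevZ h0 h1 h2 h3 !mulr0 !addr0.
Qed.

End Frames.

Section Ruled.
Variable K : closedFieldType.
Variables (f : {mpoly K[4]}) (d : nat) (V : 'rV[{mpoly K[4]}]_4) (Theta : {mpoly K[4]}).
Hypothesis gf : good d f.
Hypothesis fT : ~ divides f Theta.
Let vx x := map_mx (ev x) V.

Hypothesis tangentV : forall x, ev x f = 0 -> ev x (dd (vx x) f) = 0.
Hypothesis straightV : forall x, ev x f = 0 -> ev x Theta != 0 ->
  exists l m, (\row_i ev x (dd (vx x) (V 0 i))) = l *: vx x + m *: x.

Lemma sum_pline x v (u : 'rV[K]_4) :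
  \sum_i (u 0 i)%:P * mev polyC (pline x v) f;;i = mev polyC (pline x v) (dd u f).
Proof. by rewrite /dd rmorph_sum; apply: eq_bigr => i _; rewrite /= mevZ. Qed.

Lemma Euler_pline x v : mev polyC (pline x v) (dd x f) =
  d%:R * mev polyC (pline x v) f - 'X * (mev polyC (pline x v) f)^`().
Proof.
have [hf _ _ _] := gf; rewrite deriv_line -(mev_Euler polyC (pline x v) hf) -!sum_pline.
rewrite mulr_sumr -sumrB; apply: eq_bigr => i _; rewrite !mxE.
by rewrite mulrDl mulrA addrK.
Qed.

Lemma divides_vanish g x : divides f g -> ev x f = 0 -> ev x g = 0.
Proof. by move=> [c ->] fx; rewrite rmorphM /= fx mul0r. Qed.

(** The tangent lines [x + t V(x)] lie in the surface. Differentiating coefficient [k + 1] along [V]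
    gives, by [straightV], [k + 2] times the next coefficient plus multiples of the two preceding
    ones; [k + 2] is invertible up to the degree. Points with [Theta = 0] are recovered because [f]
    is prime. *)
Lemma flow_vanish k x : ev x f = 0 -> ev x (flow V f)`_k = 0.
Proof.
suff : (forall x, ev x f = 0 -> ev x (flow V f)`_k = 0) /\
       (forall x, ev x f = 0 -> ev x (flow V f)`_k.+1 = 0) by move=> [h _]; apply: h.
elim: k {x} => [|k [h0 h1]].
  (* Coefficient 0 is [f] itself and coefficient 1 is its derivative along [V]. *)
  by split=> x fx; rewrite coef_flow ?coef0_pline ?coef1_pline //; apply: tangentV.
split=> //; suff : divides f (Theta * (flow V f)`_k.+2).
  have [[_ _ pf] _] := good_prime gf.
  by case/pf => // h x fx; apply: divides_vanish.
apply: (vanish_divides gf) => x fx; rewrite rmorphM /=.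
have [->|Tx] := eqVneq (ev x Theta) 0; first by rewrite mul0r.
suff -> : ev x (flow V f)`_k.+2 = 0 by rewrite mulr0.
have [l [m eV]] := straightV fx Tx.
have := tangent_vanish gf h1 fx (tangentV fx); rewrite flow_deriv -/(vx x).
have p0 := h0 x fx; have p1 := h1 x fx; rewrite coef_flow -/(vx x) in p0; rewrite coef_flow -/(vx x) in p1.
rewrite coef_flow -/(vx x).
have -> : \sum_i (((vx x) 0 i)%:P + 'X * (ev x (dd (vx x) (V 0 i)))%:P)
     * mev polyC (pline x (vx x)) f;;i = mev polyC (pline x (vx x)) (dd (vx x) f)
     + 'X * (l%:P * mev polyC (pline x (vx x)) (dd (vx x) f)
     + m%:P * mev polyC (pline x (vx x)) (dd x f)).
  rewrite -!sum_pline ![in RHS]mulr_sumr -big_split [in RHS]mulr_sumr -big_split /=.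
  apply: eq_bigr => i _.
  have -> : ev x (dd (vx x) (V 0 i)) = l * vx x 0 i + m * x 0 i.
    by have /rowP/(_ i) := eV; rewrite 2!mxE => ->; rewrite !mxE.
  by rewrite polyCD !polyCM; move: (mev _ _ _) => q; ring.
have [hf _ _ _] := gf; have sp := size_pline x (vx x) hf.
rewrite Euler_pline -deriv_line; set p := mev polyC _ f in p0 p1 sp *.
clearbody p; rewrite coefD coefXM /= coefD !coefCM !coef_deriv p1 mul0rn mulr0 add0r.
rewrite coefB mulr_natl coefMn p0 mul0rn add0r coefXM.
have -> : (if k == 0%N then 0 else p^`()`_k.-1) = 0.
  by case: (k) p0 => //= k' p0'; rewrite coef_deriv p0' mul0rn.
rewrite oppr0 mulr0 addr0 => /eqP; rewrite -mulr_natr mulf_eq0 => /orP[/eqP //|nz].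
apply: nth_default; apply: leq_trans sp _; rewrite ltnNge; apply/negP => kd.
by have := good_natr gf (k := k.+2) kd; rewrite nz.
Qed.

(** Differentiating the vanishing flow coefficients along a tangent vector [w] gives the relation of
    [ruling_relation] on a ruling. The two transversal derivatives then have no coefficient in
    degree [d - 1], so the surface is singular at the point [v] at infinity of the ruling. *)
Lemma no_ruling : (forall x, ev x f = 0 -> ev x Theta != 0 ->
  exists w e, frame x (vx x) w e \in unitmx /\ ev x (dd w f) = 0) -> False.
Proof.
move=> hw; have [x [fx Tx]] : exists x, ev x f = 0 /\ ev x Theta != 0.
  apply: NNPP => h; apply: fT; apply: (vanish_divides gf) => x fx.
  by apply/eqP/negPn/negP => Tx; apply: h; exists x.
have [w [e [U fw]]] := hw x fx Tx; have [hf sf d3 _] := gf.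
set v := vx x in U.
have p0 : mev polyC (pline x v) f = 0.
  by apply/polyP => k; rewrite -coef_flow flow_vanish // coef0.
have Gv : mev polyC (pline x v) (dd v f) = 0 by rewrite -deriv_line p0 deriv0.
have Gx : mev polyC (pline x v) (dd x f) = 0 by rewrite Euler_pline p0 deriv0 !mulr0 subr0.
pose om : 'rV[K]_4 := \row_i ev x (dd w (V 0 i)).
have [c0 [c1 [c2 [c3 eo]]]] := frame_decomp om U.
have rel : mev polyC (pline x v) (dd w f) + 'X * (c2%:P * mev polyC (pline x v) (dd w f)
   + c3%:P * mev polyC (pline x v) (dd e f)) = 0.
  transitivity (\sum_i ((w 0 i)%:P + 'X * (ev x (dd w (V 0 i)))%:P) * mev polyC (pline x v) f;;i).
    transitivity (mev polyC (pline x v) (dd w f) + 'X * mev polyC (pline x v) (dd om f)).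
      rewrite eo !ddDl !ddZl !rmorphD /= !mevZ Gv Gx !mulr0 !add0r //.
    rewrite -!sum_pline mulr_sumr -big_split /=; apply: eq_bigr => i _.
    by rewrite [om _ _]mxE mulrA -mulrDl.
  apply/polyP => k; rewrite -flow_deriv coef0.
  by apply: (tangent_vanish gf _ fx fw) => y fy; apply: flow_vanish.
have fl y : ev (x + y *: v) f = 0 by rewrite -horner_pline -horner_mev p0 horner0.
have ndep y : x + y *: v != 0.
  apply/negP => /eqP h; have [] := @frame_indep _ _ _ _ _ 1 y 0 0 U.
    by rewrite !scale0r !addr0 scale1r.
  by move=> /eqP; rewrite oner_eq0.
have key : (mev polyC (pline x v) (dd w f))`_d.-1 = 0 /\ (mev polyC (pline x v) (dd e f))`_d.-1 = 0.
  apply: ruling_relation rel _; first by lia.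
  move=> y [hw0 he0]; apply: (smooth_frame sf U (ndep y) (fl y));
    rewrite -horner_pline -horner_mev ?Gv ?Gx ?horner0 //.
have hd u := dd_homog u hf; move: key; rewrite !(coef_pline_top _ _ (hd _)) => -[vw ve].
have v0 : v != 0.
  apply/negP => /eqP h; have [] := @frame_indep _ _ _ _ _ 0 1 0 0 U.
    by rewrite !scale0r !addr0 scale1r h add0r.
  by move=> _ /eqP; rewrite oner_eq0.
apply: (smooth_frame sf U v0) => //.
- by rewrite -(coef_pline_top x v hf) p0 coef0.
- by rewrite -(coef_pline_top x v (hd x)) Gx coef0.
- by rewrite -(coef_pline_top x v (hd v)) Gv coef0.
Qed.

End Ruled.

#[local] Opaque flow.

(** * The flecnodal vector field *)

Section Remainder.
Variable R : comNzRingType.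
Implicit Types A B C a : R.

(* C^2 times the cubic is congruent to alpha^2 (r0 alpha + r1 beta) modulo the quadratic form. *)
Definition rem0 A B C a0 a2 a3 := C ^+ 2 * a0 + A * (2%:R * B * a3 - 3%:R * C * a2).
Definition rem1 A B C a1 a2 a3 :=
  3%:R * C ^+ 2 * a1 - 6%:R * B * C * a2 + (4%:R * B ^+ 2 - A * C) * a3.

(** [(r1, - r0)] is the zero of the linear factor of the remainder, so the quadratic form takes
    there the value of the resultant, up to a power of [C]. *)
Lemma rem_quadratic A B C a0 a1 a2 a3 (r0 := rem0 A B C a0 a2 a3) (r1 := rem1 A B C a1 a2 a3) :
  r1 ^+ 2 * A - 2%:R * r0 * r1 * B + r0 ^+ 2 * C = C ^+ 2 * binres A B C a0 a1 a2 a3.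
Proof. by rewrite /r0 /r1 /rem0 /rem1 /binres; ring. Qed.

Lemma rem_cubic A B C a0 a1 a2 a3 (r0 := rem0 A B C a0 a2 a3) (r1 := rem1 A B C a1 a2 a3) :
  C ^+ 2 * (r1 ^+ 3 * a0 - 3%:R * r1 ^+ 2 * r0 * a1 + 3%:R * r1 * r0 ^+ 2 * a2 - r0 ^+ 3 * a3) =
  ((3%:R * a2 * C - 2%:R * B * a3) * r1 - C * a3 * r0)
  * (r1 ^+ 2 * A - 2%:R * r0 * r1 * B + r0 ^+ 2 * C).
Proof.
have e0 : r0 = rem0 A B C a0 a2 a3 by [].
have e1 : r1 = rem1 A B C a1 a2 a3 by [].
clearbody r0 r1.
suff : r1 ^+ 2 * (rem0 A B C a0 a2 a3 * r1 - rem1 A B C a1 a2 a3 * r0) = 0.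
  move=> h; apply/eqP; rewrite -subr_eq0 -h /rem0 /rem1; apply/eqP; ring.
by rewrite -e0 -e1 [r1 * r0]mulrC subrr mulr0.
Qed.
End Remainder.

Lemma rem0_morph (R S : comNzRingType) (g : {rmorphism R -> S}) A B C a0 a2 a3 :
  g (rem0 A B C a0 a2 a3) = rem0 (g A) (g B) (g C) (g a0) (g a2) (g a3).
Proof. by rewrite /rem0; ring. Qed.
Lemma rem1_morph (R S : comNzRingType) (g : {rmorphism R -> S}) A B C a0 a2 a3 :
  g (rem1 A B C a0 a2 a3) = rem1 (g A) (g B) (g C) (g a0) (g a2) (g a3).
Proof. by rewrite /rem1; ring. Qed.

Lemma not_divides_mul (R : idomainType) (p a b : R) : prime_elt p ->
  ~ divides p a -> ~ divides p b -> ~ divides p (a * b).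
Proof. by move=> [_ _ h] na nb /h[]. Qed.

Lemma ev_dd4 (K : closedFieldType) (x v0 v1 v2 v3 : 'rV[K]_4) (c0 c1 c2 c3 : K) p :
  ev x (dd (c0 *: v0 + c1 *: v1 + c2 *: v2 + c3 *: v3) p) =
  c0 * ev x (dd v0 p) + c1 * ev x (dd v1 p) + c2 * ev x (dd v2 p) + c3 * ev x (dd v3 p).
Proof. by rewrite !ddDl !ddZl !rmorphD /= !mevZ. Qed.

Section FlecnodalField.
Variable K : closedFieldType.
Variables (f : {mpoly K[4]}) (d : nat).
Hypothesis gf : good d f.
Hypothesis fL : Lp f = 0.
Hypothesis g3n : Lp f;;o3 != 0.
Hypothesis w1n : w1 f != 0.
Hypothesis ubbn : ubb f != 0.
Hypothesis Wn : Wp f != 0.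
Hypothesis fF : divides f (flec f).

Definition r0 := rem0 (tA f) (tB f) (tC f) (t0 f) (t2 f) (t3 f).
Definition r1 := rem1 (tA f) (tB f) (tC f) (t1 f) (t2 f) (t3 f).
(* A polynomial vector field that is flecnodal wherever [flec f] vanishes on the surface. *)
Definition Vf : 'rV[{mpoly K[4]}]_4 :=
  \row_i nth 0 [:: 0; r1 * f;;o3; - (r0 * f;;o3); r0 * f;;o2 - r1 * f;;o1] i.

Lemma VfE x : map_mx (ev x) Vf = ev x r1 *: avec f x - ev x r0 *: bvec f x.
Proof.
apply/rowP => i; rewrite /avec /bvec !mxE.
case: i => [[|[|[|[|]]]]] //= hi; rewrite !(rmorph0, rmorphB, rmorphN, rmorphM) /=;
  by move: (ev x r0) (ev x r1) (ev x f;;o1) (ev x f;;o2) (ev x f;;o3) => *; ring.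
Qed.

Lemma not_divides_Lp g : Lp g != 0 -> ~ divides f g.
Proof. by move=> g0 [c e]; case/eqP: g0; rewrite e rmorphM /= fL mul0r. Qed.

Lemma d1_neq0 : d.-1%:R != 0 :> {poly K}.
Proof.
have [_ _ d3 _] := gf; rewrite -polyC_natr polyC_eq0; apply: (good_natr gf); lia.
Qed.

Lemma Qp_eq0 : Qp f = 0.
Proof.
have e := Omega_eq gf fL; move: e.
have -> : Omega f = 0 by apply: (Db_vanish gf fL) => x; apply: divides_vanish.
rewrite mulr0 => /esym/eqP; rewrite !(expf_eq0, mulf_eq0) /= (negbTE d1_neq0) (negbTE g3n) (negbTE Wn) /=.
by rewrite orbF => /eqP.
Qed.

(** [r0] vanishes on the line, so its transverse derivative is used: modulo [Qp], which is zero
    here, [2 * w1] times that derivative equals [ubb ^ 2 * f3 ^ 2 * Wp]. *)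
Lemma not_divides_r0 : ~ divides f r0.
Proof.
move=> h; have : Db f r0 = 0 by apply: (Db_vanish gf fL) => x; apply: divides_vanish.
have [lA lB lC [l0 l1 l2 l3]] := Lp_tensors fL.
rewrite /r0 /rem0 DbD DbM [Db f (tA f * _)]DbM lA l0 mulr0 add0r mul0r addr0 (Db_tA fL) (Db_t0 fL).
rewrite rmorphXn rmorphB !rmorphM !rmorph_nat /= lB lC l2 l3 => e.
have q := Qp_eq0; rewrite /Qp /quad_q in q.
have : ubb f ^+ 2 * Lp f;;o3 ^+ 2 * Wp f = 2%:R * w1 f * 0
    - Lp f;;o3 ^+ 2 * (Lp f;;o3 * w2 f - 2%:R * (Lp f;;o3)^`() * w1 f) * 0.
  rewrite -[X in _ * X - _]e -[X in _ - _ * X]q /Wp.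
  move: (ubb f) (w1 f) (w2 f) (w3 f) (c1bb f) (cbbb f) (Lp f;;o3) ((Lp f;;o3)^`()) ((Lp f;;o3)^`()^`()).
  by clear => *; ring.
rewrite !mulr0 subr0.
by move/eqP; rewrite !(expf_eq0, mulf_eq0) /= (negbTE ubbn) (negbTE g3n) (negbTE Wn).
Qed.

(** [flec_tensor] shows that [f] divides [binres] times a power of [(d - 1) f3]; [f] is prime and
    does not divide [f3]. *)
Lemma binres_vanish x : ev x f = 0 ->
  ev x (binres (tA f) (tB f) (tC f) (t0 f) (t1 f) (t2 f) (t3 f)) = 0.
Proof.
have [pf _] := good_prime gf; have [hf _ _ _] := gf; move=> fx.
apply: divides_vanish fx; set b := binres _ _ _ _ _ _ _.
have [_ _ pp] := pf.
have /pp[h|//] : divides f ((d.-1%:R * f;;o3) ^+ 6 * b).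
  apply: (vanish_divides gf) => y fy; have := flec_tensor hf fy.
  rewrite (divides_vanish fF fy) mulr0 -/b mulNr => /esym/eqP; rewrite oppr_eq0 => /eqP <-.
  by rewrite !(rmorph_nat, rmorphXn, rmorphM).
case: (@not_divides_Lp ((d.-1%:R * f;;o3) ^+ 6)) => //.
by rewrite rmorphXn rmorphM rmorph_nat expf_neq0 // mulf_neq0 // d1_neq0.
Qed.

(** Where this is nonzero, [x, avec, bvec, e3] is a frame, the quadratic form on the tangent plane
    is nondegenerate, the field [Vf] is independent of [avec], and [tC] can be cancelled in
    [rem_cubic]. *)
Definition Theta := 'X_o0 * f;;o3 * (tA f * tC f - tB f ^+ 2) * r0 * tC f.

Lemma not_divides_Theta : ~ divides f Theta.
Proof.
have [pf _] := good_prime gf; have [lA lB lC _] := Lp_tensors fL.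
have m a b := @not_divides_mul _ f a b pf.
apply: (m); first apply: (m); first apply: (m); first apply: (m).
- by apply: not_divides_Lp; rewrite Lp_X0 oner_eq0.
- exact: not_divides_Lp.
- apply: not_divides_Lp; rewrite rmorphB rmorphXn rmorphM /= lA lB mul0r sub0r oppr_eq0 expf_eq0 /=.
  by rewrite mulf_eq0 negb_or g3n w1n.
- exact: not_divides_r0.
- by apply: not_divides_Lp; rewrite lC.
Qed.

Lemma Vf_tensors x (v := map_mx (ev x) Vf) (s0 := ev x r0) (s1 := ev x r1) :
  [/\ ev x (dd v (dd (avec f x) f)) = s1 * ev x (tA f) - s0 * ev x (tB f),
      ev x (dd v (dd (bvec f x) f)) = s1 * ev x (tB f) - s0 * ev x (tC f),
      ev x (dd v (dd v f)) = s1 ^+ 2 * ev x (tA f) - 2%:R * s0 * s1 * ev x (tB f) + s0 ^+ 2 * ev x (tC f) &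
      ev x (dd v (dd v (dd v f))) = s1 ^+ 3 * ev x (t0 f) - 3%:R * s1 ^+ 2 * s0 * ev x (t1 f)
        + 3%:R * s1 * s0 ^+ 2 * ev x (t2 f) - s0 ^+ 3 * ev x (t3 f)].
Proof.
have [eA eB eC [e0 e1 e2 e3]] := tensor_eval f x.
set a := avec f x in eA eB eC e0 e1 e2 e3 *; set b := bvec f x in eA eB eC e0 e1 e2 e3 *.
have evv p : ev x (dd v p) = s1 * ev x (dd a p) - s0 * ev x (dd b p).
  by rewrite /v VfE -/s1 -/s0 ddDl ddZl -scaleNr ddZl rmorphD /= !mevZ mulNr.
clearbody a b v s0 s1.
have q2 p : ev x (dd v (dd v p)) = s1 ^+ 2 * ev x (dd a (dd a p))
    - 2%:R * s0 * s1 * ev x (dd a (dd b p)) + s0 ^+ 2 * ev x (dd b (dd b p)).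
  rewrite evv (dd_comm a v p) (dd_comm b v p) !evv (dd_comm b a p).
  by move: (ev x (dd a (dd a p))) (ev x (dd a (dd b p))) (ev x (dd b (dd b p))) => *; ring.
split.
- by rewrite evv (dd_comm b a f) eA eB.
- by rewrite evv eB eC.
- by rewrite q2 eA eB eC.
- rewrite evv (dd_comm a v (dd v f)) (dd_comm b v (dd v f)) (dd_comm a v f) (dd_comm b v f) !q2.
  rewrite (dd_comm b a f) (dd_comm b a (dd b f)).
  rewrite e0 e1 e2 e3.
  by move: (ev x (t0 f)) (ev x (t1 f)) (ev x (t2 f)) (ev x (t3 f)) => *; ring.
Qed.

Lemma Vf_tangent x : ev x f = 0 -> ev x (dd (map_mx (ev x) Vf) f) = 0.
Proof.
move=> _; rewrite VfE ddDl -scaleNr !ddZl rmorphD /= !mevZ avec_tangent bvec_tangent.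
by rewrite !mulr0 addr0.
Qed.

Lemma Vf_asymptotic x (v := map_mx (ev x) Vf) : ev x f = 0 -> ev x (dd v (dd v f)) = 0.
Proof.
move=> fx; have [_ _ -> _] := Vf_tensors x.
have e := binres_vanish fx; rewrite binres_morph /= in e.
by rewrite /r0 /r1 rem0_morph rem1_morph /= rem_quadratic e mulr0.
Qed.

Lemma Vf_flecnodal x (v := map_mx (ev x) Vf) : ev x f = 0 -> ev x (tC f) != 0 ->
  ev x (dd v (dd v (dd v f))) = 0.
Proof.
move=> fx C0; have [_ _ e2 e3] := Vf_tensors x; have := Vf_asymptotic fx; rewrite e2 e3.
have := rem_cubic (ev x (tA f)) (ev x (tB f)) (ev x (tC f)) (ev x (t0 f)) (ev x (t1 f))
  (ev x (t2 f)) (ev x (t3 f)).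
rewrite -rem0_morph -rem1_morph /= -/r0 -/r1 => e z; rewrite z mulr0 in e.
by move/eqP: e; rewrite mulf_eq0 expf_eq0 (negbTE C0) => /eqP.
Qed.

Lemma coef2_pline x v : 2%:R * (mev polyC (pline x v) f)`_2 = ev x (dd v (dd v f)).
Proof.
by rewrite -(coef0_pline x v) -!deriv_line !coef_deriv mulr1n mulr_natl.
Qed.

Lemma coef3_pline x v : 6%:R * (mev polyC (pline x v) f)`_3 = ev x (dd v (dd v (dd v f))).
Proof.
by rewrite -(coef0_pline x v) -!deriv_line !coef_deriv mulr1n -mulrnA mulr_natl.
Qed.

(** Flow coefficients 1 and 2 vanish on the surface and coefficient 3 vanishes at [x].
    Differentiating the first two along [v] shows that [DV] is tangent and conjugate to [v]. For a
    nondegenerate quadratic form and an isotropic [v], the conjugate tangent vectors are the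
    multiples of [v], modulo [x]. *)
Lemma Vf_straight x (v := map_mx (ev x) Vf) : ev x f = 0 -> ev x Theta != 0 ->
  exists l m, (\row_i ev x (dd v (Vf 0 i))) = l *: v + m *: x.
Proof.
move=> fx; rewrite !rmorphM !mulf_eq0 !negb_or /= mevX => /andP[/andP[/andP[/andP[x0 f30] D0] r00] C0].
have [hf _ d3 _] := gf.
have n2 : 2%:R != 0 :> K by apply: (good_natr gf); rewrite /= ltnW.
have n3 : 3%:R != 0 :> K by apply: (good_natr gf).
have n6 : 6%:R != 0 :> K by rewrite (_ : 6 = 2 * 3)%N // natrM mulf_neq0.
have tv := Vf_tangent fx; rewrite -/v in tv.
have h1 y : ev y f = 0 -> ev y (flow Vf f)`_1 = 0.
  by move=> fy; rewrite coef_flow coef1_pline Vf_tangent.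
have p2 y : ev y f = 0 -> (mev polyC (pline y (map_mx (ev y) Vf)) f)`_2 = 0.
  move=> fy; apply/eqP; have /eqP := Vf_asymptotic fy.
  by rewrite -coef2_pline mulf_eq0 (negbTE n2).
have h2 y : ev y f = 0 -> ev y (flow Vf f)`_2 = 0.
  by move=> fy; rewrite coef_flow p2.
have p3 : (mev polyC (pline x v) f)`_3 = 0.
  apply/eqP; have /eqP := Vf_flecnodal fx C0.
  by rewrite -coef3_pline mulf_eq0 (negbTE n6).
set DV := \row_i _.
have split k : (\sum_i ((v 0 i)%:P + 'X * (ev x (dd v (Vf 0 i)))%:P) * mev polyC (pline x v) f;;i)`_k.+1
    = (mev polyC (pline x v) f)`_k.+2 *+ k.+2 + (mev polyC (pline x v) (dd DV f))`_k.
  rewrite -coef_deriv deriv_line -!sum_pline.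
  have cX (q : {poly K}) : q`_k = ('X * q)`_k.+1 by rewrite coefXM.
  rewrite [X in _ + X]cX -coefD mulr_sumr -big_split /=.
  congr (nth _ (polyseq _) _); apply: eq_bigr => i _.
  by rewrite [DV _ _]mxE mulrDl mulrA.
have q0 : ev x (dd DV f) = 0.
  have := tangent_vanish gf h1 fx tv; rewrite flow_deriv -/v split p2 // mul0rn add0r.
  by rewrite coef0_pline.
have q1 : ev x (dd v (dd DV f)) = 0.
  have := tangent_vanish gf h2 fx tv; rewrite flow_deriv -/v split p3 mul0rn add0r.
  by rewrite coef1_pline.
have U : frame x (avec f x) (bvec f x) (delta_mx 0 o3) \in unitmx.
  by rewrite unitmxE det_frame_ab unitfE mulf_neq0 // expf_neq0.
have [c0 [c1 [c2 [c3 eD]]]] := frame_decomp DV U.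
have [ea eb eq _] := Vf_tensors x; rewrite -/v in ea eb eq.
have asy := Vf_asymptotic fx; rewrite -/v eq in asy.
have ex : ev x (dd x f) = 0 by rewrite (dd_Euler x hf) fx mulr0.
have exv : ev x (dd x (dd v f)) = 0 by rewrite (dd_Euler x (dd_homog v hf)) tv mulr0.
move: q0; rewrite eD ev_dd4 ex avec_tangent bvec_tangent dd_delta !mulr0 !add0r => /eqP.
rewrite mulf_eq0 (negbTE f30) orbF => /eqP c30.
move: q1; rewrite dd_comm eD ev_dd4 exv (dd_comm _ v f) ea (dd_comm _ v f) eb c30.
rewrite mul0r addr0 mulr0 add0r scale0r addr0; move: asy D0 r00.
have -> : ev x (tA f * tC f - tB f ^+ 2) = ev x (tA f) * ev x (tC f) - ev x (tB f) ^+ 2.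
  by rewrite rmorphB rmorphXn rmorphM.
have ev' : v = ev x r1 *: avec f x - ev x r0 *: bvec f x by apply: VfE.
move: (ev x (tA f)) (ev x (tB f)) (ev x (tC f)) (ev x r0) (ev x r1) ev' => A B C s0 s1 -> asy D0 s00 e.
have P0 : s1 * A - s0 * B != 0.
  apply/negP => /eqP P0; case/negP: D0; apply/eqP.
  apply: (mulfI s00); rewrite mulr0.
  have Q0 : s1 * B - s0 * C = 0.
    apply: (mulfI s00); rewrite mulr0; transitivity (s1 * (s1 * A - s0 * B)
      - (s1 ^+ 2 * A - 2%:R * s0 * s1 * B + s0 ^+ 2 * C)); first by ring.
    by rewrite asy P0 mulr0 subr0.
  transitivity (B * (s1 * A - s0 * B) - A * (s1 * B - s0 * C)); first by ring.
  by rewrite P0 Q0 !mulr0 subr0.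
have key : c1 * s0 + c2 * s1 = 0.
  apply: (mulfI P0); rewrite mulr0.
  transitivity (s0 * (c1 * (s1 * A - s0 * B) + c2 * (s1 * B - s0 * C))
     + c2 * (s1 ^+ 2 * A - 2%:R * s0 * s1 * B + s0 ^+ 2 * C)); first by ring.
  by rewrite e asy !mulr0 addr0.
have ec1 : c1 = - c2 / s0 * s1.
  by apply: (mulIf s00); rewrite mulrAC mulfVK // mulNr; apply/eqP; rewrite -addr_eq0 key.
exists (- c2 / s0), c0; rewrite scalerBr !scalerA -ec1 mulfVK // scaleNr opprK.
by rewrite -addrA addrC.
Qed.

Lemma Vf_contra : False.
Proof.
apply: (@no_ruling K f d Vf Theta gf not_divides_Theta Vf_tangent Vf_straight) => x fx.
rewrite !rmorphM !mulf_eq0 !negb_or /= mevX => /andP[/andP[/andP[/andP[x0 f30] _] r00] _].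
have U : frame x (avec f x) (bvec f x) (delta_mx 0 o3) \in unitmx.
  by rewrite unitmxE det_frame_ab unitfE mulf_neq0 // expf_neq0.
exists (avec f x), (delta_mx 0 o3); split; last exact: avec_tangent.
rewrite -row_free_unit; apply: inj_row_free => c; rewrite frame_row VfE => e.
have : c 0 o0 *: x + (c 0 o1 * ev x r1 + c 0 o2) *: avec f x
   + (- (c 0 o1 * ev x r0)) *: bvec f x + c 0 o3 *: delta_mx 0 o3 = 0.
  rewrite -[RHS]e scalerBr !scalerA scalerDl scaleNr !addrA; congr (_ + _).
  by rewrite [RHS]addrAC.
case/(frame_indep U) => c00 c10 /eqP; rewrite oppr_eq0 mulf_eq0 (negbTE r00) orbF => /eqP c20 c30.
rewrite c20 mul0r add0r in c10.
by apply/rowP; apply: ord4_ind; rewrite mxE.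
Qed.

End FlecnodalField.

(** * Coordinate changes and ramification of the Gauss map *)

Section Transfer.
Variable K : closedFieldType.
Implicit Types (f g : {mpoly K[4]}) (x v w : 'rV[K]_4) (P : 'M[K]_4).

Lemma good_msub d f P : good d f -> P \in unitmx -> good d (msub P f).
Proof.
move=> [hf sf d3 hp] U; split=> //; first exact: msub_homog.
move=> x x0 [fx gx]; apply: (sf (x *m P)).
  by apply: contraNneq x0 => h; rewrite -(mulmxK U x) h mul0mx.
split=> [|i]; first by rewrite -ev_msub.
rewrite -dd_delta -(mulmxKV U (delta_mx 0 i)) -ev_msub -dd_msub ev_dd.
by apply: big1 => j _; rewrite gx mulr0.
Qed.

Lemma divides_msub f g P : divides f g -> divides (msub P f) (msub P g).
Proof. by move=> [c ->]; exists (msub P c); rewrite rmorphM. Qed.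

Lemma mev_frame (v0 v1 v2 v3 : 'rV[K]_4) g :
  Lp (msub (frame v0 v1 v2 v3) g) = mev polyC (pline v0 v1) g.
Proof.
apply: poly_eq_horner => y; rewrite horner_Lp ev_msub horner_mev horner_pline.
rewrite frame_row; congr mev; rewrite !mxE /= !(mulr0, mulr1, addr0, add0r).
by rewrite scale1r !scale0r !addr0.
Qed.

Lemma mderiv_frame (v0 v1 v2 v3 : 'rV[K]_4) g i :
  (msub (frame v0 v1 v2 v3) g);;i = msub (frame v0 v1 v2 v3) (dd (nth 0 [:: v0; v1; v2; v3] i) g).
Proof. by rewrite -dd_delta dd_msub -rowE rowK. Qed.

Lemma Lp_0 d f : good d f -> Lp f = 0 -> Lp f;;o0 = 0.
Proof.
by move=> [hf _ _ _] h; have := Euler_Lp hf; rewrite -deriv_Lp h deriv0 !mulr0 addr0.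
Qed.

Lemma line_coprime d f : good d f -> Lp f = 0 ->
  forall y, ~ ((Lp f;;o2).[y] = 0 /\ (Lp f;;o3).[y] = 0).
Proof.
move=> gf h y [g2 g3]; have [_ sf _ _] := gf; apply: (sf (pt y) (pt_neq0 y)).
split; first by rewrite -horner_Lp h horner0.
by apply: ord4_ind; rewrite -horner_Lp // ?(Lp_0 gf h) ?(Lp_1 h) ?horner0.
Qed.

Lemma line_coprime_top d f : good d f -> Lp f = 0 ->
  ~ ((Lp f;;o2)`_d.-1 = 0 /\ (Lp f;;o3)`_d.-1 = 0).
Proof.
move=> gf h [g2 g3]; have [hf sf _ _] := gf.
have t i : (Lp f;;i)`_d.-1 = ev (delta_mx 0 o1) f;;i by apply/coef_pline_top/mderiv_homog.
have e1 : delta_mx 0 o1 != 0 :> 'rV[K]_4.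
  by apply/negP => /eqP/rowP/(_ o1); rewrite !mxE /= => /eqP; rewrite oner_eq0.
apply: (sf _ e1); split.
  by rewrite -(coef_pline_top (delta_mx 0 o0) _ hf) -/(Lp f) h coef0.
by apply: ord4_ind; rewrite -t // ?(Lp_0 gf h) ?(Lp_1 h) ?coef0.
Qed.

Lemma WpE f : Wp f = schwarz (Lp f;;o2) (Lp f;;o3).
Proof. by rewrite /Wp /schwarz /= deriv_wron. Qed.

Lemma schwarz_w0 (g h : {poly K}) : wron g h = 0 -> schwarz g h = 0.
Proof. by move=> e; rewrite schwarzE e !deriv0; ring. Qed.

Lemma frame_unit_indep (v0 v1 v2 v3 : 'rV[K]_4) :
  (forall c0 c1 c2 c3, c0 *: v0 + c1 *: v1 + c2 *: v2 + c3 *: v3 = 0 ->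
    [/\ c0 = 0, c1 = 0, c2 = 0 & c3 = 0]) -> frame v0 v1 v2 v3 \in unitmx.
Proof.
move=> h; rewrite -row_free_unit; apply: inj_row_free => c; rewrite frame_row => /h[? ? ? ?].
by apply/rowP; apply: ord4_ind; rewrite mxE.
Qed.

Lemma frame_delta : frame (delta_mx 0 o0) (delta_mx 0 o1) (delta_mx 0 o2) (delta_mx 0 o3) = 1%:M :> 'M[K]_4.
Proof.
apply/row_matrixP => i; rewrite rowK rowE mulmx1.
by case: i => [[|[|[|[|]]]]] //= hi; congr delta_mx; apply: val_inj.
Qed.

Lemma delta_indep (c0 c1 c2 c3 : K) :
  c0 *: delta_mx 0 o0 + c1 *: delta_mx 0 o1 + c2 *: delta_mx 0 o2 + c3 *: delta_mx 0 o3
    = 0 :> 'rV[K]_4 -> [/\ c0 = 0, c1 = 0, c2 = 0 & c3 = 0].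
Proof. by apply: frame_indep; rewrite frame_delta unitmx1. Qed.

(* e0 is a ramification point of the Gauss map of the line. *)
Lemma flec_ramified d f : good d f -> Lp f = 0 -> divides f (flec f) ->
  (Lp f;;o2)`_0 = 0 -> (Lp f;;o2)`_1 = 0 -> False.
Proof.
move=> gf h hF c0 c1; have [hf _ d3 _] := gf.
have hi i : f;;i \is d.-1.-homog by apply: mderiv_homog.
have si i := size_Lp (hi i).
have cop := line_coprime gf h.
have g2n : Lp f;;o2 != 0.
  apply/negP => /eqP g20; have /closed_rootP[y /rootP y0] : size (Lp f;;o3) != 1%N.
    apply/negP => /eqP s1; apply: (line_coprime_top gf h).
    by rewrite g20 coef0 nth_default // s1; lia.
  by apply: (cop y); rewrite g20 horner0.
have [q e] : exists q, Lp f;;o2 = 'X^2 * q by apply: coef_vanish_dvd => -[|[|//]] _.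
have qn : q != 0 by apply: contraNneq g2n => q0; rewrite e q0 mulr0.
have [k [r rn eq]] := multiplicity_XsubC q 0; rewrite qn /= in rn.
have e2 : Lp f;;o2 = 'X^(k.+2) * r by rewrite e eq subr0 mulrC -mulrA -exprD addn2 mulrC.
have r0 : r.[0] != 0 by move: rn; rewrite /root.
(* The order of the zero is at most the degree of [f;;o2] on the line, so the integers up to [k + 3]
   needed by [schwarz_neq0] are invertible. *)
have kd : (k.+2 <= d.-1)%N.
  rewrite -ltnS; apply: leq_trans (si o2); rewrite e2 mulrC size_mulXn; last first.
    by apply: contraNneq r0 => ->; rewrite horner0.
  rewrite -addn1 leq_add2l size_poly_gt0.
  by apply: contraNneq r0 => ->; rewrite horner0.
have g30 : (Lp f;;o3).[0] != 0.
  by apply/negP => /eqP g30; apply: (cop 0); rewrite horner_coef0.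
have Wn : Wp f != 0.
  rewrite WpE e2; apply: schwarz_neq0 => // i i3; apply: (good_natr gf); lia.
have g3n : Lp f;;o3 != 0 by apply: contraNneq g30 => ->; rewrite horner0.
have w1n : w1 f != 0 by apply: contraNneq Wn; rewrite WpE => /schwarz_w0 ->.
have [u0|u0] := eqVneq (ubb f) 0; last exact: (Vf_contra gf h g3n w1n u0 Wn hF).
(* The case [ubb = 0] is removed by the shear of [e2] to [e2 + e1]: it keeps [w1] and [Wp] and
   changes [ubb] to [2 * f3 * w1], which is nonzero. *)
pose P := frame (delta_mx 0 o0) (delta_mx 0 o1) (delta_mx 0 o2 + delta_mx 0 o1) (delta_mx 0 o3 : 'rV[K]_4).
have U : P \in unitmx.
  apply: frame_unit_indep => a0 a1 a2 a3.
  rewrite scalerDr [a2 *: _ + _]addrC !addrA -[_ + a1 *: _ + a2 *: delta_mx 0 o1]addrA -scalerDl => /delta_indep[-> a12 a20 ->].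
  by rewrite a20 addr0 in a12.
have LP g : Lp (msub P g) = Lp g by rewrite mev_frame.
have D1 g : (msub P g);;o1 = msub P g;;o1 by rewrite mderiv_frame /= dd_delta.
have D2 g : (msub P g);;o2 = msub P (g;;o2 + g;;o1) by rewrite mderiv_frame /= ddDl !dd_delta.
have D3 g : (msub P g);;o3 = msub P g;;o3 by rewrite mderiv_frame /= dd_delta.
have E2 : Lp (msub P f);;o2 = Lp f;;o2 by rewrite D2 LP rmorphD /= (Lp_1 h) addr0.
have E3 : Lp (msub P f);;o3 = Lp f;;o3 by rewrite D3 LP.
have w1' : w1 (msub P f) = w1 f by rewrite /w1 E2 E3.
have n2 : 2%:R != 0 :> {poly K}.
  by rewrite -polyC_natr polyC_eq0; apply: (good_natr gf); rewrite /= ltnW.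
have u' : ubb (msub P f) = 2%:R * Lp f;;o3 * w1 f.
  rewrite /ubb E2 E3 !(D2, D3) !LP !mderivD !rmorphD /= (Lp_11 h).
  have c12 : f;;o2;;o1 = f;;o1;;o2 by apply: mderiv_comm.
  rewrite c12 !mderiv1C /w1; transitivity (ubb f + 2%:R * Lp f;;o3 *
    (Lp f;;o3 * (Lp f;;o2)^`() - Lp f;;o2 * (Lp f;;o3)^`())); last by rewrite u0 add0r.
  rewrite /ubb /quad2.
  move: (Lp f;;o2;;o2) (Lp f;;o2;;o3) (Lp f;;o3;;o3) (Lp f;;o2)^`() (Lp f;;o3)^`() (Lp f;;o2) (Lp f;;o3).
  by clear => *; ring.
apply: (@Vf_contra K (msub P f) d (good_msub gf U)).
- by rewrite LP.
- by rewrite E3.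
- by rewrite w1'.
- by rewrite u' !mulf_neq0.
- by rewrite WpE E2 E3 -WpE.
- rewrite flec_msub; have [c ->] := divides_msub P hF.
  by exists (\det P ^+ 6 *: c); rewrite scalerAr.
Qed.

(** The Gauss map of the line has degree [d - 1 > 1], so it is ramified at a finite point [y0]. The
    new frame puts this point at [e0] and takes for [e2] a vector tangent there; the derivative
    along [e2] then has a double zero at the origin. *)
Lemma flec_not_divides_std d f : good d f -> Lp f = 0 -> ~ divides f (flec f).
Proof.
move=> gf h hF; have [hf _ d3 _] := gf.
have hi i : f;;i \is d.-1.-homog by apply: mderiv_homog.
have si i := size_Lp (hi i); have cop := line_coprime gf h.
have [y0 hy] : exists y, (wron (Lp f;;o2) (Lp f;;o3)).[y] = 0.
  apply: (@wron_root K d.-1) => //; last exact: (line_coprime_top gf h); last by lia.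
  by move=> k hk; apply: (good_natr gf); lia.
set a := (Lp f;;o3).[y0]; set b := - (Lp f;;o2).[y0].
have [e U] : exists e, frame (pt y0) (delta_mx 0 o1) (a *: delta_mx 0 o2 + b *: delta_mx 0 o3) e \in unitmx.
  have ab : ~ (b = 0 /\ a = 0) by move=> [b0 a0]; apply: (cop y0); split=> //; rewrite -[LHS]opprK -/b b0 oppr0.
  have [a0|a0] := eqVneq a 0.
    have b0 : b != 0 by apply/eqP => b0; apply: ab.
    exists (delta_mx 0 o2); apply: frame_unit_indep => c0 c1 c2 c3; rewrite a0 scale0r add0r => hh.
    have [c00 c10 c30 hb] : [/\ c0 = 0, c0 * y0 + c1 = 0, c3 = 0 & c2 * b = 0].
      by apply: delta_indep; rewrite -[RHS]hh; apply/rowP => i; rewrite !mxE; ring.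
    move/eqP: hb; rewrite mulf_eq0 (negbTE b0) orbF => /eqP c20; split=> //.
    by rewrite c00 mul0r add0r in c10.
  exists (delta_mx 0 o3); apply: frame_unit_indep => c0 c1 c2 c3 hh.
  have [c00 c10 ha c30] : [/\ c0 = 0, c0 * y0 + c1 = 0, c2 * a = 0 & c2 * b + c3 = 0].
    by apply: delta_indep; rewrite -[RHS]hh; apply/rowP => i; rewrite !mxE; ring.
  move/eqP: ha; rewrite mulf_eq0 (negbTE a0) orbF => /eqP c20; rewrite c20 mul0r add0r in c30; split=> //.
  by rewrite c00 mul0r add0r in c10.
set P := frame _ _ _ _ in U.
have LP g : Lp (msub P g) = mev polyC (pline (pt y0) (delta_mx 0 o1)) g by rewrite mev_frame.
have D2 : (msub P f);;o2 = msub P (a *: f;;o2 + b *: f;;o3).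
  by rewrite mderiv_frame /= ddDl !ddZl !dd_delta.
have LPy g y : (Lp (msub P g)).[y] = (Lp g).[y0 + y].
  by rewrite LP horner_mev horner_pline horner_Lp /pt scalerDl addrA.
apply: (@flec_ramified d (msub P f) (good_msub gf U)).
- apply: natr_tail_eq => y; rewrite LPy h horner0 //.
- rewrite flec_msub; have [c ->] := divides_msub P hF.
  by exists (\det P ^+ 6 *: c); rewrite scalerAr.
- rewrite D2 -horner_coef0 LPy addr0 rmorphD /= !LpZ hornerD !hornerM !hornerC /a /b; ring.
- rewrite D2; have -> (p : {poly K}) : p`_1 = p^`().[0] by rewrite horner_coef0 coef_deriv.
  rewrite deriv_Lp mderiv_frame /= dd_delta LPy addr0 mderivD !mderivZ rmorphD /= !LpZ.
  rewrite hornerD !hornerM !hornerC /a /b -!deriv_Lp.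
  by move: hy; rewrite /wron hornerD hornerN !hornerM => <-; ring.
Qed.

Lemma flec_not_divides d f (p q : 'rV[K]_4) : good d f -> p != 0 -> ~~ (q <= p)%MS ->
  mev polyC (pline p q) f = 0 -> ~ divides f (flec f).
Proof.
move=> gf p0 qp h hF.
have r1 : (\rank (q + p)%MS <= 2)%N by apply: rank_adds1; apply: rank_leq_row.
have [|u] := @pick_outside K 4 [:: (q + p)%MS]; first by rewrite /= andbT; apply: (leq_ltn_trans r1).
rewrite /= andbT => hu.
have [|v] := @pick_outside K 4 [:: (u + (q + p))%MS]; first by rewrite /= andbT ltnS; apply: rank_adds1.
rewrite /= andbT => hv; have U := frame_unit_fwd p0 qp hu hv.
apply: (@flec_not_divides_std d _ (good_msub gf U)); first by rewrite mev_frame.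
rewrite flec_msub; have [c ->] := divides_msub (frame p q u v) hF.
by exists (\det (frame p q u v) ^+ 6 *: c); rewrite scalerAr.
Qed.

End Transfer.

(** * Lines and the valency of a simple line *)

Section OmegaForm.
Variable K : closedFieldType.
Implicit Types (f g : {mpoly K[4]}) (x p q u v w : 'rV[K]_4).

(* The derivative of [flec f] along the vector of the plane [<u, v>] tangent to the surface. *)
Definition omega f u v := dd v f * dd u (flec f) - dd u f * dd v (flec f).

Lemma flec_degree d f : good d f -> flec f \is (11 * d - 24).-homog.
Proof.
move=> [hf _ d3 _]; have e : d = d.-2.-1.+3 by lia.
have -> : (11 * d - 24 = 11 * d.-2.-1 + 9)%N by lia.
by apply: flec_homog; rewrite -e.
Qed.

Lemma omega_homog d f u v : good d f -> omega f u v \is (12 * d - 26).-homog.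
Proof.
move=> gf; have [hf _ d3 _] := gf; have hF := flec_degree gf.
have h a b : dd a f * dd b (flec f) \is (12 * d - 26).-homog.
  have -> : (12 * d - 26 = d.-1 + (11 * d - 24).-1)%N by lia.
  by apply: dhomogM; apply: dd_homog.
by apply: rpredB; apply: h.
Qed.

Lemma Omega_msub f p q u v : Omega (msub (frame p q u v) f) =
  (\det (frame p q u v) ^+ 6)%:P * mev polyC (pline p q) (omega f u v).
Proof.
rewrite /Omega /Db flec_msub !mderivZ !mderiv_frame /= !LpZ !mev_frame /omega rmorphB !rmorphM /=.
by move: (_%:P) (mev _ _ _) (mev _ _ _) (mev _ _ _) (mev _ _ _) => *; ring.
Qed.

(** [Qp] depends on [e2] only modulo [e3] and follows translations of the line. Hence the order at
    any point can be computed with that point at the origin and a chosen transverse direction as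
    [e2]. *)
Lemma Qp_shift_frame f y0 (l : K) : let P := frame (pt y0) (delta_mx 0 o1)
    (delta_mx 0 o2 + l *: delta_mx 0 o3) (delta_mx 0 o3) in
  Lp f = 0 -> Qp (msub P f) = Qp f \Po ('X + y0%:P).
Proof.
move=> P h.
have LP g : Lp (msub P g) = Lp g \Po ('X + y0%:P).
  apply: poly_eq_horner => y; rewrite mev_frame horner_mev horner_pline horner_comp !hornerE.
  by rewrite horner_Lp; congr mev; apply/rowP => i; rewrite !mxE; ring.
have D1 g : (msub P g);;o1 = msub P g;;o1 by rewrite mderiv_frame /= dd_delta.
have D2 g : (msub P g);;o2 = msub P (g;;o2 + l *: g;;o3).
  by rewrite mderiv_frame /= ddDl ddZl !dd_delta.
have D3 g : (msub P g);;o3 = msub P g;;o3 by rewrite mderiv_frame /= dd_delta.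
have dsh (g : {poly K}) : (g \Po ('X + y0%:P))^`() = g^`() \Po ('X + y0%:P).
  by rewrite deriv_comp derivD derivX derivC addr0 mulr1.
have E2 : Lp (msub P f);;o2 = (Lp f;;o2 + l%:P * Lp f;;o3) \Po ('X + y0%:P).
  by rewrite D2 LP rmorphD /= LpZ.
have E3 : Lp (msub P f);;o3 = Lp f;;o3 \Po ('X + y0%:P) by rewrite D3 LP.
have B (g g' : {mpoly K[4]}) : Lp (g + l *: g') = Lp g + l%:P * Lp g' by rewrite rmorphD /= LpZ.
have dB (g g' : {mpoly K[4]}) i : (g + l *: g');;i = g;;i + l *: g';;i.
  by rewrite mderivD mderivZ.
have c32 (g : {mpoly K[4]}) : g;;o3;;o2 = g;;o2;;o3 by apply: mderiv_comm.
set sh := fun g : {poly K} => g \Po ('X + y0%:P) in LP dsh E2 E3 *.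
have ew1 : w1 (msub P f) = sh (w1 f).
  rewrite /w1 E2 E3 !dsh derivD derivM derivC mul0r add0r /sh -!rmorphM -rmorphB /=.
  by congr (_ \Po _); move: (Lp f;;o2)^`() (Lp f;;o3)^`() => *; ring.
have ew2 : w2 (msub P f) = sh (w2 f).
  rewrite /w2 E2 E3 !dsh !derivD !derivM !derivC !mul0r !add0r derivM derivC mul0r add0r.
  rewrite /sh -!rmorphM -rmorphB /=.
  by congr (_ \Po _); move: (Lp f;;o2)^`()^`() (Lp f;;o3)^`()^`() => *; ring.
have shq r s a b c : sh (quad2 r s a b c) = quad2 (sh r) (sh s) (sh a) (sh b) (sh c).
  exact: quad2_morph.
have shc r s a b c e : sh (cub3 r s a b c e) = cub3 (sh r) (sh s) (sh a) (sh b) (sh c) (sh e).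
  exact: cub3_morph.
have eu : ubb (msub P f) = sh (ubb f).
  rewrite /ubb E2 E3 !(D1, D2, D3) !LP !(dB, B, c32) -/(sh _) -!shq; congr sh; rewrite /quad2.
  by move: (Lp f;;o2;;o2) (Lp f;;o2;;o3) (Lp f;;o3;;o3) (Lp f;;o2) (Lp f;;o3) => *; ring.
have ec : c1bb (msub P f) = sh (c1bb f).
  rewrite /c1bb E2 E3 !(D1, D2, D3) !LP !(dB, B, c32) -/(sh _) -!shq; congr sh; rewrite /quad2.
  by move: (Lp f;;o1;;o2;;o2) (Lp f;;o1;;o2;;o3) (Lp f;;o1;;o3;;o3) (Lp f;;o2) (Lp f;;o3) => *; ring.
have eb : cbbb (msub P f) = sh (cbbb f).
  rewrite /cbbb E2 E3 !(D1, D2, D3) !LP !(dB, B, c32) -/(sh _) -!shc; congr sh; rewrite /cub3.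
  move: (Lp f;;o2;;o2;;o2) (Lp f;;o2;;o2;;o3) (Lp f;;o2;;o3;;o3) (Lp f;;o3;;o3;;o3).
  by move: (Lp f;;o2) (Lp f;;o3) => *; ring.
rewrite /Qp ew1 ew2 eu ec eb; apply/esym.
exact: quad_q_morph.
Qed.

End OmegaForm.

Lemma seq_choice (T : eqType) (U : Type) (u0 : U) (R : T -> U -> Prop) (s : seq T) :
  (forall a, a \in s -> exists b, R a b) -> exists g, forall a, a \in s -> R a (g a).
Proof.
elim: s => [|a s IH] h; first by exists (fun=> u0).
have [g hg] := IH (fun a ha => h a (mem_behead (s := _ :: _) ha)).
have [b hb] := h a (mem_head _ _).
exists (fun c => if c == a then b else g c) => c; rewrite inE.
by case: eqP => [-> //|_] /= /hg.
Qed.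

Section OrderAt.
Variable K : closedFieldType.
Implicit Types (f : {mpoly K[4]}) (p q u v w x : 'rV[K]_4) (A B L : 'M[K]_4).

Lemma Qp_order_at f y0 (l : K) (rs : seq K) : Lp f = 0 -> uniq rs ->
  (forall a t, a \in rs -> ev (pt y0 + t *: (a *: delta_mx 0 o1 +
     (delta_mx 0 o2 + l *: delta_mx 0 o3))) f = 0) ->
  ('X - y0%:P) ^+ size rs %| Qp f.
Proof.
move=> h urs hrs; set P := frame (pt y0) (delta_mx 0 o1)
    (delta_mx 0 o2 + l *: delta_mx 0 o3) (delta_mx 0 o3).
have hL : Lp (msub P f) = 0.
  apply: natr_tail_eq => y; rewrite mev_frame horner_mev horner_pline.
  by rewrite -addrA -scalerDl -/(pt _) -horner_Lp h horner0.
have [|q e] := Qp_order hL urs.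
  move=> a t ha; rewrite ev_msub -(hrs a t ha); congr mev.
  by rewrite mulmxDl -scalemxAl mulmxDl -scalemxAl -!rowE !rowK.
have -> : Qp f = (Qp f \Po ('X + y0%:P)) \Po ('X - y0%:P).
  have e0 : ('X + y0%:P) \Po ('X - y0%:P) = 'X by rewrite comp_polyD comp_polyX comp_polyC subrK.
  by rewrite -comp_polyA e0 comp_polyXr.
rewrite -(Qp_shift_frame y0 l h) -/P e rmorphM rmorphXn /= comp_polyX.
exact: dvdp_mulr.
Qed.

Lemma Qp_order_frame f p q u v y0 (l : K) (rs : seq K) : mev polyC (pline p q) f = 0 -> uniq rs ->
  (forall a t, a \in rs -> ev (p + y0 *: q + t *: (a *: q + (u + l *: v))) f = 0) ->
  ('X - y0%:P) ^+ size rs %| Qp (msub (frame p q u v) f).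
Proof.
move=> h urs hrs; apply: (@Qp_order_at _ _ l) => //; first by rewrite mev_frame.
move=> a t ha; rewrite ev_msub -(hrs a t ha); congr mev.
by rewrite /pt !(mulmxDl, =^~ scalemxAl) -!rowE !rowK.
Qed.

(** The canonical generator condition makes equality of lines equality of matrices, so lines can be
    counted in duplicate-free lists. *)
Definition lineX f A := [/\ \rank A = 2%N, <<A>>%MS = A & forall x, (x <= A)%MS -> ev x f = 0].

Lemma rank_pair p q : p != 0 -> ~~ (q <= p)%MS -> \rank (q + p)%MS = 2%N.
Proof.
move=> p0 qp; apply/eqP; rewrite eqn_leq rank_adds1 ?rank_leq_row //=.
by apply: leq_ltn_trans (rank_adds_gt qp); rewrite lt0n mxrank_eq0.
Qed.

Lemma span_line A p q : \rank A = 2%N -> (p <= A)%MS -> (q <= A)%MS -> p != 0 -> ~~ (q <= p)%MS ->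
  (A <= q + p)%MS.
Proof.
move=> rA pA qA p0 qp; have s : (q + p <= A)%MS by rewrite addsmx_sub qA pA.
by have := mxrank_leqif_sup s; rewrite rA rank_pair // => -[_ <-].
Qed.

Lemma line_eq f A B p q : lineX f A -> lineX f B -> p != 0 -> ~~ (q <= p)%MS ->
  (p <= A)%MS -> (q <= A)%MS -> (p <= B)%MS -> (q <= B)%MS -> A = B.
Proof.
move=> [rA gA _] [rB gB _] p0 qp pA qA pB qB; rewrite -gA -gB; apply/genmxP.
have sA := span_line rA pA qA p0 qp; have sB := span_line rB pB qB p0 qp.
by rewrite (submx_trans sA) ?(submx_trans sB) // addsmx_sub ?qA ?pA ?qB ?pB.
Qed.

Lemma line_basis A p : \rank A = 2%N -> exists2 q : 'rV[K]_4, (q <= A)%MS & ~~ (q <= p)%MS.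
Proof.
move=> rA; have : ~~ (A <= p)%MS.
  by apply/negP => /mxrankS; rewrite rA => h; have := leq_trans h (rank_leq_row p).
by case/row_subPn => i hi; exists (row i A) => //; apply: row_sub.
Qed.

Lemma line_point A : \rank A = 2%N -> exists2 p : 'rV[K]_4, (p <= A)%MS & p != 0.
Proof.
move=> rA; exists (nz_row A); first exact: nz_row_sub.
by rewrite nz_row_eq0 -mxrank_eq0 rA.
Qed.

Lemma sub_pair x p q : (x <= q + p)%MS -> exists s t, x = s *: p + t *: q.
Proof.
case/sub_addsmxP => -[a b] /= ->; exists (b 0 0), (a 0 0).
by rewrite [a]mx11_scalar [b]mx11_scalar !mul_scalar_mx addrC !mxE !mulr1n.
Qed.

Lemma line_coord A p q x : \rank A = 2%N -> (p <= A)%MS -> (q <= A)%MS -> p != 0 ->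
  ~~ (q <= p)%MS -> (x <= A)%MS -> exists s t, x = s *: p + t *: q.
Proof. by move=> rA pA qA p0 qp xA; apply: sub_pair; apply: submx_trans xA (span_line rA pA qA p0 qp). Qed.

Lemma pair_sub A p q (s t : K) : (p <= A)%MS -> (q <= A)%MS -> ((s *: p + t *: q)%R <= A)%MS.
Proof. by move=> pA qA; apply: addmx_sub; apply: scalemx_sub. Qed.

Lemma line_pline f A p q : lineX f A -> (p <= A)%MS -> (q <= A)%MS -> mev polyC (pline p q) f = 0.
Proof.
move=> [_ _ h] pA qA; apply: line_poly0 => t; apply: h.
by apply: addmx_sub => //; apply: scalemx_sub.
Qed.

Lemma line_tangent f A p w : lineX f A -> (p <= A)%MS -> (w <= A)%MS -> ev p (dd w f) = 0.
Proof.
move=> lA pA wA; rewrite -(coef0_pline p w) -deriv_line (line_pline lA) // deriv0 coef0 //.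
Qed.

Lemma lin_dep_pair p q (s t : K) : p != 0 -> ~~ (q <= p)%MS -> s *: p + t *: q = 0 -> s = 0 /\ t = 0.
Proof.
move=> p0 qp e; have t0 : t = 0.
  apply/eqP/negPn/negP => t0; case/negP: qp; apply/sub_rVP; exists (- s / t).
  apply: (scalerI t0); rewrite scalerA mulrCA divff // mulr1 scaleNr.
  by apply/eqP; rewrite -addr_eq0 addrC e.
by move/eqP: e; rewrite t0 scale0r addr0 scaler_eq0 (negbTE p0) orbF => /eqP.
Qed.

Lemma shift_indep p q (y : K) : p != 0 -> ~~ (q <= p)%MS -> p + y *: q != 0.
Proof.
move=> p0 qp; apply/negP => /eqP e; have [] := lin_dep_pair (s := 1) (t := y) p0 qp.
  by rewrite scale1r.
by move/eqP; rewrite oner_eq0.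
Qed.

(** All lines of the surface through the point lie in its tangent plane, so the ratio of their [v]-
    and [u]-components is the same; only the slope [a] distinguishes them. *)
Lemma line_dir f L A p q u v y (gv := ev (p + y *: q) (dd v f)) :
  lineX f L -> lineX f A -> A <> L -> (p <= L)%MS -> (q <= L)%MS -> frame p q u v \in unitmx ->
  ((p + y *: q)%R <= A)%MS -> gv != 0 ->
  exists a, ((a *: q + (u + (- ev (p + y *: q) (dd u f) / gv) *: v))%R <= A)%MS.
Proof.
move=> lL lA AL pL qL U PA gv0; set P0 := p + y *: q in gv gv0 PA *.
have PL : (P0 <= L)%MS by rewrite /P0 -[p]scale1r pair_sub.
have [rA _ _] := lA; have [w wA wP] := line_basis P0 rA.
have tw := line_tangent lA PA wA.
have [c0 [c1 [c2 [c3 ew]]]] := frame_decomp w U.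
have P00 : P0 != 0.
  apply/negP => /eqP e; have [] := @frame_indep _ _ _ _ _ 1 y 0 0 U.
    by rewrite !scale0r !addr0 scale1r.
  by move/eqP; rewrite oner_eq0.
move: tw; rewrite ew ev_dd4 (line_tangent lL PL pL) (line_tangent lL PL qL) !mulr0 !add0r -/gv => e.
have c20 : c2 != 0.
  apply/negP => /eqP c20; apply: AL; move: e; rewrite c20 mul0r add0r => /eqP.
  rewrite mulf_eq0 (negbTE gv0) orbF => /eqP c30.
  apply: (line_eq lA lL P00 wP) => //; rewrite ew c20 c30 !scale0r !addr0.
  exact: pair_sub.
have c3e : c3 = c2 * (- ev P0 (dd u f) / gv).
  apply: (mulIf gv0); rewrite -mulrA mulfVK // mulrN; apply/eqP.
  by rewrite -addr_eq0 addrC e.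
exists ((c1 - c0 * y) / c2).
suff -> : (c1 - c0 * y) / c2 *: q + (u + (- ev P0 (dd u f) / gv) *: v) = c2^-1 *: w - (c2^-1 * c0) *: P0.
  by rewrite -scaleNr pair_sub.
rewrite ew c3e; apply/rowP => i; rewrite !mxE; move: c20; clear; set g := _ / gv.
by move: (g) (p 0 i) (q 0 i) (u 0 i) (v 0 i) => *; field.
Qed.

Lemma Qp_order_lines f L p q u v y (As : seq 'M[K]_4) :
  lineX f L -> (p <= L)%MS -> (q <= L)%MS -> frame p q u v \in unitmx ->
  ev (p + y *: q) (dd v f) != 0 -> uniq As ->
  (forall A, A \in As -> [/\ lineX f A, A <> L & ((p + y *: q)%R <= A)%MS]) ->
  ('X - y%:P) ^+ size As %| Qp (msub (frame p q u v) f).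
Proof.
move=> lL pL qL U gv0 uAs hAs; set l := - ev (p + y *: q) (dd u f) / ev (p + y *: q) (dd v f).
have [|g hg] := @seq_choice _ K 0 (fun A a => ((a *: q + (u + l *: v))%R <= A)%MS) As.
  by move=> A /hAs[lA AL PA]; apply: (line_dir lL lA).
rewrite -(size_map g); apply: (@Qp_order_frame _ _ _ _ _ _ l); first exact: (line_pline lL).
  rewrite map_inj_in_uniq // => A B hA hB e.
  have [lA _ PA] := hAs A hA; have [lB _ PB] := hAs B hB; have ga := hg A hA; have gb := hg B hB.
  rewrite e in ga; apply: (line_eq lA lB _ _ PA ga PB gb).
    apply/negP => /eqP e0; have [] := @frame_indep _ _ _ _ _ 1 y 0 0 U.
      by rewrite !scale0r !addr0 scale1r.
    by move/eqP; rewrite oner_eq0.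
  apply/negP => /sub_rVP[c ec].
  have [] := @frame_indep _ _ _ _ _ (- c) (g B - c * y) 1 l U.
    have : g B *: q + (u + l *: v) - c *: (p + y *: q) = 0 by rewrite ec subrr.
    by move=> <-; apply/rowP => i; rewrite !mxE; ring.
  by move=> _ _ /eqP; rewrite oner_eq0.
move=> a t /mapP[A hA ->]; have [[_ _ h] _ PA] := hAs A hA; apply: h.
by rewrite -[p + _]scale1r pair_sub // hg.
Qed.

(** The powers of [dd v f] that separate [omega] from the product of [Qp] and the Schwarzian do not
    vanish at the point. *)
Lemma omega_order d f L p q u v y n (gf : good d f) :
  lineX f L -> (p <= L)%MS -> (q <= L)%MS -> frame p q u v \in unitmx ->
  ev (p + y *: q) (dd v f) != 0 ->
  ('X - y%:P) ^+ n %| Qp (msub (frame p q u v) f) ->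
  ('X - y%:P) ^+ n %| mev polyC (pline p q) (omega f u v).
Proof.
move=> lL pL qL U gv0 dv; set g := msub _ f in dv.
have gg : good d g := good_msub gf U.
have gL : Lp g = 0 by rewrite mev_frame (line_pline lL).
have := Omega_eq gg gL; rewrite Omega_msub => e.
have : ('X - y%:P) ^+ n %| Lp g;;o3 ^+ 12 *
   ((\det (frame p q u v) ^+ 6)%:P * mev polyC (pline p q) (omega f u v)).
  by rewrite e; apply: dvdp_mulr; apply: dvdp_mull.
have g3 : (Lp g;;o3).[y] = ev (p + y *: q) (dd v f).
  by rewrite mderiv_frame /= mev_frame horner_mev horner_pline.
rewrite Gauss_dvdpr; last first.
  rewrite coprimep_expl // coprimep_expr // coprimep_sym coprimep_XsubC.
  by apply/negP => /rootP h; rewrite -g3 h eqxx in gv0.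
rewrite mul_polyC dvdpZr // expf_neq0 //.
by move: U; rewrite unitmxE unitfE.
Qed.

Lemma root_split (P : {poly K}) (ys : seq K) : P != 0 ->
  (forall y, ('X - y%:P) ^+ count_mem y ys %| P) ->
  exists rs rest, [/\ P = lead_coef P *: \prod_(z <- rs) ('X - z%:P),
     perm_eq rs (ys ++ rest) & size rs = (size P).-1].
Proof.
move=> P0 h; have [rs e] := closed_field_poly_normal P.
have l0 : lead_coef P != 0 by rewrite lead_coef_eq0.
have [s ss ps] : exists2 s, subseq s rs & perm_eq ys s.
  apply/count_subseqP => y; rewrite -[X in (_ <= X)%N]mu_prod_XsubC mup_geq; last first.
    by rewrite monic_neq0 // monic_prod_XsubC.
  by have := h y; rewrite {1}e dvdpZr.
have [rest pr] := perm_to_subseq ss.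
exists rs, rest; split=> //; last by rewrite {1}e size_scale // size_prod_XsubC.
by rewrite (perm_trans pr) // perm_cat2r perm_sym.
Qed.

End OrderAt.

Section Valency.
Variable K : closedFieldType.
Implicit Types (p q u v w x : 'rV[K]_4) (A B L : 'M[K]_4).
Variables (f : {mpoly K[4]}) (d : nat).
Hypothesis gf : good d f.

(** No frame is fixed here: by [omega_change] any two transversal vectors detect the same
    nonvanishing. *)
Definition simple L := exists x u v, (x <= L)%MS /\ ev x (omega f u v) != 0.

Definition meet A B := (A :&: B != 0)%MS.

Lemma meetP A B : meet A B -> exists x, [/\ x != 0, (x <= A)%MS & (x <= B)%MS].
Proof.
move=> h; exists (nz_row (A :&: B)%MS); rewrite nz_row_eq0; split=> //;
  apply: submx_trans (nz_row_sub _) _; [exact: capmxSl|exact: capmxSr].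
Qed.

Lemma meetI A B x : x != 0 -> (x <= A)%MS -> (x <= B)%MS -> meet A B.
Proof.
move=> x0 xA xB; apply/negP => /eqP e; case/negP: x0.
by rewrite -submx0 -e sub_capmx xA xB.
Qed.

Lemma meetC A B : meet A B = meet B A.
Proof.
by apply/idP/idP => /meetP[x [x0 xA xB]]; apply: (meetI x0).
Qed.

Lemma vanish_tangent (g : {mpoly K[4]}) A x w : (forall x, (x <= A)%MS -> ev x g = 0) ->
  (x <= A)%MS -> (w <= A)%MS -> ev x (dd w g) = 0.
Proof.
move=> h xA wA; rewrite -(coef0_pline x w) -deriv_line line_poly0 ?deriv0 ?coef0 // => t.
by apply: h; apply: addmx_sub => //; apply: scalemx_sub.
Qed.

Lemma flec_line L x : lineX f L -> (x <= L)%MS -> ev x (flec f) = 0.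
Proof.
move=> [rL _ hL] xL; have [x0|x0] := eqVneq x 0.
  have [_ _ d3 _] := gf; have := flec_degree gf.
  have -> : (11 * d - 24 = (11 * d - 25).+1)%N by lia.
  by move/ev0_homog => h; rewrite x0.
have [v vL vx] := line_basis x rL; apply: (flec_on_line gf x0 vx) => t; apply: hL.
by apply: addmx_sub => //; apply: scalemx_sub.
Qed.

(** [omega] is alternating in its two vectors and sees them only modulo [L]; the constant is a
    [2 x 2] determinant. *)
Lemma omega_change L p q u v u' v' : lineX f L -> (p <= L)%MS -> (q <= L)%MS ->
  frame p q u v \in unitmx -> exists c, forall x, (x <= L)%MS ->
  ev x (omega f u' v') = c * ev x (omega f u v).
Proof.
move=> lL pL qL U; have [_ _ hL] := lL.
have [a0 [a1 [a2 [a3 eu]]]] := frame_decomp u' U.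
have [b0 [b1 [b2 [b3 ev']]]] := frame_decomp v' U.
exists (a2 * b3 - a3 * b2) => x xL.
have t w : (w <= L)%MS -> ev x (dd w f) = 0 by apply: vanish_tangent.
have tF w : (w <= L)%MS -> ev x (dd w (flec f)) = 0.
  by apply: vanish_tangent xL => y yL; apply: flec_line lL yL.
rewrite /omega !rmorphB !rmorphM /= eu ev' !ev_dd4 !(t _ pL) !(t _ qL) !(tF _ pL) !(tF _ qL).
move: (ev x (dd u f)) (ev x (dd v f)) (ev x (dd u (flec f))) (ev x (dd v (flec f))) => *; ring.
Qed.

Lemma multiple_tangent L x w : lineX f L -> ~ simple L -> (x <= L)%MS -> x != 0 ->
  ev x (dd w f) = 0 -> ev x (dd w (flec f)) = 0.
Proof.
move=> [_ _ hL] nL xL x0 tw; have [_ sf _ _] := gf.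
have [i gi] : exists i, ev x f;;i != 0.
  apply: NNPP => h; apply: (sf x x0); split; first exact: hL.
  by move=> i; apply/eqP/negPn/negP => gi; apply: h; exists i.
have : ev x (omega f w (delta_mx 0 i)) = 0.
  by apply/eqP/negPn/negP => h; apply: nL; exists x, w, (delta_mx 0 i).
rewrite /omega rmorphB !rmorphM /= tw mul0r subr0 dd_delta => /eqP.
by rewrite mulf_eq0 (negbTE gi) => /eqP.
Qed.

Lemma pick_pair (L : 'M[K]_4) : \rank L = 2%N ->
  exists p q, [/\ p != 0, ~~ (q <= p)%MS, (p <= L)%MS & (q <= L)%MS].
Proof.
move=> rL; have [p pL p0] := line_point rL; have [q qL qp] := line_basis p rL.
by exists p, q.
Qed.

Lemma pick_frame (p q : 'rV[K]_4) (As : seq 'M[K]_4) : p != 0 -> ~~ (q <= p)%MS ->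
  all (fun A => \rank A < 4)%N As ->
  exists u v, frame p q u v \in unitmx /\ all (fun A => ~~ (v <= A)%MS) As.
Proof.
move=> p0 qp hA; have r1 := rank_pair p0 qp.
have [|u] := @pick_outside K 4 [:: (q + p)%MS]; first by rewrite /= andbT r1.
rewrite /= andbT => hu.
have [|v] := @pick_outside K 4 ((u + (q + p))%MS :: As).
  by rewrite /= hA andbT ltnS; apply: rank_adds1; rewrite r1.
by rewrite /= => /andP[hv hAs]; exists u, v; split=> //; apply: frame_unit_fwd.
Qed.

Lemma rank_kergrad (x : 'rV[K]_4) : x != 0 -> ev x f = 0 -> (\rank (kermx (gradc f x)) < 4)%N.
Proof.
move=> x0 fx; have [_ sf _ _] := gf; have := gradc_neq0 sf x0 fx.
by rewrite mxrank_ker -mxrank_eq0 -lt0n; move: (\rank _) => r; lia.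
Qed.

Lemma sub_kergrad x v : (v <= kermx (gradc f x))%MS = (ev x (dd v f) == 0).
Proof.
by rewrite sub_kermx gradcE; apply/eqP/eqP => [->|h]; rewrite ?mxE //; apply/matrixP => i j; rewrite !ord1 h mxE.
Qed.

Lemma pair_swap p q (t : K) : p != 0 -> ~~ (q <= p)%MS -> q != 0 /\ ~~ ((p + t *: q)%R <= q)%MS.
Proof.
move=> p0 qp; have q0 : q != 0 by apply: contraNneq qp => ->; rewrite sub0mx.
split=> //; apply/negP => /sub_rVP[c e]; have [] := lin_dep_pair (s := 1) (t := t - c) p0 qp.
  by rewrite scale1r scalerBl addrA e subrr.
by move/eqP; rewrite oner_eq0.
Qed.

(** The affine coordinate is chosen so that neither a zero of [omega] nor a neighbour is at
    infinity, and [v] is transversal at each meeting point. Thus all [12 d - 26] zeros are finite,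
    and the roots of [Qp] bound the number of neighbours. *)
Lemma valency_data L (nb : seq 'M[K]_4) : lineX f L -> simple L -> uniq nb ->
  (forall A, A \in nb -> [/\ lineX f A, A <> L & meet A L]) ->
  exists p q u v Y rs rest, [/\ frame p q u v \in unitmx, (p <= L)%MS, (q <= L)%MS,
    forall A, A \in nb -> ((p + Y A *: q)%R <= A)%MS &
    [/\ exists2 c, c != 0 & mev polyC (pline p q) (omega f u v) = c *: \prod_(r <- rs) ('X - r%:P),
       perm_eq rs (map Y nb ++ rest), size rs = (12 * d - 26)%N & (size nb <= 8 * d - 14)%N]].
Proof.
move=> lL [x1 [u1 [v1 [x1L om1]]]] unb hnb; have [rL _ hL] := lL; have [hf sf d3 _] := gf.
have eN : ((12 * d - 26).+1 = 12 * d - 25)%N by clear -d3; lia.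
have num a b z : (z.-1 = a + b)%N -> (z <= 8 * d - 13)%N -> (a <= 8 * d - 14)%N by clear -d3; lia.
have [p0 [q0 [p00 q0p0 p0L q0L]]] := pick_pair rL.
pose O0 := mev polyC (pline p0 q0) (omega f u1 v1).
have hom := omega_homog u1 v1 gf.
have O0n : O0 != 0.
  apply/negP => /eqP e; case/negP: om1; apply/eqP.
  have [s [t ->]] := line_coord rL p0L q0L p00 q0p0 x1L.
  have [->|s0] := eqVneq s 0.
    by rewrite scale0r add0r (mev_homog _ _ _ hom) -(coef_pline_top p0 q0 hom) -/O0 e coef0 mulr0.
  have -> : s *: p0 + t *: q0 = s *: (p0 + (t / s) *: q0) by rewrite scalerDr scalerA mulrC mulfVK.
  by rewrite (mev_homog _ _ _ hom) -horner_pline -horner_mev -/O0 e horner0 mulr0.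
(* A neighbour contains at most one point [p0 + t *: q0], having only one point in common with [L];
   [tA] is its parameter, or [0] if there is none. *)
have [|tA htA] := @seq_choice _ K 0 (fun A a => forall t, ((p0 + t *: q0)%R <= A)%MS -> t = a) nb.
  move=> A /hnb[lA AL _].
  have [[a ha]|h] := classic (exists a, ((p0 + a *: q0)%R <= A)%MS); last first.
    by exists 0 => t ht; case: h; exists t.
  exists a => t ht; apply/eqP/negPn/negP => ta; apply: AL.
  have qA : (q0 <= A)%MS.
    have -> : q0 = (t - a)^-1 *: (p0 + t *: q0) + (- (t - a)^-1) *: (p0 + a *: q0).
      rewrite scaleNr -scalerBr opprD addrACA subrr add0r -scalerBl scalerA mulVf ?scale1r //.
      by rewrite subr_eq0.
    exact: pair_sub.
  have pA : (p0 <= A)%MS.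
    have -> : p0 = 1 *: (p0 + a *: q0) + (- a) *: q0 by rewrite scale1r scaleNr addrK.
    exact: pair_sub.
  exact: (line_eq lA lL p00 q0p0).
have /closed_nonrootP[t] : O0 * \prod_(A <- nb) ('X - (tA A)%:P) != 0.
  by rewrite mulf_neq0 // monic_neq0 // -(big_map tA xpredT (fun a => 'X - a%:P)) monic_prod_XsubC.
rewrite rootM negb_or => /andP[Ot tnb].
have tA' A : A \in nb -> t <> tA A.
  move=> hA e; case/negP: tnb; apply/rootP; rewrite (big_rem A hA) /= hornerM e.
  by rewrite !hornerE subrr mul0r.
pose q := p0 + t *: q0; pose p := q0.
(* The point just chosen becomes [q], the point at infinity of the coordinate [p + y *: q]. *)
have [pn qp] : p != 0 /\ ~~ (q <= p)%MS := pair_swap t p00 q0p0.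
have pL : (p <= L)%MS by [].
have qL : (q <= L)%MS by rewrite /q -[p0]scale1r; apply: pair_sub.
have qA A : A \in nb -> ~~ (q <= A)%MS by move=> hA; apply/negP => /(htA _ hA); apply: tA'.
have eqq : p0 + t *: q0 = q by [].
clearbody p q.
have [|Y hY] := @seq_choice _ K 0 (fun A y => ((p + y *: q)%R <= A)%MS) nb.
  move=> A hA; have [lA AL /meetP[x [x0 xA xL]]] := hnb A hA.
  have [a [b e]] := line_coord rL pL qL pn qp xL.
  have a0 : a != 0.
    apply/negP => /eqP a0; move: xA x0; rewrite e a0 scale0r add0r scaler_eq0 negb_or => bA /andP[b0 _].
    by case/negP: (qA A hA); rewrite -(scale1r q) -(mulVf b0) -scalerA scalemx_sub.
  exists (b / a); have -> : p + (b / a) *: q = a^-1 *: x.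
    by rewrite e scalerDr !scalerA mulVf // scale1r mulrC.
  exact: scalemx_sub.
(* The tangent planes at the meeting points, which [v] has to avoid. *)
pose ks := [seq kermx (gradc f (p + Y A *: q)) | A <- nb].
have [|u [v [U hv]]] := @pick_frame p q ks pn qp.
  apply/allP => k /mapP[A hA ->]; apply: rank_kergrad; first exact: shift_indep.
  by apply: hL; rewrite -[p]scale1r; apply: pair_sub.
have gv A : A \in nb -> ev (p + Y A *: q) (dd v f) != 0.
  by move=> hA; rewrite -sub_kergrad; apply: (allP hv); apply: map_f.
have dvQ y : ('X - y%:P) ^+ count_mem y (map Y nb) %| Qp (msub (frame p q u v) f).
  rewrite count_map -size_filter.
  case e : [seq A <- nb | preim Y (pred1 y) A] => [|A0 s]; first by rewrite dvd1p.
  have hA0 : A0 \in [seq A <- nb | preim Y (pred1 y) A] by rewrite e mem_head.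
  rewrite -e; move: hA0; rewrite mem_filter /= => /andP[/eqP yA0 hA0].
  apply: (Qp_order_lines lL pL qL U); first by rewrite -yA0 gv.
    exact: filter_uniq.
  move=> A; rewrite mem_filter /= => /andP[/eqP <- hA].
  by have [lA AL _] := hnb A hA; split=> //; apply: hY.
pose O := mev polyC (pline p q) (omega f u v).
have homO := omega_homog u v gf.
have Oq : ev q (omega f u v) != 0.
  have [c hc] := omega_change u1 v1 lL pL qL U; move: Ot; rewrite /root /O0 horner_mev horner_pline eqq.
  by rewrite hc // mulf_eq0 negb_or => /andP[].
have On : O != 0 by apply: contraNneq Oq => e; rewrite -(coef_pline_top p q homO) -/O e coef0.
have sO : size O = (12 * d - 25)%N.
  apply/eqP; rewrite eqn_leq; apply/andP; split.
    by rewrite -eN; apply: size_pline.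
  rewrite leqNgt; apply/negP => h; case/negP: Oq; apply/eqP.
  by rewrite -(coef_pline_top p q homO) nth_default // -ltnS eN.
have dvO y : ('X - y%:P) ^+ count_mem y (map Y nb) %| O.
  case e : (count_mem y (map Y nb)) => [|n]; first by rewrite dvd1p.
  have : y \in map Y nb by rewrite -has_pred1 has_count e.
  case/mapP => A hA yA; rewrite -e; apply: (omega_order gf lL pL qL U _ (dvQ y)).
  by rewrite yA gv.
have [rs [rest [ers pr srs]]] := root_split On dvO.
exists p, q, u, v, Y, rs, rest; split=> //; split=> //.
- by exists (lead_coef O); rewrite // lead_coef_eq0.
- by rewrite srs sO -eN.
have Qn : Qp (msub (frame p q u v) f) != 0.
  apply: contraNneq On => Q0; have gL : Lp (msub (frame p q u v) f) = 0.
    by rewrite mev_frame (line_pline lL).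
  have := Omega_eq (good_msub gf U) gL; rewrite Q0 mulr0 mul0r Omega_msub => /eqP.
  rewrite !(expf_eq0, mulf_eq0) /= polyC_eq0 expf_eq0 /=.
  have /negbTE -> : \det (frame p q u v) != 0 by move: U; rewrite unitmxE unitfE.
  move/orP => [/eqP g30|e0]; last exact: e0.
  have := U.
  case/negP.
  have cop := line_coprime (good_msub gf U) gL.
  have : size (Lp (msub (frame p q u v) f);;o2) == 1%N.
    by apply: contraT => /closed_rootP[y /rootP y0]; case: (cop y); rewrite y0 g30 horner0.
  move/eqP => s1; case: (line_coprime_top (good_msub gf U) gL).
  by rewrite g30 coef0 nth_default // s1 -ltnS (ltn_predK d3) ltnW.
have [rs' [rest' [_ pr' srs']]] := root_split Qn dvQ.
have := perm_size pr'; rewrite size_cat size_map srs' => /num; apply.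
exact: (size_Qp (msub_homog (frame p q u v) hf) d3).
Qed.

End Valency.

(** * Counting lines by a plane section *)

Lemma sum_root_mult (F : fieldType) (T : eqType) (s : seq T) (t : T -> F) (m : T -> nat) (p : {poly F}) :
  uniq s -> {in s &, injective t} -> (forall a, a \in s -> ('X - (t a)%:P) ^+ m a %| p) ->
  p != 0 -> (\sum_(a <- s) m a < size p)%N.
Proof.
elim: s p => [|a s IH] p; first by rewrite big_nil size_poly_gt0.
rewrite [uniq _]/= => /andP[na us] inj dv p0.
have /dvdpP[q e] := dv a (mem_head _ _).
have q0 : q != 0 by apply: contraNneq p0 => q0; rewrite e q0 mul0r.
have := IH q us; rewrite big_cons e size_Mmonic //; last by rewrite monic_exp // monicXsubC.
rewrite size_exp_XsubC addnS /= addnC ltn_add2r; apply=> //.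
  by move=> b c hb hc; apply: inj; rewrite inE ?hb ?hc orbT.
move=> b hb; have := dv b; rewrite inE hb orbT => /(_ isT); rewrite e Gauss_dvdpl //.
rewrite coprimep_expl // coprimep_expr // coprimep_XsubC root_XsubC.
apply: contraNneq na => e2.
by have <- : b = a by apply: inj; rewrite ?inE ?eqxx ?hb ?orbT.
Qed.

Section Elimination.
Variable K : closedFieldType.
Implicit Types (p q u v w x : 'rV[K]_4) (A B L : 'M[K]_4).
Variables (f : {mpoly K[4]}) (d : nat).
Hypothesis gf : good d f.

Lemma pline_mul n m (p q : 'rV[K]_n) (P : 'M[K]_(n, m)) :
  pline p q *m map_mx polyC P = pline (p *m P) (q *m P).
Proof. by rewrite /pline mulmxDl -scalemxAl -!map_mxM. Qed.

Lemma row_init_pline (p q : 'rV[K]_4) : row_init (pline p q) = pline (row_init p) (row_init q).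
Proof. by apply/rowP => i; rewrite !mxE. Qed.

Lemma line_grad_neq0 L p q u v : lineX f L -> (p <= L)%MS -> (q <= L)%MS ->
  frame p q u v \in unitmx -> mev polyC (pline p q) (dd u f) != 0.
Proof.
move=> lL pL qL U; set g := msub (frame p q u v) f; have gg : good d g := good_msub gf U.
have gL : Lp g = 0 by rewrite mev_frame (line_pline lL).
have <- : Lp g;;o2 = mev polyC (pline p q) (dd u f) by rewrite mderiv_frame mev_frame.
apply/negP => /eqP g20; have [_ _ d3 _] := gf.
have : size (Lp g;;o3) == 1%N.
  by apply: contraT => /closed_rootP[y /rootP y0]; case: (line_coprime gg gL (y := y)); rewrite y0 g20 horner0.
move/eqP => s1; case: (line_coprime_top gg gL); rewrite g20 coef0; split=> //.
by rewrite nth_default // s1 -ltnS (ltn_predK d3) ltnW.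
Qed.

Section Projection.
Variables (v0 v1 v2 O : 'rV[K]_4).
Let P := frame v0 v1 v2 O.
Hypothesis U : P \in unitmx.

Definition proj x : 'rV[K]_3 := row_init (x *m invmx P).

Lemma projD x y : proj (x + y) = proj x + proj y.
Proof. by rewrite /proj mulmxDl; apply/rowP => i; rewrite !mxE. Qed.
Lemma projZ c x : proj (c *: x) = c *: proj x.
Proof. by rewrite /proj -scalemxAl; apply/rowP => i; rewrite !mxE. Qed.
Lemma projO : proj O = 0.
Proof.
rewrite /proj; have -> : O = delta_mx 0 o3 *m P by rewrite -rowE rowK.
by rewrite mulmxK //; apply/rowP => i; rewrite !mxE; case: i => [[|[|[|]]]].
Qed.

Lemma proj_elim : ~ divides f (flec f) -> exists Phi : {mpoly K[3]}, [/\ Phi != 0,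
  forall x w, exists a b, mev polyC (pline (proj x) (proj w)) Phi =
    a * mev polyC (pline x w) f + b * mev polyC (pline x w) (flec f) &
  forall y w : 'rV[K]_3, (size (mev polyC (pline y w) Phi) <= (d * (11 * d - 24)).+1)%N].
Proof.
move=> nd; have gg := good_msub gf U; have [pg sg] := good_prime gg.
have nd' : ~ divides (msub P f) (msub P (flec f)).
  move=> /(divides_msub (invmx P)); rewrite !msubM mulVmx // !msub1 //.
have [Phi [Phi0 hb hs]] := elim_mpoly pg sg nd'.
have [hf _ d3 _] := gf; have hF := flec_degree gf.
exists Phi; split=> // [x w|y w].
  have [a [b e]] := hb _ polyC (pline (x *m invmx P) (w *m invmx P)).
  have mm g : mev polyC (pline (x *m invmx P) (w *m invmx P)) (msub P g) = mev polyC (pline x w) g.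
    by rewrite mev_msub pline_mul !mulmxKV.
  by exists a, b; rewrite -row_init_pline -!mm.
apply: (hs _ polyC (pline y w) (fun=> 1%N)).
- by move=> c; apply: size_polyC_leq1.
- move=> i; rewrite !mxE; apply: leq_trans (size_polyD _ _) _; rewrite geq_max.
  rewrite (leq_trans (size_polyC_leq1 _)) //=.
  apply: leq_trans (size_polyMleq _ _) _; rewrite size_polyX /=.
  by rewrite ltnS size_polyC_leq1.
- by lia.
- move=> mo hmo; rewrite -(dhomogP _ _ _ (msub_homog P hf) mo hmo) /= mdegE [X in (_ <= X)%N]big_ord_recr /=.
  by rewrite leq_add2r; apply: leq_sum => i _; rewrite mul1n.
- move=> mo hmo; rewrite -(dhomogP _ _ _ (msub_homog P hF) mo hmo) /= mdegE [X in (_ <= X)%N]big_ord_recr /=.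
  by rewrite leq_add2r; apply: leq_sum => i _; rewrite mul1n.
Qed.

End Projection.

Lemma rank_lines A B : lineX f A -> lineX f B -> meet A B -> (\rank (A + B)%MS < 4)%N.
Proof.
move=> [rA _ _] [rB _ _] h; have := mxrank_sum_cap A B; rewrite rA rB.
by move: h; rewrite /meet -mxrank_eq0; move: (\rank _) (\rank _) => a b; lia.
Qed.

Lemma rank_meet A B : \rank A = 2%N -> \rank B = 2%N -> (\rank (A + B)%MS <= 3)%N -> meet A B.
Proof.
move=> rA rB; have := mxrank_sum_cap A B; rewrite rA rB /meet -mxrank_eq0.
by move: (\rank _) (\rank _) => a b; lia.
Qed.

(** Off the lines and off the planes of meeting pairs, the projections of distinct lines are
    distinct lines. *)
Lemma pick_center (ls : seq 'M[K]_4) : (forall A, A \in ls -> lineX f A) ->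
  exists O : 'rV[K]_4, (forall A, A \in ls -> ~~ (O <= A)%MS) /\
   (forall A B, A \in ls -> B \in ls -> A <> B -> meet A B -> ~~ (O <= A + B)%MS).
Proof.
move=> hls; pose cs := [seq M <- ls ++ [seq (A + B)%MS | A <- ls, B <- ls] | (\rank M < 4)%N].
have [|O hO] := @pick_outside K 4 cs; first exact: filter_all.
exists O; split=> [A hA|A B hA hB AB mAB]; apply: (allP hO); rewrite mem_filter mem_cat.
  by have [-> _ _] := hls A hA; rewrite hA.
apply/andP; split; first by apply: rank_lines => //; apply: hls.
by apply/orP; right; apply: (allpairs_f (fun A B => (A + B)%MS)).
Qed.

Lemma hyperplane_meet (M : 'M[K]_4) p q : \rank M = 3%N -> ~~ (q <= M)%MS ->
  exists t : K, ((p + t *: q)%R <= M)%MS.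
Proof.
move=> rM qM; have : (p <= q + M)%MS.
  apply: submx_full; rewrite /row_full eqn_leq rank_leq_col /=.
  by have := rank_adds_gt qM; rewrite rM.
case/sub_addsmxP => -[a b] /= e; exists (- a 0 0).
have -> : p + (- a 0 0) *: q = b *m M.
  by rewrite e [X in X *m q]mx11_scalar mul_scalar_mx scaleNr addrAC subrr add0r.
exact: submxMl.
Qed.

Lemma sub_adds_vec (x O : 'rV[K]_4) (A : 'M[K]_4) : (x <= A + O)%MS -> exists z : K, ((x - z *: O)%R <= A)%MS.
Proof.
case/sub_addsmxP => -[a b] /= ->; exists (b 0 0).
by rewrite [X in X *m O]mx11_scalar mul_scalar_mx addrK submxMl.
Qed.

Lemma rank_add_vec (O : 'rV[K]_4) (A : 'M[K]_4) : \rank A = 2%N -> ~~ (O <= A)%MS -> \rank (A + O)%MS = 3%N.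
Proof.
move=> rA OA; apply/eqP; rewrite addsmxC eqn_leq rank_adds1 ?rA //=.
by have := rank_adds_gt OA; rewrite rA.
Qed.

(** The tangent plane at a point of [L] contains [O] only at zeros of the polar form of [O], which
    is not identically zero on [L]; the list adds [q] for the parameter at infinity. *)
Lemma tangent_points L (O : 'rV[K]_4) : lineX f L -> ~~ (O <= L)%MS -> exists zs : seq 'rV[K]_4,
  forall x, (x <= L)%MS -> x != 0 -> ev x (dd O f) = 0 -> exists2 z, z \in zs & (x <= z)%MS.
Proof.
move=> lL OL; have [rL _ _] := lL; have [p [q [p0 qp pL qL]]] := pick_pair rL.
have Opq : ~~ (O <= q + p)%MS.
  by apply: contra OL => h; apply: submx_trans h _; rewrite addsmx_sub qL.
have [|v] := @pick_outside K 4 [:: (O + (q + p))%MS].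
  by rewrite /= andbT ltnS rank_adds1 // rank_pair.
rewrite /= andbT => hv; have U := frame_unit_fwd p0 qp Opq hv.
have g0 := line_grad_neq0 lL pL qL U; have [rs e] := closed_field_poly_normal (mev polyC (pline p q) (dd O f)).
exists (q :: [seq p + r *: q | r <- rs]) => x xL x0 gx.
have [s [t ex]] := line_coord rL pL qL p0 qp xL.
have [s0|s0] := eqVneq s 0.
  by exists q; [rewrite mem_head|rewrite ex s0 scale0r add0r scalemx_sub].
have xe : x = s *: (p + (t / s) *: q) by rewrite scalerDr scalerA mulrC mulfVK.
exists (p + (t / s) *: q); last by rewrite xe scalemx_sub.
rewrite inE; apply/orP; right; apply: map_f; rewrite -root_prod_XsubC.
have l0 : lead_coef (mev polyC (pline p q) (dd O f)) != 0 by rewrite lead_coef_eq0.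
rewrite -(rootZ _ _ l0) -e; apply/rootP; rewrite horner_mev horner_pline.
have [hf _ _ _] := gf; move: gx; rewrite xe (mev_homog _ _ _ (dd_homog O hf)) => /eqP.
by rewrite mulf_eq0 expf_eq0 (negbTE s0) andbF => /eqP.
Qed.

Lemma rank3 (x y z : 'rV[K]_4) : (\rank (x + (y + z))%MS < 4)%N.
Proof. by rewrite ltnS; apply: rank_adds1; apply: rank_adds1; apply: rank_leq_row. Qed.

(** From a general centre [O] the lines project into the curve [Phi = 0]. On a general line
    [pr p + t * pr q] they give distinct roots of a nonzero polynomial of degree at most
    [d (11 d - 24)]. At a non-simple line both [f] and [flec f] vanish to second order in a common
    tangent direction, so the root is double. *)
Lemma count_lines (ls : seq 'M[K]_4) (m : pred 'M[K]_4) : uniq ls ->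
  (forall A, A \in ls -> lineX f A) -> (forall A, A \in ls -> m A -> ~ simple f A) ->
  (size ls + count m ls <= d * (11 * d - 24))%N.
Proof.
move=> uls hls hm; have [e|[A0 hA0]] : ls = [::] \/ exists A, A \in ls.
- by case: ls {uls hls hm} => [|A s]; [left|right; exists A; rewrite mem_head].
- by rewrite e.
have [rA0 _ _] := hls A0 hA0; have [p1 [q1 [p10 qp1 p1A q1A]]] := pick_pair rA0.
have nd := flec_not_divides gf p10 qp1 (line_pline (hls A0 hA0) p1A q1A).
have [O [OA OAB]] := pick_center hls.
have O0 : O != 0 by apply: contraNneq (OA A0 hA0) => ->; rewrite sub0mx.
have [v0 [v1 [v2 U]]] := frame_last O0.
have [Phi [Phi0 hb hs]] := proj_elim U nd; set pr := proj v0 v1 v2 O in hb.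
have prO : pr O = 0 := projO U.
have [y0 hy0] := mpoly_nonzero_point Phi0.
have [p ep] : exists p, pr p = y0.
  have [x ex _] := row_ext y0 0; exists (x *m frame v0 v1 v2 O).
  by rewrite /pr /proj mulmxK.
have phiA A x : A \in ls -> (x <= A + O)%MS -> ev (pr x) Phi = 0.
  move=> hA /sub_adds_vec[z xz]; have [_ _ h] := hls A hA.
  have -> : pr x = pr (x - z *: O) by rewrite /pr -scaleNr projD projZ -/pr prO scaler0 addr0.
  have [a [b /(congr1 (fun r : {poly K} => r`_0))]] := hb (x - z *: O) 0.
  rewrite coef0_pline coefD !coef0M !coef0_pline => ->.
  by rewrite h // (flec_line gf (hls A hA) xz) !mulr0 addr0.
have pA A : A \in ls -> ~~ (p <= A + O)%MS.
  by move=> hA; apply/negP => /(phiA A p hA); rewrite ep => e; rewrite e eqxx in hy0.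
have rAO A : A \in ls -> \rank (A + O)%MS = 3%N.
  by move=> hA; have [rA _ _] := hls A hA; rewrite rank_add_vec // OA.
have AOB A B : A \in ls -> B \in ls -> A <> B -> (\rank ((A + O) :&: (B + O))%MS <= 2)%N.
  move=> hA hB AB; rewrite leqNgt; apply/negP => h3.
  have sAB : (A + O <= B + O)%MS.
    apply: submx_trans (capmxSr (A + O)%MS (B + O)%MS).
    by have := mxrank_leqif_sup (capmxSl (A + O)%MS (B + O)%MS); rewrite rAO // => -[h1 <-]; rewrite eqn_leq h1.
  have sub : (A + B <= B + O)%MS.
    by rewrite addsmx_sub addsmxSl andbT (submx_trans _ sAB) // addsmxSl.
  have [rA gA _] := hls A hA; have [rB gB _] := hls B hB.
  have mAB : meet A B.
    by apply: rank_meet => //; have := mxrankS sub; rewrite rAO.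
  have := OAB A B hA hB AB mAB; case/negP.
  have : (B + O <= A + B)%MS; last by apply: submx_trans; apply: addsmxSr.
  have := mxrank_leqif_sup sub; rewrite rAO // => -[h1 <-]; rewrite eqn_leq h1 /=.
  rewrite ltnNge; apply/negP => h2; apply: AB; rewrite -gA -gB; apply/genmxP.
  have eA : (A + B <= A)%MS.
    by have := mxrank_leqif_sup (addsmxSl A B) => -[h4 <-]; rewrite eqn_leq h4 rA h2.
  have eB : (A + B <= B)%MS.
    by have := mxrank_leqif_sup (addsmxSr A B) => -[h4 <-]; rewrite eqn_leq h4 rB h2.
  by rewrite (submx_trans (addsmxSl A B) eB) (submx_trans (addsmxSr A B) eA).
have [zs hzs] := @seq_choice _ (seq 'rV[K]_4) [::] (fun L zs => forall x, (x <= L)%MS -> x != 0 ->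
   ev x (dd O f) = 0 -> exists2 z, z \in zs & (x <= z)%MS) ls (fun A hA => tangent_points (hls A hA) (OA A hA)).
(* Conditions on [q]: off each plane [A + O] ([cs1]); distinct parameters for distinct lines
   ([cs2]); the tangent plane at the chosen point of each line avoids [O] ([cs3]). The first
   excluded space, spanned by [O] and [p], makes the chosen points nonzero. *)
pose cs1 := [seq (A + O)%MS | A <- ls].
pose cs2 := [seq M <- [seq (p + ((A + O) :&: (B + O)))%MS | A <- ls, B <- ls] | (\rank M < 4)%N].
pose cs3 := flatten [seq [seq (z + (O + p))%MS | z <- zs A] | A <- ls].
have [|q hq] := @pick_outside K 4 ((O + (O + p))%MS :: cs1 ++ cs2 ++ cs3).
  rewrite -cat1s !all_cat; apply/and4P; split; first by rewrite /= rank3.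
  - by apply/allP => M /mapP[A hA ->]; rewrite rAO.
  - exact: filter_all.
  - by apply/allP => M /flattenP[s /mapP[A hA ->] /mapP[z hz ->]]; apply: rank3.
have q1' A : A \in ls -> ~~ (q <= A + O)%MS.
  by move=> hA; apply: (allP hq); rewrite inE !mem_cat map_f ?orbT.
have q2 A B : A \in ls -> B \in ls -> A <> B -> ~~ (q <= p + ((A + O) :&: (B + O)))%MS.
  move=> hA hB AB; apply: (allP hq); rewrite inE !mem_cat mem_filter.
  rewrite ltnS rank_adds1 ?AOB //= (allpairs_f (fun A B => (p + ((A + O) :&: (B + O)))%MS)) //.
  by rewrite orbT !orbT.
have q3 A z : A \in ls -> z \in zs A -> ~~ (q <= z + (O + p))%MS.
  move=> hA hz; apply: (allP hq); rewrite inE !mem_cat; do 3!(apply/orP; right).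
  by apply/flattenP; exists [seq (z + (O + p))%MS | z <- zs A]; apply: map_f.
have [t ht] := @seq_choice _ K 0 (fun A t => ((p + t *: q)%R <= A + O)%MS) ls
   (fun A hA => hyperplane_meet p (rAO A hA) (q1' A hA)).
have t0 A : A \in ls -> t A != 0.
  by move=> hA; apply: contraTneq (ht A hA) => ->; rewrite scale0r addr0 pA.
pose phi := mev polyC (pline (pr p) (pr q)) Phi.
have phin : phi != 0.
  apply: contraNneq hy0 => e; rewrite -ep -[pr p]addr0 -(scale0r (pr q)) -horner_pline -horner_mev.
  by rewrite -/phi e horner0.
have dv A : A \in ls -> ('X - (t A)%:P) ^+ (1 + m A) %| phi.
  move=> hA; have [z hz] := sub_adds_vec (ht A hA); set x := p + _ - _ in hz.
  have lA := hls A hA; have [_ _ hA0'] := lA; have tA0 := t0 A hA.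
  have qE : q = (t A)^-1 *: x + ((z / t A) *: O + (- (t A)^-1) *: p).
    by apply/rowP => i; rewrite !mxE; field.
  have qz y : (x <= y)%MS -> (q <= y + (O + p))%MS.
    move=> xy; rewrite qE; apply: addmx_sub_adds; first exact: scalemx_sub.
    by apply: addmx_sub_adds; apply: scalemx_sub.
  have x0 : x != 0.
    apply/negP => /eqP e; have : ~~ (q <= O + (O + p))%MS by apply: (allP hq); rewrite mem_head.
    by rewrite qz // e sub0mx.
  have prx : pr x = pr p + t A *: pr q.
    by rewrite /pr /x -scaleNr !projD !projZ -/pr prO scaler0 addr0.
  (* Adding a multiple of [O] to [q] does not change its projection and makes the direction tangent
     at [x]. *)
  have [w [prw wm]] : exists w, pr w = pr q /\ (m A -> ev x (dd w f) = 0).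
    case mA : (m A); last by exists q.
    have gO : ev x (dd O f) != 0.
      apply/negP => /eqP /(hzs A hA x hz x0)[y hy xy].
      by have := q3 A y hA hy; rewrite qz.
    exists (q + (- ev x (dd q f) / ev x (dd O f)) *: O).
    split; first by rewrite /pr projD projZ -/pr prO scaler0 addr0.
    by move=> _; rewrite ddDl ddZl rmorphD /= mevZ mulfVK // subrr.
  have [a [b e]] := hb x w.
  have vanish2 g : ev x g = 0 -> (m A -> ev x (dd w g) = 0) ->
      'X^(1 + m A) %| mev polyC (pline x w) g.
    move=> g0 g1; have [r ->] : exists r, mev polyC (pline x w) g = 'X^(1 + m A) * r.
      apply: coef_vanish_dvd => -[|[|l]] hl; first by rewrite coef0_pline.
        by rewrite coef1_pline g1 //; move: hl; case: (m A).
      by move: hl; case: (m A).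
    exact: dvdp_mulr.
  have comp : phi \Po ('X + (t A)%:P) = mev polyC (pline (pr x) (pr w)) Phi.
    apply: poly_eq_horner => y; rewrite horner_comp !hornerE /phi !horner_mev !horner_pline.
    by rewrite prx prw scalerDl [y *: _ + _]addrC addrA.
  have : 'X^(1 + m A) %| phi \Po ('X + (t A)%:P).
    rewrite comp e; apply: dvdp_add; apply: dvdp_mull; apply: vanish2 => //.
    - exact: hA0'.
    - exact: (flec_line gf lA).
    - by move=> mA; apply: (multiple_tangent gf lA (hm A hA mA) hz x0); apply: wm.
  case/dvdpP => r er; apply/dvdpP; exists (r \Po ('X - (t A)%:P)).
  have e0 : ('X + (t A)%:P) \Po ('X - (t A)%:P) = 'X by rewrite comp_polyD comp_polyX comp_polyC subrK.
  by rewrite -comp_Xn_poly -comp_polyM -er -comp_polyA e0 comp_polyXr.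
have inj : {in ls &, injective t}.
  move=> A B hA hB e; apply: NNPP => AB; have := q2 A B hA hB AB; case/negP.
  have h : ((p + t A *: q)%R <= (A + O) :&: (B + O))%MS by rewrite sub_capmx ht //= e ht.
  have -> : q = (- (t A)^-1) *: p + (t A)^-1 *: (p + t A *: q).
    by apply/rowP => i; rewrite !mxE; have := t0 A hA => ?; field.
  by apply: addmx_sub_adds; apply: scalemx_sub.
have := sum_root_mult uls inj dv phin; rewrite big_split /= sum1_size => h.
have := leq_trans h (hs (pr p) (pr q)); rewrite ltnS; apply: leq_trans.
by rewrite leq_add2l -sum1_count big_mkcond leq_sum // => A _; case: (m A).
Qed.

End Elimination.

(** * Lines skew to a given line *)

Section Taylor.
Variables (K S : comNzRingType) (phi : {rmorphism K -> S}) (n : nat).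
Implicit Types (x w : 'rV[S]_n) (t : S).

Lemma taylor2 x w t (p : {mpoly K[n]}) : exists r, mev phi (x + t *: w) p =
  mev phi x p + t * (\sum_i w 0 i * mev phi x p;;i) + t ^+ 2 * r.
Proof.
elim/mpoly_ring_ind: p => [c|i|p q [r er] [s es]|p q [r er] [s es]].
- by exists 0; rewrite !mevC big1 ?mulr0 ?addr0 // => i _; rewrite mderivC rmorph0 mulr0.
- exists 0; rewrite !mevX !mxE mulr0 addr0; congr (_ + _ * _).
  rewrite (bigD1 i) //= big1 ?addr0 => [|j ji]; rewrite mderivX mnm1E.
    rewrite eqxx scale1r.
    have -> : (U_(i) - U_(i) = 0)%MM by apply/mnmP => l; rewrite mnmBE subnn mnm0E.
    by rewrite mpolyX0 rmorph1 mulr1.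
  by rewrite eq_sym (negbTE ji) scale0r rmorph0 mulr0.
- exists (r + s); rewrite !rmorphD /= er es.
  have -> : \sum_i w 0 i * mev phi x (p + q);;i =
    \sum_i w 0 i * mev phi x p;;i + \sum_i w 0 i * mev phi x q;;i.
    by rewrite -big_split; apply: eq_bigr => i _; rewrite mderivD rmorphD mulrDr.
  by move: (\sum_i _) (\sum_i _) (mev _ _ _) (mev _ _ _) => *; ring.
- set a := \sum_i w 0 i * mev phi x p;;i in er; set b := \sum_i w 0 i * mev phi x q;;i in es.
  exists (a * b + mev phi x p * s + r * mev phi x q + t * (a * s + r * b) + t ^+ 2 * r * s).
  rewrite !rmorphM /= er es.
  have -> : \sum_i w 0 i * mev phi x (p * q);;i = a * mev phi x q + mev phi x p * b.
    rewrite mulr_suml mulr_sumr -big_split; apply: eq_bigr => i _.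
    by rewrite mderivM rmorphD !rmorphM mulrDr /= mulrA [w 0 i * (_ * _)]mulrCA.
  by clear er es; clearbody a b; move: (mev _ _ _) (mev _ _ _) => *; ring.
Qed.

Lemma taylor1 x w t (p : {mpoly K[n]}) : exists r, mev phi (x + t *: w) p = mev phi x p + t * r.
Proof.
have [r e] := taylor2 x w t p; exists (\sum_i w 0 i * mev phi x p;;i + t * r).
by rewrite e mulrDr addrA expr2 mulrA.
Qed.
End Taylor.

Section Hensel.
Variables (K S : comNzRingType) (phi : {rmorphism K -> S}).
Variables (g : {mpoly K[4]}) (x : 'rV[S]_4) (rho tau : S).
Hypothesis g0 : mev phi x g = 0.
Hypothesis g3 : mev phi x g;;o3 = rho.

(* A section of the surface through the line, transverse to it; [rho] is the derivative along [e3]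
   and the powers of [rho] clear the denominators of the Hensel lift. *)
Definition branch (z : S) : 'rV[S]_4 :=
  tau *: (rho ^+ 2 *: delta_mx 0 o2 + (rho * z) *: delta_mx 0 o3).

(** Newton iteration without division: the error carries [rho ^+ 2], of which one factor comes from
    the derivative [rho] along [e3] and the other from the step [rho * z] in [branch]. *)
Lemma hensel_branch N : exists z c, mev phi (x + branch z) g = rho ^+ 2 * tau ^+ N.+1 * c.
Proof.
elim: N => [|N [z [c e]]].
  exists 0; have [r e] := taylor1 phi x (delta_mx 0 o2) (rho ^+ 2 * tau) g.
  exists r; rewrite /branch mulr0 scale0r addr0 scalerA [tau * _]mulrC e g0 add0r.
  by rewrite expr1.
exists (z - tau ^+ N * c); set P := x + branch z in e.
have -> : x + branch (z - tau ^+ N * c) = P + (- (rho * tau ^+ N.+1 * c)) *: delta_mx 0 o3.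
  by apply/rowP => i; rewrite !mxE (exprS tau N); ring.
have [r ->] := taylor2 phi P (delta_mx 0 o3) (- (rho * tau ^+ N.+1 * c)) g.
have -> : \sum_i (delta_mx 0 o3 : 'rV[S]_4) 0 i * mev phi P g;;i = mev phi P g;;o3.
  by rewrite sum_ord4 !mxE /= !mul0r !add0r mul1r.
have [r' e'] := taylor1 phi x (rho *: delta_mx 0 o2 + z *: delta_mx 0 o3) (rho * tau) g;;o3.
have -> : mev phi P g;;o3 = rho + rho * tau * r'.
  rewrite g3 in e'; rewrite -e'; congr mev; rewrite /P /branch; apply/rowP => i; rewrite !mxE; ring.
exists (- (c * r') + tau ^+ N * c ^+ 2 * r); rewrite e (exprS tau N.+1) (exprS tau N); ring.
Qed.

End Hensel.

Lemma low_coef_mul (R : idomainType) (p r : {poly R}) m : (forall i, (i < m)%N -> (p * r)`_i = 0) ->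
  r`_0 != 0 -> (p * r)`_m = p`_m * r`_0.
Proof.
move=> h r0; have pz i : (i < m)%N -> p`_i = 0.
  elim/ltn_ind: i => i IH im; have := h i im; rewrite coefM big_ord_recr /= subnn big1 ?add0r.
    by move/eqP; rewrite mulf_eq0 (negbTE r0) orbF => /eqP.
  by move=> j _; rewrite IH ?mul0r // (ltn_trans (ltn_ord j)).
rewrite coefM big_ord_recr /= subnn big1 ?add0r // => j _.
by rewrite pz ?mul0r.
Qed.

Lemma roots_prod_factor (R : idomainType) (p : {poly R}) (cs : seq R) : uniq cs ->
  (forall c, c \in cs -> p.[c] = 0) -> exists q, p = q * \prod_(c <- cs) ('X - c%:P).
Proof.
elim: cs p => [|c cs IH] p; first by exists p; rewrite big_nil mulr1.
rewrite [uniq _]/= => /andP[nc ucs] h.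
have /factor_theorem[q e] : root p c by apply/rootP/h; rewrite mem_head.
have [|r er] := IH q ucs; last by exists r; rewrite big_cons e er mulrAC -mulrA.
move=> b hb; have := h b; rewrite inE hb orbT => /(_ isT); rewrite e hornerM hornerXsubC.
move/eqP; rewrite mulf_eq0 subr_eq0 => /orP[/eqP //|/eqP bc].
by rewrite -bc hb in nc.
Qed.

(** * Elimination by projection from a point of a line *)

Section Support.
Variable K : closedFieldType.

Lemma support_off_line d (g : {mpoly K[4]}) mo : g \is d.-homog ->
  mev polyC (pline (delta_mx 0 o0) (delta_mx 0 o3)) g = 0 -> mo \in msupp g ->
  (0 < mo o1 + mo o2)%N.
Proof.
move=> hg e hmo; rewrite lt0n; apply/negP; rewrite addn_eq0 => /andP[/eqP m1 /eqP m2].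
have := congr1 (fun p : {poly K} => p`_(mo o3)) e; rewrite coef0 {1}[g]mpolyE rmorph_sum coef_sum /=.
set x := pline _ _.
have xm (m : 'X_{1..4}) : mev polyC x 'X_[m] = 0 ^+ m o1 * 0 ^+ m o2 * 'X^(m o3).
  rewrite mpolyXE_id rmorph_prod /= !big_ord_recr big_ord0 /= !rmorphXn /= !mevX !mxE /=.
  rewrite !(mulr0, mulr1, addr0, add0r, mul1r) expr1n mul1r.
  by congr (_ ^+ m _ * _ ^+ m _ * _ ^+ m _); apply: val_inj.
rewrite (bigD1_seq mo) ?msupp_uniq //= big1_seq ?addr0 => [|m /andP[mmo hm]].
  rewrite mevZ xm m1 m2 !expr0 !mul1r coefCM coefXn eqxx mulr1 => /eqP.
  by rewrite mcoeff_eq0 hmo.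
rewrite mevZ xm; case m1' : (m o1) => [|k]; last by rewrite exprS !mul0r mulr0 coef0.
case m2' : (m o2) => [|k]; last by rewrite exprS mul0r mulr0 mul0r mulr0 coef0.
rewrite !expr0 !mul1r coefCM coefXn; case: eqP => [m3|]; last by rewrite mulr0.
case/eqP: mmo; have deg (a : 'X_{1..4}) : a \in msupp g -> (a o0 + a o1 + a o2 + a o3 = d)%N.
  by move=> ha; rewrite -(dhomogP _ _ _ hg a ha) /= mdegE sum_ord4.
have := deg m hm; have := deg mo hmo; rewrite m1 m2 m1' m2' -m3 => d1 d2.
apply/mnmP; apply: ord4_ind => //; last by rewrite m2'.
  by move: d1 d2; move: (m o0) (mo o0) (mo o3) => a b c; lia.
by rewrite m1'.
Qed.

End Support.

Lemma coef_comp_scaleX (R : comNzRingType) (p : {poly R}) (c : R) i :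
  (p \Po (c *: 'X))`_i = p`_i * c ^+ i.
Proof.
have -> : p \Po (c *: 'X) = \poly_(l < size p) (p`_l * c ^+ l).
  by rewrite comp_polyE poly_def; apply: eq_bigr => l _; rewrite exprZn scalerA.
by rewrite coef_poly; case: ltnP => // h; rewrite nth_default // mul0r.
Qed.

Lemma low_coef_X (R : comNzRingType) (A B D c p : {poly R}) n :
  'X * A + 'X ^+ 2 * B = p -> p = D * 'X^(n.+2) * c -> A`_0 = 0.
Proof.
move=> e1 e2; have := congr1 (fun q : {poly R} => q`_1) (etrans e1 e2).
by rewrite coefD coefXM coefXnM mulrAC coefMXn /= addr0.
Qed.

Lemma sum_delta23 (R : comNzRingType) (a b : R) (h : 'I_4 -> R) :
  \sum_i (a *: delta_mx 0 o2 + b *: delta_mx 0 o3 : 'rV[R]_4) 0 i * h i = a * h o2 + b * h o3.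
Proof. by rewrite sum_ord4 !mxE /= !(mulr0, mulr1, addr0, add0r, mul0r). Qed.

Section Pencil.
Variable K : closedFieldType.
Variables (g G : {mpoly K[4]}) (d e : nat).
Hypothesis pg : prime_elt g.
Hypothesis sg : (1 < size (muni g))%N.
Hypothesis nd : ~ divides g G.
Hypothesis hg : g \is d.-homog.
Hypothesis hG : G \is e.-homog.
Hypothesis d1 : (1 < d)%N.
Hypothesis g03 : mev polyC (pline (delta_mx 0 o0) (delta_mx 0 o3)) g = 0.
Hypothesis G03 : mev polyC (pline (delta_mx 0 o0) (delta_mx 0 o3)) G = 0.

Local Notation S := {poly {poly K}}.
Let cc : {rmorphism K -> S} := @polyCC K.

Definition row3 (a b c : S) : 'rV[S]_3 := \row_i nth 0 [:: a; b; c] i.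

Lemma mev_row3 (T : comNzRingType) (psi : {rmorphism K -> T}) (h : {rmorphism S -> T})
    (Phi : {mpoly K[3]}) (a b c : S) : (forall k, h (cc k) = psi k) ->
  h (mev cc (row3 a b c) Phi) = mev psi (\row_i nth 0 [:: h a; h b; h c] i) Phi.
Proof.
move=> hk; rewrite (mev_morph (psi := psi)) //; congr mev.
by apply/rowP => i; rewrite !mxE; case: i => [[|[|[|]]]].
Qed.

(** The centre [e3] lies on the line [e0 e3], on which both forms vanish, so each of their monomials
    contains [x1] or [x2]. With weight 1 on [x0] and [x3] and 0 on [x1] and [x2], the forms have
    weights at most [d - 1] and [e - 1]. The scale [s] is the coordinate [x1] of a point where [Phi]
    is nonzero; it lets the affine chart reach that point. *)
Lemma pencil_elim : exists (s : K) (Phi : {mpoly K[3]}), [/\ s != 0,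
  mev cc (row3 (cc s * 'X) (cc s) (cc s * 'X%:P)) Phi != 0,
  (size (mev cc (row3 (cc s * 'X) (cc s) (cc s * 'X%:P)) Phi)
     <= (d.-1 * e.-1).+1)%N &
  forall (R : comNzRingType) (phi : {rmorphism K -> R}) (x : 'rV[R]_4), exists a b,
    mev phi (row_init x) Phi = a * mev phi x g + b * mev phi x G].
Proof.
have [Phi [Phi0 hb hs]] := elim_mpoly pg sg nd.
have o1' : 'X_(lift ord0 ord0) != 0 :> {mpoly K[3]}.
  apply/negP => /eqP/(congr1 (ev (delta_mx 0 (lift ord0 ord0)))).
  by rewrite mevX rmorph0 mxE !eqxx => /eqP; rewrite oner_eq0.
have [y hy] := mpoly_nonzero_point (mulf_neq0 Phi0 o1').
move: hy; rewrite rmorphM /= mevX mulf_eq0 negb_or => /andP[hy s0].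
pose s := y 0 (lift ord0 ord0); have {}s0 : s != 0 by []; exists s, Phi; split=> //.
- apply: contraNneq hy => z.
  pose h : {rmorphism S -> K} := horner_eval (y 0 ord_max / s) \o horner_eval (y 0 ord0 / s)%:P.
  have hk k : h (cc k) = idfun k by rewrite /= /horner_eval /cc /= /polyCC !hornerC.
  have := mev_row3 Phi (cc s * 'X) (cc s) (cc s * 'X%:P) hk.
  rewrite z rmorph0 /= /horner_eval /cc /= /polyCC !(hornerM, hornerC, hornerX) => e0.
  apply/eqP; rewrite [RHS]e0; congr (mev _ _ _); apply/esym.
  apply/rowP => i; rewrite mxE; case: i => [[|[|[|]]]] //= hi.
  - by rewrite mulrCA divff // mulr1; congr (y 0 _); apply: val_inj.
  - by congr (y 0 _); apply: val_inj.
  - by rewrite mulrCA divff // mulr1; congr (y 0 _); apply: val_inj.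
pose wt := [ffun i : 'I_3 => nat_of_bool (i == ord0)].
apply: (hs _ cc _ wt).
- by move=> c; apply: size_polyC_leq1.
- move=> i; rewrite mxE ffunE; case: i => [[|[|[|]]]] //= hi; rewrite /cc /= /polyCC -?polyCM ?size_polyC_leq1 //.
  by rewrite mul_polyC; apply: leq_trans (size_scale_leq _ _) _; rewrite size_polyX.
- by rewrite -ltnS (ltn_predK d1).
- move=> mo hmo; have := support_off_line hg g03 hmo.
  have : (mo o0 + mo o1 + mo o2 + mo o3 = d)%N.
    by rewrite -(dhomogP _ _ _ hg mo hmo) /= mdegE sum_ord4.
  rewrite !big_ord_recl big_ord0 /= !ffunE /= !mul0n mul1n !addn0.
  have -> : widen_ord (leqnSn 3) ord0 = o0 by apply: val_inj.
  have -> : ord_max = o3 by apply: val_inj.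
  by move: (mo o0) (mo o1) (mo o2) (mo o3) => *; lia.
- move=> mo hmo; have := support_off_line hG G03 hmo.
  have : (mo o0 + mo o1 + mo o2 + mo o3 = e)%N.
    by rewrite -(dhomogP _ _ _ hG mo hmo) /= mdegE sum_ord4.
  rewrite !big_ord_recl big_ord0 /= !ffunE /= !mul0n mul1n !addn0.
  have -> : widen_ord (leqnSn 3) ord0 = o0 by apply: val_inj.
  have -> : ord_max = o3 by apply: val_inj.
  by move: (mo o0) (mo o1) (mo o2) (mo o3) => *; lia.
Qed.

Section Lines.
Variables (T : eqType) (ls : seq T) (al be ga de : T -> K).
(** A line skew to [e0 e3] is a graph over the coordinates [x1, x2]; [vrow] and [wrow] are its
    points over [(1, 0)] and [(0, 1)]. *)
Definition vrow A : 'rV[K]_4 := \row_i nth 0 [:: al A; 1; 0; ga A] i.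
Definition wrow A : 'rV[K]_4 := \row_i nth 0 [:: be A; 0; 1; de A] i.
Hypothesis uls : uniq ls.
Hypothesis inj : {in ls &, injective (fun A => (al A, be A))}.
Hypothesis gls : forall A, A \in ls -> mev polyC (pline (vrow A) (wrow A)) g = 0.
Hypothesis Gls : forall A, A \in ls -> mev polyC (pline (vrow A) (wrow A)) G = 0.

Let g2 := mev polyC (pline (delta_mx 0 o1) (delta_mx 0 o0)) g;;o2.
Let rho := mev polyC (pline (delta_mx 0 o1) (delta_mx 0 o0)) g;;o3.
Let om := rho * mev polyC (pline (delta_mx 0 o1) (delta_mx 0 o0)) G;;o2
  - g2 * mev polyC (pline (delta_mx 0 o1) (delta_mx 0 o0)) G;;o3.

(** In the chart [x1 = 1] a line projects to [x0 = al + be * x2], and on [x2 = 0] it contributes the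
    factor ['X - al]. If [e0 e1] lies on both surfaces, a formal branch of [g = 0] leaving it
    transversally has [G] with leading coefficient [rho * om], so [om] divides [theta] up to a power
    of [rho]. *)
Lemma pencil_core : exists theta : {poly K}, [/\ theta != 0, (size theta <= (d.-1 * e.-1).+1)%N,
  \prod_(A <- ls) ('X - (al A)%:P) %| theta &
  mev polyC (pline (delta_mx 0 o1) (delta_mx 0 o0)) g = 0 ->
  mev polyC (pline (delta_mx 0 o1) (delta_mx 0 o0)) G = 0 -> rho != 0 -> om != 0 ->
  exists m b, rho ^+ m * theta = om * b].
Proof.
have [s [Phi [s0 F0 sF hb]]] := pencil_elim; set F := mev _ _ Phi in F0 sF.
pose F' := swapXY F.
have F'0 : F' != 0 by rewrite swapXY_eq0.
have exmu : exists m, F'`_m != 0.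
  by exists (size F').-1; rewrite -lead_coefE lead_coef_eq0.
(* The eliminant may contain the line [x2 = 0]; [theta] is its restriction to that line after
   division by the highest power of [x2]. *)
have [mu mu0 mumin] := ex_minnP exmu; pose th := F'`_mu.
have lowF i : (i < mu)%N -> F'`_i = 0.
  by move=> im; apply/eqP/negPn/negP => /mumin; rewrite leqNgt im.
exists th; split=> //.
- apply/leq_sizeP => j jN; rewrite /th coef_swapXY.
  have -> : F`_j = 0 by apply: nth_default; exact: leq_trans sF jN.
  by rewrite coef0.
- pose c A : {poly K} := (al A)%:P + 'X * (be A)%:P.
  have rootc A : A \in ls -> F.[c A] = 0.
    move=> hA; rewrite -[LHS]/(horner_eval (c A) F) /F (mev_row3 (psi := polyC)); last first.
      by move=> k; rewrite /= /horner_eval /cc /= /polyCC hornerC.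
    rewrite /= /horner_eval /cc /= /polyCC !(hornerM, hornerC, hornerX).
    have [a [b eb]] := hb _ polyC (s%:P *: pline (vrow A) (wrow A)).
    have -> : \row_i nth 0 [:: s%:P * c A; s%:P; s%:P * 'X] i =
        row_init (s%:P *: pline (vrow A) (wrow A)).
      apply/rowP => i; rewrite !mxE; case: i => [[|[|[|]]]] //= hi;
        by rewrite ?polyC0 ?(mulr0, mulr1, addr0, add0r).
    by rewrite eb (mev_homog _ _ _ hg) (mev_homog _ _ _ hG) gls // Gls // !mulr0 addr0.
  have ucs : uniq (map c ls).
    rewrite map_inj_in_uniq // => A B hA hB eAB; apply: inj => //; congr (_, _).
      by have := congr1 (fun p : {poly K} => p`_0) eAB; rewrite !coef_linear.
    by have := congr1 (fun p : {poly K} => p`_1) eAB; rewrite !coef_linear.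
  have [|q eq] := @roots_prod_factor _ F (map c ls) ucs.
    by move=> r /mapP[A hA ->]; apply: rootc.
  rewrite big_map in eq; pose r : S := \prod_(A <- ls) swapXY ('X - (c A)%:P).
  have eF' : F' = swapXY q * r by rewrite /F' eq rmorphM /= rmorph_prod.
  have r0 : r`_0 = \prod_(A <- ls) ('X - (al A)%:P).
    rewrite -horner_coef0 /r horner_prod; apply: eq_bigr => A _.
    rewrite rmorphB /= swapXY_X swapXY_polyC hornerD hornerN hornerC.
    by rewrite horner_coef0 coef_map /= coef_linear.
  have r0n : r`_0 != 0.
    by rewrite r0 -(big_map al xpredT (fun a => 'X - a%:P)) monic_neq0 // monic_prod_XsubC.
  have := @low_coef_mul _ (swapXY q) r mu; rewrite -eF' => h.
  by rewrite /th (h lowF r0n) r0 dvdp_mulIr.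
move=> g0 G0 rho0 om0.
pose x0 : 'rV[S]_4 := map_mx polyC (pline (delta_mx 0 o1) (delta_mx 0 o0)).
have mx0 p : mev cc x0 p = (mev polyC (pline (delta_mx 0 o1) (delta_mx 0 o0)) p)%:P.
  by rewrite (mev_morph (psi := cc)).
have gx0 : mev cc x0 g = 0 by rewrite mx0 g0.
(* At this precision the error has order [mu + 2] and does not affect the coefficients up to
   [mu]. *)
have [z [c ec]] := hensel_branch 'X gx0 (mx0 g;;o3) mu.+1; rewrite -/rho in ec.
set w : 'rV[S]_4 := rho%:P ^+ 2 *: delta_mx 0 o2 + (rho%:P * z) *: delta_mx 0 o3.
set X := x0 + branch rho%:P 'X z in ec.
have eX : X = x0 + 'X *: w by [].
have sumw p : \sum_i w 0 i * mev cc x0 p;;i =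
    rho%:P ^+ 2 * mev cc x0 p;;o2 + rho%:P * z * mev cc x0 p;;o3.
  exact: (sum_delta23 _ _ (fun i => mev cc x0 p;;i)).
have [rg eg] := taylor2 cc x0 w 'X g.
have [rG eG] := taylor2 cc x0 w 'X G.
rewrite -eX sumw mx0 g0 add0r !mx0 -/g2 -/rho in eg.
rewrite -eX sumw mx0 G0 add0r !mx0 in eG.
have z0 : z`_0 = - g2.
  have := low_coef_X (esym eg) ec; rewrite coefD !coef0M !coefC /= => h.
  have : rho ^+ 2 * (g2 + z`_0) = 0 by rewrite -[RHS]h; ring.
  move/eqP; rewrite mulf_eq0 expf_eq0 (negbTE rho0) /= addr_eq0 => /eqP ->.
  by rewrite opprK.
set G2 := mev polyC _ G;;o2 in eG *; set G3 := mev polyC _ G;;o3 in eG *.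
pose H := rho%:P ^+ 2 * G2%:P + rho%:P * z * G3%:P + 'X * rG.
have eH : mev cc X G = 'X * H by rewrite eG /H; ring.
have H0 : H`_0 = rho * om.
  rewrite /H !coefD coefXM !coef0M !coefC /= z0 /om -/G2 -/G3; ring.
have [a [b eb]] := hb _ cc (cc s *: X).
pose TT := F' \Po (rho ^+ 2 *: 'X).
have eF' : F' = mev cc (row3 (cc s * 'X%:P) (cc s) (cc s * 'X)) Phi.
  have hk k : swapXY (cc k) = cc k by rewrite /cc /= /polyCC swapXY_polyC map_polyC.
  rewrite /F' /F (mev_row3 _ _ _ _ hk) !rmorphM /= swapXY_X swapXY_Y !hk //.
have eTT : TT = mev cc (row_init (cc s *: X)) Phi.
  have hk k : comp_poly (rho ^+ 2 *: 'X) (cc k) = cc k by rewrite /cc /= /polyCC comp_polyC.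
  rewrite /TT eF' -[LHS]/(comp_poly _ _) (mev_row3 _ _ _ _ hk) !rmorphM /= !hk comp_polyX comp_polyC.
  congr mev; apply/rowP => i; rewrite !mxE; case: i => [[|[|[|]]]] //= hi.
  - by rewrite ?mxE /= ?polyC0 ?(mulr0, mulr1, addr0, add0r).
  - by rewrite ?mxE /= ?polyC0 ?(mulr0, mulr1, addr0, add0r).
  - rewrite ?mxE /= ?polyC0 ?(mulr0, mulr1, addr0, add0r); congr (_ * _).
    by rewrite -mul_polyC rmorphXn mulrC.
rewrite -eTT (mev_homog _ _ _ hg) (mev_homog _ _ _ hG) ec eH in eb.
pose p := b * cc s ^+ e * 'X.
have epH : p * H = TT - a * cc s ^+ d * rho%:P ^+ 2 * c * 'X^(mu.+2).
  by rewrite eb /p; move: 'X^(mu.+2) => *; ring.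
have cTT i : (i <= mu)%N -> (p * H)`_i = F'`_i * rho ^+ 2 ^+ i.
  move=> im; rewrite epH coefB coefMXn ltnS (leq_trans im (leqnSn _)) subr0.
  by rewrite /TT coef_comp_scaleX.
have H0n : H`_0 != 0 by rewrite H0 mulf_neq0.
have := @low_coef_mul _ p H mu => h.
have {}h : (p * H)`_mu = p`_mu * H`_0.
  by apply: h => // i im; rewrite cTT ?lowF ?mul0r // ltnW.
exists (2 * mu)%N, (p`_mu * rho); rewrite exprM mulrC -/th.
by rewrite -[LHS](cTT mu (leqnn _)) h H0; ring.
Qed.

End Lines.
End Pencil.

Lemma coprimep_prod_XsubC (F : fieldType) (xs : seq F) (p : {poly F}) :
  (forall x, x \in xs -> p.[x] != 0) -> coprimep (\prod_(x <- xs) ('X - x%:P)) p.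
Proof.
elim: xs => [|x xs IH] h; first by rewrite big_nil coprime1p.
rewrite big_cons coprimepMl IH ?andbT => [|y hy]; last by apply: h; rewrite inE hy orbT.
by rewrite coprimep_sym coprimep_XsubC; apply: h; rewrite mem_head.
Qed.

Lemma avoid_seq (K : closedFieldType) (bs : seq K) : exists s, s \notin bs.
Proof.
have /closed_nonrootP[s] : \prod_(b <- bs) ('X - b%:P) != 0.
  by rewrite monic_neq0 // monic_prod_XsubC.
by rewrite root_prod_XsubC => h; exists s.
Qed.

Section PencilLines.
Variable K : closedFieldType.
Implicit Types (p q u v w : 'rV[K]_4) (A B L : 'M[K]_4).
Variables (f : {mpoly K[4]}) (d : nat).
Hypothesis gf : good d f.

Variables (L1 : 'M[K]_4) (e0 e1 e2 e3 : 'rV[K]_4) (ls : seq 'M[K]_4) (xs : seq K).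
Hypothesis lL1 : lineX f L1.
Hypothesis U : frame e0 e1 e2 e3 \in unitmx.
Hypothesis e0L : (e0 <= L1)%MS.
Hypothesis e3L : (e3 <= L1)%MS.
Hypothesis uls : uniq ls.
Hypothesis hls : forall A, A \in ls -> lineX f A /\ ~~ meet A L1.

Lemma e0_e3 : e0 != 0 /\ ~~ (e3 <= e0)%MS.
Proof.
split.
  apply/negP => /eqP h; have [] := @frame_indep _ _ _ _ _ 1 0 0 0 U.
    by rewrite h !scale0r scaler0 !addr0.
  by move/eqP; rewrite oner_eq0.
apply/negP => /sub_rVP[c h]; have [] := @frame_indep _ _ _ _ _ c 0 0 (-1) U.
  by rewrite h !scale0r !addr0 scaleN1r subrr.
by move=> _ _ _ /eqP; rewrite oppr_eq0 oner_eq0.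
Qed.

Lemma line_param A w : A \in ls -> exists a c, ((a *: e0 + w + c *: e3)%R <= A)%MS.
Proof.
move=> /hls[[rA _ _] nm]; have [rL _ _] := lL1; have [e00 e30] := e0_e3.
have : (w <= A + L1)%MS.
  apply: submx_full; rewrite /row_full; have := mxrank_sum_cap A L1.
  by move: nm; rewrite /meet negbK -mxrank_eq0 => /eqP ->; rewrite rA rL addn0 => ->.
case/sub_addsmxP => -[a b] /= ew.
have [s [t est]] := line_coord rL e0L e3L e00 e30 (submxMl b L1).
exists (- s), (- t); have -> : - s *: e0 + w + - t *: e3 = a *m A.
  by rewrite ew est; apply/rowP => i; rewrite !mxE; ring.
exact: submxMl.
Qed.

Let om := mev polyC (pline e1 e0) (omega f e2 e3).
Hypothesis hxs : xs = [::] \/ [/\ mev polyC (pline e1 e0) f = 0, mev polyC (pline e1 e0) (flec f) = 0,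
   om != 0, \prod_(x <- xs) ('X - x%:P) %| om &
   (forall x, x \in xs -> ev (e1 + x *: e0) (dd e3 f) != 0) /\
   forall A a c, A \in ls -> ((a *: e0 + e1 + c *: e3)%R <= A)%MS -> c != 0].

(** Both the projected lines and the zeros [xs] of [om] are roots of [theta]. Replacing the centre
    [e3] by [e3 + sg *: e0] keeps it on [L1]; for general [sg] the projected lines are distinct and
    the two sets of roots are disjoint. *)
Lemma pencil_lines : ~ divides f (flec f) -> (size ls + size xs <= d.-1 * (11 * d - 25))%N.
Proof.
move=> nd; have [e00 e30] := e0_e3; have [hf _ d3 _] := gf; have hF := flec_degree gf.
have [al hal] := @seq_choice _ K 0 (fun A a => exists c, ((a *: e0 + e1 + c *: e3)%R <= A)%MS) ls
  (fun A hA => line_param e1 hA).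
have [ga hga] := @seq_choice _ K 0 (fun A c => ((al A *: e0 + e1 + c *: e3)%R <= A)%MS) ls hal.
have [be hbe] := @seq_choice _ K 0 (fun A a => exists c, ((a *: e0 + e2 + c *: e3)%R <= A)%MS) ls
  (fun A hA => line_param e2 hA).
have [de hde] := @seq_choice _ K 0 (fun A c => ((be A *: e0 + e2 + c *: e3)%R <= A)%MS) ls hbe.
(* Values of [sg] to avoid: [b1] and [b2] could identify the images of two lines, [b3] could place
   an image over a point of [xs]. A zero denominator only adds the value [0]. *)
pose b1 := [seq (al A - al B) / (ga A - ga B) | A <- ls, B <- ls].
pose b2 := [seq (be A - be B) / (de A - de B) | A <- ls, B <- ls].
pose b3 := [seq (al A - x) / ga A | A <- ls, x <- xs].
have [sg hsg] := avoid_seq (b1 ++ b2 ++ b3).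
move: hsg; rewrite !mem_cat !negb_or => /and3P[sg1 sg2 sg3].
pose al' A := al A - sg * ga A; pose be' A := be A - sg * de A.
have two (a b c e : K) : a - sg * c = b - sg * e -> sg != (a - b) / (c - e) -> c = e /\ a = b.
  move=> h ns; have [ce|ce] := eqVneq c e; first by split=> //; apply: (addIr (- (sg * c))); rewrite {2}ce.
  case/eqP: ns; apply: (mulIf (x := c - e)); rewrite ?subr_eq0 // mulfVK ?subr_eq0 //.
  apply/eqP; rewrite -subr_eq0; apply/eqP.
  by transitivity (b - sg * e - (a - sg * c)); [ring|rewrite h subrr].
have inj : {in ls &, injective (fun A => (al' A, be' A))}.
  move=> A B hA hB [ea eb].
  have n1 : sg != (al A - al B) / (ga A - ga B).
    by apply: contraNneq sg1 => ->; apply: (allpairs_f (fun A B => (al A - al B) / (ga A - ga B))).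
  have n2 : sg != (be A - be B) / (de A - de B).
    by apply: contraNneq sg2 => ->; apply: (allpairs_f (fun A B => (be A - be B) / (de A - de B))).
  have [cg ca] := two _ _ _ _ ea n1; have [cd cb] := two _ _ _ _ eb n2.
  have h1A := hga A hA; have h1B := hga B hB; have h2A := hde A hA; have h2B := hde B hB.
  rewrite -ca -cg in h1B; rewrite -cb -cd in h2B.
  have [lA _] := hls hA; have [lB _] := hls hB.
  apply: (line_eq lA lB _ _ h1A h2A h1B h2B).
    apply/negP => /eqP h; have [] := @frame_indep _ _ _ _ _ (al A) 1 0 (ga A) U.
      by rewrite scale1r scale0r addr0.
    by move=> _ /eqP; rewrite oner_eq0.
  apply/negP => /sub_rVP[c h]; have [] := @frame_indep _ _ _ _ _ (be A - c * al A) (- c) 1 (de A - c * ga A) U.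
    transitivity (be A *: e0 + e2 + de A *: e3 - c *: (al A *: e0 + e1 + ga A *: e3)).
      by apply/rowP => i; rewrite !mxE; ring.
    by rewrite h subrr.
  by move=> _ _ /eqP; rewrite oner_eq0.
pose e3' := e3 + sg *: e0; pose P := frame e0 e1 e2 e3'.
have U' : P \in unitmx.
  apply: frame_unit_indep => c0 c1 c2 c3 h.
  have h' : (c0 + c3 * sg) *: e0 + c1 *: e1 + c2 *: e2 + c3 *: e3 = 0.
    by rewrite -[RHS]h /e3'; apply/rowP => i; rewrite !mxE; ring.
  have [c00 c10 c20 c30] := frame_indep U h'; split=> //.
  by rewrite c30 mul0r addr0 in c00.
have e3'L : (e3' <= L1)%MS by rewrite /e3' -[e3]scale1r pair_sub.
have gg := good_msub gf U'; have [pg sg'] := good_prime gg.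
have nd' : ~ divides (msub P f) (msub P (flec f)).
  by move=> /(divides_msub (invmx P)); rewrite !msubM mulVmx // !msub1.
have mP g x y : mev polyC (pline x y) (msub P g) = mev polyC (pline (x *m P) (y *m P)) g.
  by rewrite mev_msub pline_mul.
have rowP' i : delta_mx 0 i *m P = nth 0 [:: e0; e1; e2; e3'] i by rewrite -rowE rowK.
have flecL A x y : lineX f A -> (x <= A)%MS -> (y <= A)%MS -> mev polyC (pline x y) (flec f) = 0.
  move=> lA xA yA; apply: line_poly0 => t; apply: (flec_line gf lA).
  by apply: addmx_sub => //; apply: scalemx_sub.
have vP A : vrow al' ga A *m P = al A *: e0 + e1 + ga A *: e3.
  by rewrite frame_row !mxE /= /al' /e3'; apply/rowP => i; rewrite !mxE; ring.
have wP A : wrow be' de A *m P = be A *: e0 + e2 + de A *: e3.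
  by rewrite frame_row !mxE /= /be' /e3'; apply/rowP => i; rewrite !mxE; ring.
have [|||||th [th0 sth dvA hth]] := @pencil_core K (msub P f) (msub P (flec f)) d (11 * d - 24)
  pg sg' nd' (msub_homog P hf) (msub_homog P hF) _ _ _ _ ls al' be' ga de uls inj.
- exact: ltnW.
- by rewrite mP !rowP' (line_pline lL1).
- by rewrite mP !rowP' (flecL L1).
- by move=> A hA; have [lA _] := hls hA; rewrite mP vP wP (line_pline lA) ?hga ?hde.
- by move=> A hA; have [lA _] := hls hA; rewrite mP vP wP (flecL A) ?hga ?hde.
have e25 : ((11 * d - 24).-1 = 11 * d - 25)%N by clear -d3; lia.
rewrite e25 in sth.
pose D2 := \prod_(A <- ls) ('X - (al' A)%:P); pose D1 := \prod_(x <- xs) ('X - x%:P).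
have sD2 : size D2 = (size ls).+1.
  by rewrite /D2 -(big_map al' xpredT (fun a => 'X - a%:P)) size_prod_XsubC size_map.
have sD1 : size D1 = (size xs).+1 by rewrite size_prod_XsubC.
suff dv : D2 * D1 %| th.
  have := dvdp_leq th0 dv; rewrite size_mul -?size_poly_gt0 ?sD1 ?sD2 //.
  by rewrite addnS /= addSn => h; rewrite -ltnS; apply: leq_trans h sth.
case: hxs => [x0|[fL FL om0 dvx [gx cx]]]; first by rewrite /D1 x0 big_nil mulr1.
have cop : coprimep D1 D2.
  apply: coprimep_prod_XsubC => x hx; rewrite /D2 horner_prod prodf_seq_neq0.
  apply/allP => A hA /=; rewrite hornerXsubC subr_eq0; apply: contraNneq sg3 => ex.
  suff -> : sg = (al A - x) / ga A by apply: (allpairs_f (fun A x => (al A - x) / ga A)).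
  have g0 := cx A _ _ hA (hga A hA); apply: (mulIf g0); rewrite mulfVK // ex /al'; ring.
rewrite Gauss_dvdp 1?coprimep_sym // dvA /=.
have dE (w : 'I_4) : mev polyC (pline (delta_mx 0 o1) (delta_mx 0 o0)) (msub P f);;w =
    mev polyC (pline e1 e0) (dd (nth 0 [:: e0; e1; e2; e3'] w) f).
  by rewrite mderiv_frame mP !rowP'.
have dF (w : 'I_4) : mev polyC (pline (delta_mx 0 o1) (delta_mx 0 o0)) (msub P (flec f));;w =
    mev polyC (pline e1 e0) (dd (nth 0 [:: e0; e1; e2; e3'] w) (flec f)).
  by rewrite mderiv_frame mP !rowP'.
have z0 : mev polyC (pline e1 e0) (dd e0 f) = 0 by rewrite -deriv_line fL deriv0.
have zF : mev polyC (pline e1 e0) (dd e0 (flec f)) = 0 by rewrite -deriv_line FL deriv0.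
have d3E g : mev polyC (pline e1 e0) (dd e0 g) = 0 ->
    mev polyC (pline e1 e0) (dd e3' g) = mev polyC (pline e1 e0) (dd e3 g).
  by move=> h; rewrite /e3' ddDl ddZl rmorphD /= mevZ h mulr0 addr0.
have p1 : mev polyC (pline (delta_mx 0 o1) (delta_mx 0 o0)) (msub P f) = 0 by rewrite mP !rowP'.
have p2 : mev polyC (pline (delta_mx 0 o1) (delta_mx 0 o0)) (msub P (flec f)) = 0 by rewrite mP !rowP'.
pose rho := mev polyC (pline e1 e0) (dd e3 f).
have {}hth : rho != 0 -> om != 0 -> exists m b, rho ^+ m * th = om * b.
  have q3 := etrans (dE o3) (d3E _ z0); have q2 := dE o2.
  have r3 := etrans (dF o3) (d3E _ zF); have r2 := dF o2.
  have eom : rho * mev polyC (pline e1 e0) (dd e2 (flec f)) -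
     mev polyC (pline e1 e0) (dd e2 f) * mev polyC (pline e1 e0) (dd e3 (flec f)) = om.
    by rewrite /om /omega rmorphB !rmorphM.
  have transport (r r' a a' b b' c c' : {poly K}) : r = r' -> a = a' -> b = b' -> c = c' ->
      r' * a' - b' * c' = om -> r' = rho ->
      (r != 0 -> r * a - b * c != 0 -> exists m b0, r ^+ m * th = (r * a - b * c) * b0) ->
      rho != 0 -> om != 0 -> exists m b, rho ^+ m * th = om * b.
    by move=> -> -> -> -> -> ->.
  have hq := transport _ _ _ _ _ _ _ _ q3 r2 q2 r3.
  have hq2 := hq eom.
  have hq3 := hq2 (erefl _).
  have ht := hth p1 p2.
  exact: (hq3 ht).
have [x0|[x1 hx1]] : xs = [::] \/ exists x, x \in xs.
- by case: (xs) => [|x s]; [left|right; exists x; rewrite mem_head].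
- by rewrite /D1 x0 big_nil dvd1p.
have gx' x : x \in xs -> rho.[x] != 0 by move=> hx; rewrite /rho horner_mev horner_pline gx.
have rho0 : rho != 0 by apply: contraNneq (gx' x1 hx1) => ->; rewrite horner0.
have [m [b eb]] := hth rho0 om0.
have : D1 %| rho ^+ m * th by rewrite eb dvdp_mulr.
rewrite Gauss_dvdpr //; apply: coprimep_prod_XsubC => x hx.
by rewrite horner_exp expf_neq0 // gx'.
Qed.

End PencilLines.

Lemma count_split (T : Type) (b a : pred T) (s : seq T) :
  count a s = (count (fun x => a x && b x) s + count (fun x => a x && ~~ b x) s)%N.
Proof. by elim: s => //= x s ->; case: (a x) (b x) => [] [] /=; lia. Qed.

Lemma pred_sum_leq a b c n : (a.-1 = b + c)%N -> (a <= n.+1)%N -> (b <= n)%N.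
Proof. by lia. Qed.

(** * Neighbours of a simple line *)

Section Counting.
Variable K : closedFieldType.
Implicit Types (p q u v w : 'rV[K]_4) (A B L : 'M[K]_4).
Variables (f : {mpoly K[4]}) (d : nat).
Hypothesis gf : good d f.

Lemma flec_not_divides_line L : lineX f L -> ~ divides f (flec f).
Proof.
move=> lL; have [rL _ _] := lL; have [p [q [p0 qp pL qL]]] := pick_pair rL.
exact: (flec_not_divides gf p0 qp (line_pline lL pL qL)).
Qed.

Lemma frame_perm (v0 v1 v2 v3 : 'rV[K]_4) :
  frame v0 v3 v1 v2 \in unitmx -> frame v0 v1 v2 v3 \in unitmx.
Proof.
move=> U; apply: frame_unit_indep => c0 c1 c2 c3 h.
have h' : c0 *: v0 + c3 *: v3 + c1 *: v1 + c2 *: v2 = 0.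
  by rewrite -[RHS]h; apply/rowP => i; rewrite !mxE; ring.
by have [] := frame_indep U h'.
Qed.

Lemma skew_lines_bound L1 (ls : seq 'M[K]_4) : lineX f L1 -> uniq ls ->
  (forall A, A \in ls -> lineX f A /\ ~~ meet A L1) -> (size ls <= d.-1 * (11 * d - 25))%N.
Proof.
move=> lL uls hls; have [rL _ _] := lL; have [e0 [e3 [e00 e30 e0L e3L]]] := pick_pair rL.
have [e1 [e2 [U _]]] := @pick_frame K e0 e3 [::] e00 e30 isT.
have := @pencil_lines K f d gf L1 e0 e1 e2 e3 ls [::] lL (frame_perm U) e0L e3L uls hls
  (or_introl erefl) (flec_not_divides_line lL).
by rewrite addn0.
Qed.

(** The change of coordinate on the line that puts [p + ya *: q] at infinity: a root [r] moves to
    the inverse of [r - ya], and [r = ya] disappears to infinity. *)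
Lemma line_factor_rev N (W : 'rV[K]_4 -> K) (Z : {poly K}) p q (ya c : K) (rs : seq K) :
  (forall (t : K) x, W (t *: x) = t ^+ N * W x) -> size rs = N ->
  (forall x, Z.[x] = W (q + x *: (p + ya *: q))) ->
  (forall y, W (p + y *: q) = c * \prod_(r <- rs) (y - r)) ->
  Z = c *: \prod_(r <- rs) (1 + (ya - r) *: 'X).
Proof.
move=> hW sN hZ hc; apply/eqP; rewrite -subr_eq0 -[_ == _]orFb -(polyX_eq0 K) -mulf_eq0; apply/eqP.
apply: natr_tail_eq => x; rewrite hornerM hornerX; have [->|x0] := eqVneq x 0; first by rewrite mul0r.
rewrite hornerD hornerN hornerZ horner_prod hZ.
have -> : q + x *: (p + ya *: q) = x *: (p + (ya + x^-1) *: q).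
  by apply/rowP => i; rewrite !mxE; field.
rewrite hW hc -sN mulrCA -mulrBr.
have -> : x ^+ size rs * \prod_(r <- rs) (ya + x^-1 - r) = \prod_(r <- rs) (1 + (ya - r) *: 'X).[x].
  elim: (rs) => [|r s IH]; first by rewrite !big_nil expr0 mul1r.
  have h1 : (1 + (ya - r) *: 'X).[x] = 1 + (ya - r) * x by rewrite !hornerE.
  rewrite !big_cons -IH h1 /= exprS; move: (\prod_(j <- s) _) (x ^+ _) => P X.
  by field.
by rewrite subrr !mulr0.
Qed.

Lemma linear_factor (ya r : K) : r != ya -> 1 + (ya - r) *: 'X = (ya - r) *: ('X - ((r - ya)^-1)%:P).
Proof.
move=> h; have h' : r - ya != 0 by rewrite subr_eq0.
have e : (ya - r) *: ((r - ya)^-1)%:P = -1 :> {poly K}.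
  by rewrite -mul_polyC -polyCM -opprB mulNr divff // polyCN.
by rewrite scalerBr e opprK addrC.
Qed.

Section Neighbours.
Variables (L : 'M[K]_4) (p q u v : 'rV[K]_4) (all nb : seq 'M[K]_4) (Y : 'M[K]_4 -> K) (rs rest : seq K).
Hypothesis lL : lineX f L.
Hypothesis U : frame p q u v \in unitmx.
Hypothesis pL : (p <= L)%MS.
Hypothesis qL : (q <= L)%MS.
Hypothesis uall : uniq all.
Hypothesis hall : forall A, A \in all -> lineX f A.
Hypothesis nbE : nb = [seq A <- all | (A != L) && meet A L].
Hypothesis hY : forall A, A \in nb -> ((p + Y A *: q)%R <= A)%MS.
Variable c : K.
Hypothesis c0 : c != 0.
Hypothesis eO : mev polyC (pline p q) (omega f u v) = c *: \prod_(r <- rs) ('X - r%:P).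
Hypothesis prs : perm_eq rs (map Y nb ++ rest).
Hypothesis srs : size rs = (12 * d - 26)%N.

Lemma pq_indep : p != 0 /\ ~~ (q <= p)%MS.
Proof.
split.
  apply/negP => /eqP h; have [] := @frame_indep _ _ _ _ _ 1 0 0 0 U.
    by rewrite h !scale0r scaler0 !addr0.
  by move/eqP; rewrite oner_eq0.
apply/negP => /sub_rVP[a h]; have [] := @frame_indep _ _ _ _ _ a (-1) 0 0 U.
  by rewrite h !scale0r !addr0 scaleN1r subrr.
by move=> _ /eqP; rewrite oppr_eq0 oner_eq0.
Qed.

Lemma shift_sub y A : (p <= A)%MS -> (q <= A)%MS -> ((p + y *: q)%R <= A)%MS.
Proof. by move=> pA qA; rewrite -[p]scale1r pair_sub. Qed.

Lemma plane_frame y (e3 : 'rV[K]_4) : ~~ (e3 <= L)%MS ->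
  exists e2, frame (p + y *: q) q e2 e3 \in unitmx.
Proof.
move=> e3L; have [p0 qp] := pq_indep; have P0 := shift_indep y p0 qp.
have qP : ~~ (q <= (p + y *: q)%R)%MS.
  apply/negP => /sub_rVP[a h]; have [] := lin_dep_pair (s := - a) (t := 1 - a * y) p0 qp.
    transitivity (q - a *: (p + y *: q)); last by rewrite -h subrr.
    by apply/rowP => i; rewrite !mxE; ring.
  by move/eqP; rewrite oppr_eq0 => /eqP ->; rewrite mul0r subr0 => /eqP; rewrite oner_eq0.
have e3' : ~~ (e3 <= q + (p + y *: q)%R)%MS.
  by apply: contra e3L => h; apply: submx_trans h _; rewrite addsmx_sub qL shift_sub.
have [|e2] := @pick_outside K 4 [:: (e3 + (q + (p + y *: q)%R))%MS]; first by rewrite /= rank3.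
rewrite /= andbT => h2; exists e2; have V := frame_unit_fwd P0 qP e3' h2.
apply: frame_unit_indep => a0 a1 a2 a3 h.
have h' : a0 *: (p + y *: q) + a1 *: q + a3 *: e3 + a2 *: e2 = 0.
  by rewrite -[RHS]h; apply/rowP => i; rewrite !mxE; ring.
by have [] := frame_indep V h'.
Qed.

Lemma nb_lines A : A \in nb -> [/\ lineX f A, A <> L & meet A L].
Proof. by rewrite nbE mem_filter => /andP[/andP[/eqP AL m] /hall]. Qed.

(* The tangent plane at the point is then spanned by [L] and [e3], so it contains both [A] and [B]. *)
Lemma special_coplanar A B y (e3 : 'rV[K]_4) : lineX f A -> ((p + y *: q)%R <= A)%MS ->
  lineX f B -> (e3 <= B)%MS -> ~~ (e3 <= L)%MS -> meet B L -> ev (p + y *: q) (dd e3 f) = 0 -> meet A B.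
Proof.
move=> lA PA lB e3B e3L mB g3; have [e2 V] := plane_frame y e3L.
have [rA _ _] := lA; have [rB _ _] := lB; have [_ sf _ _] := gf; have [_ _ hL] := lL.
have PL : ((p + y *: q)%R <= L)%MS by apply: shift_sub.
have [p0 qp] := pq_indep; have P0 := shift_indep y p0 qp.
have g2 : ev (p + y *: q) (dd e2 f) != 0.
  apply/negP => /eqP g2; apply: (smooth_frame sf V P0 (hL _ PL)) => //.
    exact: (line_tangent lL).
  exact: (line_tangent lL).
pose M := (e3 + (q + (p + y *: q)%R))%MS.
have LM : (L <= M)%MS.
  have [rL _ _] := lL; apply: submx_trans (addsmxSr e3 _).
  apply: span_line => //; apply/negP => /sub_rVP[a h].
  have [] := @frame_indep _ _ _ _ _ a (-1) 0 0 V; first by rewrite -h !scale0r !addr0 scaleN1r subrr.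
  by move=> _ /eqP; rewrite oppr_eq0 oner_eq0.
have AM : (A <= M)%MS.
  apply/row_subP => i; set w := row i A; have wA : (w <= A)%MS by apply: row_sub.
  have [a0 [a1 [a2 [a3 ew]]]] := frame_decomp w V.
  have := line_tangent lA PA wA; rewrite ew ev_dd4 (line_tangent lL PL PL) (line_tangent lL PL qL) g3.
  rewrite !mulr0 !add0r addr0 => /eqP; rewrite mulf_eq0 (negbTE g2) orbF => /eqP ->.
  rewrite scale0r addr0 addrC [X in _ + X]addrC; apply: addmx_sub_adds; first exact: scalemx_sub.
  by apply: addmx_sub_adds; apply: scalemx_sub.
have BM : (B <= M)%MS.
  have [x [x0 xB xL]] := meetP mB.
  apply: submx_trans (span_line rB xB e3B x0 _) _.
    apply/negP => h; case/negP: e3L; exact: submx_trans h xL.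
  by rewrite addsmx_sub addsmxSl (submx_trans xL LM).
apply: rank_meet => //; apply: leq_trans (mxrankS (_ : (A + B <= M)%MS)) _; first by rewrite addsmx_sub AM.
by have := rank3 e3 q (p + y *: q).
Qed.

(** For [e3] off [L]: the tangent plane at the point [r] is not the plane spanned by [L] and
    [e3]. *)
Definition nonspecial (e3 : 'rV[K]_4) (r : K) : bool := ev (p + r *: q) (dd e3 f) != 0.

(** [pencil_lines] is applied to [B], with [L] as the line through the point [e0] of [B] and with
    all nonspecial zeros of [omega]. Directly counted are only the lines skew to both [B] and [L];
    those skew to [B] and meeting [L] are represented by their own zeros. *)
Lemma skew_excess B (e3 : 'rV[K]_4) : B \in nb -> (e3 <= B)%MS -> ~~ (e3 <= L)%MS ->
  (size [seq A <- all | ~~ meet A B] + count (nonspecial e3) rest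
     <= d.-1 * (11 * d - 25))%N.
Proof.
move=> hB e3B e3L; have [lB BL mBL] := nb_lines hB; set ns := nonspecial e3.
have [p0 qp] := pq_indep; set ya := Y B; have PB := hY hB; rewrite -/ya in PB.
have [e2 V] := plane_frame ya e3L; set e0 := p + ya *: q in PB V *.
have e0L : (e0 <= L)%MS by apply: shift_sub.
have e00 : e0 != 0 by apply: shift_indep.
have [hf _ d3 _] := gf.
have nsya r : ns r -> r != ya.
  by apply: contraTneq => ->; rewrite /ns /nonspecial -/e0 (line_tangent lB PB e3B) eqxx.
(* The roots in the coordinate [q + x *: e0], where the point on [B] is at infinity; that point is
   special, so no nonspecial root is lost. *)
pose xs := [seq (r - ya)^-1 | r <- rs & ns r].
pose ls := [seq A <- all | ~~ meet A B && ~~ meet A L].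
have hom u' v' := omega_homog u' v' gf.
have hW (t : K) x : ev (t *: x) (omega f u v) = t ^+ (12 * d - 26) * ev x (omega f u v).
  exact: (mev_homog _ _ _ (hom u v)).
have eZ := @line_factor_rev (12 * d - 26) (fun x => ev x (omega f u v))
  (mev polyC (pline q e0) (omega f u v)) p q ya c rs hW srs.
have {}eZ : mev polyC (pline q e0) (omega f u v) = c *: \prod_(r <- rs) (1 + (ya - r) *: 'X).
  apply: eZ => [x|y]; first by rewrite horner_mev horner_pline.
  rewrite -horner_pline -horner_mev eO hornerZ horner_prod; congr (_ * _).
  by apply: eq_bigr => r _; rewrite hornerXsubC.
have Zn : mev polyC (pline q e0) (omega f u v) != 0.
  rewrite eZ scaler_eq0 negb_or c0 prodf_seq_neq0; apply/allP => r _ /=.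
  apply/negP => /eqP/(congr1 (horner^~ 0)); rewrite /= !hornerE ?mulr0 ?addr0 => /eqP.
  by rewrite oner_eq0.
have poly_change u' v' u'' v'' : frame e0 q u'' v'' \in unitmx \/ frame p q u'' v'' \in unitmx ->
    exists a, mev polyC (pline q e0) (omega f u' v') = a *: mev polyC (pline q e0) (omega f u'' v'').
  move=> h; have [a ha] : exists a, forall x, (x <= L)%MS -> ev x (omega f u' v') = a * ev x (omega f u'' v'').
    by case: h => h; apply: (omega_change gf u' v' lL _ qL h).
  exists a; apply: poly_eq_horner => y; rewrite hornerZ !horner_mev !horner_pline ha //.
  by apply: addmx_sub => //; apply: scalemx_sub.
have [a ea] := poly_change e2 e3 u v (or_intror U).
have [b eb] := poly_change u v e2 e3 (or_introl V).
have a0 : a != 0 by apply: contraNneq Zn => a0; rewrite eb ea a0 !scale0r scaler0.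
have dvx : \prod_(x <- xs) ('X - x%:P) %| mev polyC (pline q e0) (omega f e2 e3).
  rewrite ea dvdpZr // eZ dvdpZr // /xs big_map big_filter.
  rewrite [X in _ %| X](bigID ns) /=; apply: dvdp_mulr.
  suff h s : \prod_(r <- s | ns r) ('X - ((r - ya)^-1)%:P) %| \prod_(r <- s | ns r) (1 + (ya - r) *: 'X).
    exact: h.
  elim: s => [|r s IH]; first by rewrite !big_nil dvdpp.
  rewrite !big_cons; case nsr : (ns r) => //; apply: dvdp_mul => //.
  by rewrite linear_factor ?nsya // dvdpZr // subr_eq0 eq_sym nsya.
have hls A : A \in ls -> lineX f A /\ ~~ meet A B.
  by rewrite mem_filter => /andP[/andP[mB _] /hall].
have h : (size ls + size xs <= d.-1 * (11 * d - 25))%N.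
  apply: (@pencil_lines K f d gf B e0 q e2 e3 ls xs lB V PB e3B (filter_uniq _ uall) hls _
    (flec_not_divides_line lL)); right; split=> //.
  - exact: (line_pline lL).
  - apply: line_poly0 => t; apply: (flec_line gf lL).
    by apply: addmx_sub => //; apply: scalemx_sub.
  - by rewrite ea scaler_eq0 negb_or a0.
  split=> [x /mapP[r]|A s t hA hs].
    rewrite mem_filter => /andP[nsr _] ->; have ry := nsya r nsr.
    have ry' : r - ya != 0 by rewrite subr_eq0.
    have -> : q + (r - ya)^-1 *: e0 = (r - ya)^-1 *: (p + r *: q).
      by rewrite /e0; apply/rowP => i; rewrite !mxE; field.
    by rewrite (mev_homog _ _ _ (dd_homog e3 hf)) mulf_neq0 // expf_neq0 // invr_eq0.
  apply/negP => /eqP t0; move: hA; rewrite mem_filter => /andP[/andP[_ /negP mL] _]; apply: mL.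
  rewrite t0 scale0r addr0 in hs; apply: (meetI _ hs); last first.
    by rewrite -[q]scale1r pair_sub.
  apply/negP => /eqP e; have [] := @frame_indep _ _ _ _ _ s 1 0 0 V.
    by rewrite scale1r !scale0r !addr0.
  by move=> _ /eqP; rewrite oner_eq0.
have sxs : size xs = (count ns (map Y nb) + count ns rest)%N.
  by rewrite size_map size_filter (seq.permP prs) count_cat.
rewrite sxs addnA in h; apply: leq_trans h; rewrite leq_add2r.
(* The zero of a neighbour [A] skew to [B] is nonspecial: by [special_coplanar], a special one would
   make [A] meet [B]. *)
rewrite size_filter (count_split (fun A => ~~ meet A L)) [size ls]size_filter leq_add2l.
rewrite count_map -!size_filter; apply: uniq_leq_size; first exact: filter_uniq.
move=> A; rewrite !mem_filter negbK => /andP[/andP[mB mL] hA] /=.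
have lA := hall hA; have AL : A != L by apply: contraNneq mB => ->; rewrite meetC.
have Anb : A \in nb by rewrite nbE mem_filter AL mL.
rewrite Anb andbT; apply/negP => /eqP g3; case/negP: mB.
exact: (special_coplanar lA (hY Anb) lB e3B e3L mBL g3).
Qed.

(** The plane section contains [L] and the lines [As] through one point, so [Gp_vanish] bounds from
    below the order there of the derivative across [L]. *)
Lemma plane_order y (e3 : 'rV[K]_4) (As : seq 'M[K]_4) : ~~ (e3 <= L)%MS -> uniq As ->
  (forall A, A \in As -> [/\ lineX f A, A <> L, ((p + y *: q)%R <= A)%MS & (A <= e3 + (q + p))%MS]) ->
  ('X - y%:P) ^+ size As %| mev polyC (pline p q) (dd e3 f).
Proof.
move=> e3L uAs hAs; have [e2 V] := plane_frame y e3L; set P0 := p + y *: q in V hAs *.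
have PL : (P0 <= L)%MS by apply: shift_sub.
have [p0 qp] := pq_indep; have P00 : P0 != 0 by apply: shift_indep.
have [|g hg] := @seq_choice _ K 0 (fun A a => ((a *: q + e3)%R <= A)%MS) As.
  move=> A /hAs[lA AL PA Apl]; have [rA _ _] := lA; have [w wA wP] := line_basis P0 rA.
  have /sub_addsmxP[[b m] /= ew] := submx_trans wA Apl.
  have [s [t est]] := sub_pair (submxMl m (q + p)%MS).
  have eb : b *m e3 = b 0 0 *: e3 by rewrite [b in LHS]mx11_scalar mul_scalar_mx.
  rewrite est eb in ew; have b0 : b 0 0 != 0.
    apply/negP => /eqP b0; apply: AL; apply: (line_eq lA lL P00 wP) => //.
    by rewrite ew b0 scale0r add0r pair_sub.
  exists ((t - s * y) / b 0 0).
  have -> : ((t - s * y) / b 0 0) *: q + e3 = (b 0 0)^-1 *: w + (- (s / b 0 0)) *: P0.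
    by rewrite ew /P0; apply/rowP => i; rewrite !mxE; field.
  exact: pair_sub.
pose h := msub (frame P0 q e3 e2) f.
have hL : Lp h = 0 by rewrite mev_frame (line_pline lL).
have urs : uniq (map g As).
  rewrite map_inj_in_uniq // => A B hA hB e.
  have [lA _ PA _] := hAs A hA; have [lB _ PB _] := hAs B hB; have ga := hg A hA; have gb := hg B hB.
  rewrite e in ga; apply: (line_eq lA lB P00 _ PA ga PB gb).
  apply/negP => /sub_rVP[a ec]; have [] := @frame_indep _ _ _ _ _ (- a) (g B) 0 1 V.
    transitivity (g B *: q + e3 - a *: P0); last by rewrite ec subrr.
    by apply/rowP => i; rewrite !mxE; ring.
  by move=> _ _ _ /eqP; rewrite oner_eq0.
have hrs a t : a \in map g As ->
    ev (delta_mx 0 o0 + t *: (a *: delta_mx 0 o1 + delta_mx 0 o2)) h = 0.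
  move=> /mapP[A hA ->]; have [[_ _ hA'] _ PA _] := hAs A hA; rewrite ev_msub.
  rewrite mulmxDl -scalemxAl mulmxDl -scalemxAl -!rowE !rowK /=; apply: hA'.
  by rewrite -[P0]scale1r pair_sub // hg.
have [r er] : exists r, Lp h;;o2 = 'X^(size As) * r.
  apply: coef_vanish_dvd => l hl; rewrite Lp_Gp1 (Gp_vanish hL urs hrs) // size_map add1n //.
have eR : Lp h;;o2 = mev polyC (pline p q) (dd e3 f) \Po ('X + y%:P).
  apply: poly_eq_horner => z; rewrite mderiv_frame mev_frame horner_comp !hornerE !horner_mev !horner_pline.
  by congr mev; rewrite /P0; apply/rowP => i; rewrite !mxE; ring.
have e0 : ('X + y%:P) \Po ('X - y%:P) = 'X by rewrite comp_polyD comp_polyX comp_polyC subrK.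
have -> : mev polyC (pline p q) (dd e3 f) = Lp h;;o2 \Po ('X - y%:P).
  by rewrite eR -comp_polyA e0 comp_polyXr.
by rewrite er comp_polyM comp_Xn_poly dvdp_mulr.
Qed.

(** Besides [L], the plane section is a curve of degree [d - 1]; its intersections with [L] are the
    zeros of [dd e3 f], counted with multiplicity. *)
Lemma plane_bound (e3 : 'rV[K]_4) : ~~ (e3 <= L)%MS ->
  (size [seq A <- nb | (A <= e3 + (q + p))%MS] <= d.-1)%N.
Proof.
move=> e3L; set ms := filter _ _; have [p0 qp] := pq_indep; have [hf _ _ _] := gf.
have unb : uniq nb by rewrite nbE filter_uniq.
have [e2 V] := plane_frame 0 e3L; rewrite scale0r addr0 in V.
have V' : frame p q e3 e2 \in unitmx.
  apply: frame_unit_indep => a0 a1 a2 a3 h.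
  have h' : a0 *: p + a1 *: q + a3 *: e2 + a2 *: e3 = 0 by rewrite -[RHS]h addrAC.
  by have [] := frame_indep V h'.
have Rn := line_grad_neq0 gf lL pL qL V'.
have dv y : ('X - y%:P) ^+ count_mem y (map Y ms) %| mev polyC (pline p q) (dd e3 f).
  rewrite count_map -size_filter; apply: plane_order => //; first by rewrite !filter_uniq.
  move=> A; rewrite !mem_filter /= => /andP[/eqP <- /andP[Apl hA]].
  by have [lA AL _] := nb_lines hA; split=> //; apply: hY.
have [rs' [rest' [_ pr' s']]] := root_split Rn dv.
have := perm_size pr'; rewrite size_cat size_map s' => e.
exact: (pred_sum_leq e (size_pline p q (dd_homog e3 hf))).
Qed.

(** If both vectors were tangent at the point, then together with [L] all directions would be,
    against smoothness. *)
Lemma special_disjoint (e3 e3' : 'rV[K]_4) r : ~~ (e3 <= L)%MS -> ~~ (e3' <= e3 + (q + p))%MS ->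
  nonspecial e3 r || nonspecial e3' r.
Proof.
move=> e3L e3P; have [p0 qp] := pq_indep; have [_ sf _ _] := gf; have [_ _ hL] := lL.
rewrite -negb_and; apply/negP => /andP[/eqP g1 /eqP g2].
have e3q : ~~ (e3 <= q + p)%MS.
  by apply: contra e3L => h; apply: submx_trans h _; rewrite addsmx_sub qL.
have V := frame_unit_fwd p0 qp e3q e3P; have PL : ((p + r *: q)%R <= L)%MS by apply: shift_sub.
apply: (smooth_frame sf V (shift_indep r p0 qp) (hL _ PL)) => //; exact: (line_tangent lL).
Qed.

(** Every zero in [rest] is nonspecial for at least one of the two planes, so the two excesses
    together amount to at least [size rest]. *)
Lemma two_planes B B' (e3 e3' : 'rV[K]_4) : B \in nb -> B' \in nb -> (e3 <= B)%MS -> (e3' <= B')%MS ->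
  ~~ (e3 <= L)%MS -> ~~ (e3' <= e3 + (q + p))%MS ->
  (size [seq A <- all | ~~ meet A B] + size [seq A <- all | ~~ meet A B'] + size rest
     <= 2 * (d.-1 * (11 * d - 25)))%N.
Proof.
move=> hB hB' e3B e3B' e3L e3P.
have e3L' : ~~ (e3' <= L)%MS.
  apply: contra e3P => h; have [rL _ _] := lL; have [p0 qp] := pq_indep.
  by apply: submx_trans h _; apply: submx_trans (span_line rL pL qL p0 qp) (addsmxSr _ _).
have h1 := skew_excess hB e3B e3L; have h2 := skew_excess hB' e3B' e3L'.
have h3 : (size rest <= count (nonspecial e3) rest + count (nonspecial e3') rest)%N.
  rewrite -count_predUI; apply: leq_trans (leq_addr _ _); rewrite -(count_predT rest).
  by apply: sub_count => r _ /=; apply: special_disjoint.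
by clear -h1 h2 h3; lia.
Qed.

End Neighbours.
End Counting.

(** * The bound on the number of lines *)

Section Final.
Variable K : closedFieldType.
Implicit Types (A B L : 'M[K]_4).
Variables (f : {mpoly K[4]}) (d : nat) (ls : seq 'M[K]_4).
Hypothesis gf : good d f.
Hypothesis uls : uniq ls.
Hypothesis hls : forall A, A \in ls -> lineX f A.

Definition nbs L := [seq A <- ls | (A != L) && meet A L].
Definition skew L := [seq A <- ls | ~~ meet A L].

Lemma size_lines L : L \in ls -> (size ls <= 1 + size (nbs L) + size (skew L))%N.
Proof.
move=> hL; rewrite /nbs /skew !size_filter -(count_predC (fun A => meet A L) ls) leq_add2r.
rewrite (count_split (fun A => A != L)) addnC leq_add //.
  rewrite -[X in (_ <= X)%N]/(nat_of_bool true) -hL -(count_uniq_mem L uls).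
  by apply: sub_count => A /= /andP[_]; rewrite negbK.
by apply: sub_count => A /= /andP[-> ->].
Qed.

(** The saving [4 d - 12] is the least possible size of [rest]: [12 d - 26] zeros minus at most
    [8 d - 14] neighbours. *)
Lemma simple_line_data L : L \in ls -> simple f L ->
  [/\ (size (nbs L) <= 8 * d - 14)%N,
      forall B, B \in nbs L -> (size [seq A <- nbs L | (A <= B + L)%MS] <= d.-1)%N &
      forall B B', B \in nbs L -> B' \in nbs L -> ~~ (B' <= B + L)%MS ->
        (size (skew B) + size (skew B') + (4 * d - 12) <= 2 * (d.-1 * (11 * d - 25)))%N].
Proof.
move=> hL sL; have lL := hls hL.
have hnb A : A \in nbs L -> [/\ lineX f A, A <> L & meet A L].
  by rewrite mem_filter => /andP[/andP[/eqP AL mA] hA]; split=> //; apply: hls.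
have [p [q [u [v [Y [rs [rest [U pL qL hY [[c c0 eO] prs srs snb]]]]]]]]] :=
  valency_data gf lL sL (filter_uniq _ uls) hnb.
have srest : (4 * d - 12 <= size rest)%N.
  have [_ _ d3 _] := gf; have := perm_size prs; rewrite srs size_cat size_map.
  by move: snb; move: (size _) (size _) => a b; clear -d3; lia.
have [p0 qp] := pq_indep U; have [rL _ _] := lL.
have sL' : (L <= q + p)%MS := span_line rL pL qL p0 qp.
have dir B : B \in nbs L -> exists e3 : 'rV[K]_4, [/\ (e3 <= B)%MS, ~~ (e3 <= L)%MS & (B + L <= e3 + (q + p))%MS].
  move=> /hnb[lB BL mB]; have [rB gB _] := lB; have [x [x0 xB xL]] := meetP mB.
  have [e3 e3B e3x] := line_basis x rB.
  have e3L : ~~ (e3 <= L)%MS by apply/negP => h; apply: BL; apply: (line_eq lB lL x0 e3x).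
  exists e3; split=> //; rewrite addsmx_sub (submx_trans sL' (addsmxSr _ _)) andbT.
  apply: submx_trans (span_line rB xB e3B x0 e3x) _; rewrite addsmx_sub addsmxSl.
  exact: submx_trans xL (submx_trans sL' (addsmxSr _ _)).
split=> // [B hB|B B' hB hB' nBB].
  have [e3 [e3B e3L pl]] := dir B hB.
  have h := plane_bound gf lL U pL qL uls hls (erefl _) hY e3L.
  apply: leq_trans h; rewrite !size_filter; apply: sub_count => A /= h.
  exact: submx_trans h pl.
have [e3 [e3B e3L pl]] := dir B hB; have /row_subPn[i hi] := nBB.
have pl' : (e3 + (q + p) <= B + L)%MS.
  by rewrite !addsmx_sub (submx_trans e3B (addsmxSl _ _)) (submx_trans qL (addsmxSr _ _)) (submx_trans pL (addsmxSr _ _)).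
have e3P : ~~ (row i B' <= e3 + (q + p))%MS.
  by apply: contra hi => h; apply: submx_trans h pl'.
have := two_planes gf lL U pL qL uls hls (erefl _) hY c0 eO prs srs hB hB' e3B (row_sub i B') e3L e3P.
by apply: leq_trans; rewrite leq_add2l.
Qed.

(** If [A] meets the two lines in different points, it lies in their plane. If the three lines are
    concurrent, that plane is the tangent plane at the common point and contains [A] too. *)
Lemma meet_two L1 L2 A : lineX f L1 -> lineX f L2 -> lineX f A -> L1 <> L2 -> meet L1 L2 ->
  meet A L1 -> meet A L2 -> (A <= L1 + L2)%MS.
Proof.
move=> l1 l2 lA L12 m12 /meetP[x1 [x10 x1A x1L]] /meetP[x2 [x20 x2A x2L]].
have [r1 g1 h1] := l1; have [r2 g2 _] := l2; have [rA _ _] := lA.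
have [x21|x21] := boolP (x2 <= x1)%MS; last first.
  apply: submx_trans (span_line rA x1A x2A x10 x21) _; rewrite addsmx_sub.
  by rewrite (submx_trans x2L (addsmxSr _ _)) (submx_trans x1L (addsmxSl _ _)).
have x1L2 : (x1 <= L2)%MS.
  have /sub_rVP[a ea] := x21; have a0 : a != 0 by apply: contraNneq x20 => a0; rewrite ea a0 scale0r.
  by rewrite -(scale1r x1) -(mulVf a0) -scalerA -ea scalemx_sub.
pose k := kermx (gradc f x1).
have tk B : lineX f B -> (x1 <= B)%MS -> (B <= k)%MS.
  by move=> lB xB; apply/row_subP => i; rewrite sub_kergrad (line_tangent lB xB) ?row_sub.
have s12 : (L1 + L2 <= k)%MS by rewrite addsmx_sub !tk.
have rk : (\rank k <= 3)%N by rewrite -ltnS; apply: (rank_kergrad gf x10 (h1 _ x1L)).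
have r12 : (2 < \rank (L1 + L2)%MS)%N.
  rewrite ltnNge; apply/negP => h; apply: L12; rewrite -g1 -g2; apply/genmxP.
  have e1 : (L1 + L2 <= L1)%MS.
    by have := mxrank_leqif_sup (addsmxSl L1 L2) => -[h4 <-]; rewrite eqn_leq h4 r1 h.
  have e2 : (L1 + L2 <= L2)%MS.
    by have := mxrank_leqif_sup (addsmxSr L1 L2) => -[h4 <-]; rewrite eqn_leq h4 r2 h.
  by rewrite (submx_trans (addsmxSl L1 L2) e2) (submx_trans (addsmxSr L1 L2) e1).
apply: submx_trans (tk A lA x1A) _; have := mxrank_leqif_sup s12 => -[h4 <-].
by rewrite eqn_leq h4 (leq_trans rk r12).
Qed.

(** This and the next two lemmas relate the nonlinear terms to [k ^ 2], so that linear arithmetic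
    can treat those terms as unknowns. *)
Lemma numerics_pencil k : (3 <= k)%N -> (k.-1 * (11 * k - 25) + 36 * k = 11 * k ^ 2 + 25)%N.
Proof. by case: k => [|[|[|k]]] // _; rewrite /= expnS expn1; nia. Qed.

Lemma numerics_flec k : (3 <= k)%N -> (k * (11 * k - 24) + 24 * k = 11 * k ^ 2)%N.
Proof. by case: k => [|[|[|k]]] // _; rewrite expnS expn1; nia. Qed.

Lemma numerics_sq k : (3 <= k)%N -> (6 * k <= k ^ 2 + 9)%N.
Proof. by case: k => [|[|[|k]]] // _; rewrite expnS expn1; nia. Qed.

Lemma line_bound : (size ls <= 11 * d ^ 2 - 30 * d + 18)%N.
Proof.
have [_ _ d3 _] := gf.
have eN := numerics_pencil d3; have eF := numerics_flec d3; have eS := numerics_sq d3.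
have [|m hm] := @seq_choice _ bool true (fun A b => b = true <-> ~ simple f A) ls.
  by move=> A _; have [s|s] := classic (simple f A); [exists false|exists true]; split.
have F1 := count_lines gf uls hls (fun A hA => proj1 (hm A hA)).
have [[L0 [hL0 sL0]]|ns] := classic (exists L, L \in ls /\ simple f L); last first.
  have cs : count m ls = size ls.
    apply/eqP; rewrite -all_count; apply/allP => A hA; apply/(hm A hA) => sA; apply: ns.
    by exists A.
  by clear -d3 F1 eF eS cs; move: (d ^ 2)%N (d * _)%N (count _ _) (size _) F1 eF eS cs => *; lia.
have F3 L : L \in ls -> (size (skew L) <= d.-1 * (11 * d - 25))%N.
  move=> hL; apply: (skew_lines_bound gf (hls hL)); first exact: filter_uniq.
  by move=> A; rewrite mem_filter => /andP[mA hA]; split=> //; apply: hls.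
(* A tight case: [1 + (6 d - 8) + (d - 1) (11 d - 25)] is exactly the bound. *)
have [[L [hL [sL vL]]]|big] := classic (exists L, L \in ls /\ simple f L /\ (size (nbs L) <= 6 * d - 8)%N).
  have h1 := size_lines hL; have h2 := F3 L hL.
  by clear -d3 h1 h2 vL eN eS; move: (d ^ 2)%N (d.-1 * _)%N (size _) (size _) (size _) h1 h2 vL eN eS => *; lia.
have valency L : L \in ls -> simple f L -> (6 * d - 7 <= size (nbs L))%N.
  move=> hL sL; rewrite leqNgt; apply/negP => h; apply: big; exists L; split=> //; split=> //.
  by clear -d3 h; move: (size _) h => z; lia.
have sub_ls L A : A \in nbs L -> A \in ls by rewrite mem_filter => /andP[].
(* Also tight: adding the counts from [B] and [B'] gives [2 (1 + 8 d - 14) + 2 (d - 1) (11 d - 25) -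
   (4 d - 12)], exactly twice the bound. *)
have [[L [B [B' [hL sL [hB sB hB' sB' nBB]]]]]|flat] := classic (exists L B B', [/\ L \in ls, simple f L &
    [/\ B \in nbs L, simple f B, B' \in nbs L, simple f B' & ~~ (B' <= B + L)%MS]]).
  have [_ _ h3] := simple_line_data hL sL; have {}h3 := h3 B B' hB hB' nBB.
  have [v1 _ _] := simple_line_data (sub_ls _ _ hB) sB; have [v2 _ _] := simple_line_data (sub_ls _ _ hB') sB'.
  have n1 := size_lines (sub_ls _ _ hB); have n2 := size_lines (sub_ls _ _ hB').
  clear -d3 h3 v1 v2 n1 n2 eN eS.
  move: (d ^ 2)%N (d.-1 * _)%N (size ls) (size (nbs B)) (size (nbs B')) (size (skew B)) (size (skew B')) h3 v1 v2 n1 n2 eN eS => *; lia.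
have inplane L B : L \in ls -> simple f L -> B \in nbs L -> simple f B ->
    forall A, A \in nbs L -> ~~ (A <= B + L)%MS -> m A.
  move=> hL sL hB sB A hA nA; apply/(hm A (sub_ls _ _ hA)) => sA; apply: flat.
  by exists L, B, A.
(* If [L0] has no simple neighbour, its at least [6 d - 7] neighbours are all non-simple, and
   [count_lines] suffices. *)
have [[L1 [h1 s1]]|none] := classic (exists L1, L1 \in nbs L0 /\ simple f L1); last first.
  have : (size (nbs L0) <= count m ls)%N.
    rewrite -size_filter; apply: uniq_leq_size; first exact: filter_uniq.
    move=> A hA; rewrite mem_filter (sub_ls _ _ hA) andbT; apply/(hm A (sub_ls _ _ hA)) => sA.
    by apply: none; exists A.
  have v0 := valency L0 hL0 sL0 => h.
  clear -d3 F1 v0 h eF eS; move: (d ^ 2)%N (d * _)%N (size _) (count _ _) (size _) F1 v0 h eF eS => *; lia.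
have h1' := sub_ls _ _ h1.
have [n10 m10] : L1 <> L0 /\ meet L1 L0.
  by move: h1; rewrite mem_filter => /andP[/andP[/eqP n10 m10] _].
have h0 : L0 \in nbs L1 by rewrite mem_filter hL0 andbT meetC m10 andbT; apply/eqP => /esym.
(* Neighbours outside the plane of [L0] and [L1] are non-simple. Each of the two lines has at least
   [(6 d - 7) - (d - 1) = 5 d - 6] of them, and no line is counted for both, since one meeting [L0]
   and [L1] lies in their plane. *)
pose O0 := [seq A <- nbs L0 | ~~ (A <= L1 + L0)%MS].
pose O1 := [seq A <- nbs L1 | ~~ (A <= L0 + L1)%MS].
have szO L B : L \in ls -> simple f L -> B \in nbs L ->
    (5 * d - 6 <= size [seq A <- nbs L | ~~ (A <= B + L)%MS])%N.
  move=> hL sL hB; have [_ h _] := simple_line_data hL sL; have {}h := h B hB.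
  have v := valency L hL sL; have e := count_predC (fun A => (A <= B + L)%MS) (nbs L).
  rewrite size_filter in h; rewrite size_filter.
  have {}e : (count (fun A => (A <= B + L)%MS) (nbs L) + count (fun A => ~~ (A <= B + L)%MS) (nbs L) = size (nbs L))%N by [].
  clear -d3 h v e; move: (count _ _) (count _ _) (size _) h v e => *; lia.
have : (size (O0 ++ O1) <= count m ls)%N.
  rewrite -size_filter; apply: uniq_leq_size.
    rewrite cat_uniq !filter_uniq //= andbT; apply/hasPn => A.
    rewrite mem_filter => /andP[nA hA]; apply/negP; rewrite mem_filter => /andP[_ hA'].
    case/negP: nA; rewrite addsmxC; apply: meet_two (hls h1') (hls hL0) (hls (sub_ls _ _ hA)) n10 m10 _ _.
      by move: hA; rewrite mem_filter => /andP[/andP[]].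
    by move: hA'; rewrite mem_filter => /andP[/andP[]].
  move=> A; rewrite mem_cat !mem_filter => /orP[] /andP[nA hA].
    by have /andP[_ hA'] := hA; rewrite hA' (inplane _ _ hL0 sL0 h1 s1) // mem_filter.
  by have /andP[_ hA'] := hA; rewrite hA' (inplane _ _ h1' s1 h0 sL0) // mem_filter.
have s0' := szO _ _ hL0 sL0 h1; have s1' := szO _ _ h1' s1 h0 => h.
rewrite size_cat in h; clear -d3 F1 s0' s1' h eF eS.
move: (d ^ 2)%N (d * _)%N (size _) (size _) (count _ _) (size _) F1 s0' s1' h eF eS => *; lia.
Qed.
End Final.

(** * From coefficient families to polynomials *)

Section FormPolynomial.
Variables (K : closedFieldType) (d : nat) (c : hform K d).

Definition mon_multinom (e : mon d) : 'X_{1..4} := [multinom (e i : nat) | i < 4].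
Definition form_mpoly : {mpoly K[4]} := \sum_(e : mon d | is_degd e) c e *: 'X_[mon_multinom e].

Lemma ev_monomial (x : 'rV[K]_4) (m : 'X_{1..4}) : ev x 'X_[m] = \prod_(j < 4) x 0 j ^+ m j.
Proof. by rewrite mpolyXE_id rmorph_prod; apply: eq_bigr => j _; rewrite rmorphXn /= mevX. Qed.

Lemma ev_form x : ev x form_mpoly = heval c x.
Proof.
rewrite /form_mpoly /heval raddf_sum; apply: eq_bigr => e _ /=.
by rewrite mevZ ev_monomial; congr (_ * _); apply: eq_bigr => j _; rewrite mnmE.
Qed.

Lemma ev_form_deriv i x : ev x form_mpoly^`M(i) = hderiv c i x.
Proof.
rewrite /form_mpoly /hderiv (raddf_sum (mderiv i)) raddf_sum; apply: eq_bigr => e _ /=.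
rewrite mderivZ mderivX !mevZ ev_monomial mnmE /= -!mulrA; congr (_ * (_ * _)).
rewrite (bigD1 i) //= mnmBE mnmE mnm1E eqxx subn1; congr (_ * _).
by apply: eq_bigr => j ji; rewrite mnmBE mnmE mnm1E eq_sym (negPf ji) subn0.
Qed.

Lemma form_dhomog : form_mpoly \is d.-homog.
Proof.
apply: rpred_sum => e /eqP de; apply: rpredZ; rewrite dhomogX; apply/eqP.
by rewrite -[LHS]/(mdeg (mon_multinom e)) mdegE -[RHS]de; apply: eq_bigr => i _; rewrite mnmE.
Qed.

Lemma genmx_lineX (A : 'M[K]_(2, 4)) : is_line A -> line_on c A -> lineX form_mpoly <<A>>%MS.
Proof.
move=> /eqP rA hA; split; first by rewrite genmxE.
  exact: genmx_id.
by move=> x; rewrite genmxE => /submxP[u ->]; rewrite ev_form.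
Qed.

End FormPolynomial.

Theorem theorem1p1 (K : closedFieldType) (d : nat) (hd : (3 <= d)%N)
  (hchar : forall p : nat, p \in [pchar K] -> (d < p)%N)
  (c : hform K d) (hsmooth : smooth_surface c)
  (Ls : seq 'M[K]_(2, 4))
  (hlines : forall A, A \in Ls -> is_line A /\ line_on c A)
  (hdistinct : forall (i j : nat), (i < size Ls)%N -> (j < size Ls)%N -> i <> j ->
     ~~ same_line (nth 0 Ls i) (nth 0 Ls j)) :
  (size Ls <= 11 * d ^ 2 - 30 * d + 18)%N.
Proof.
have gf : good d (form_mpoly c).
  split=> //; first exact: form_dhomog.
  move=> x x0 [ex dx]; apply: (hsmooth x x0); split; first by rewrite -ev_form.
  by move=> i; rewrite -ev_form_deriv.
rewrite -(size_map (fun A => <<A>>%MS : 'M[K]_4)); apply: (line_bound gf).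
  apply/(uniqP 0) => i j; rewrite !inE !size_map => hi hj.
  rewrite !(nth_map 0) // => /genmxP e.
  by apply/eqP; apply: contraLR e => /eqP ij; apply: hdistinct.
by move=> A /mapP[B /hlines[h1 h2] ->]; apply: genmx_lineX.
Qed.
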